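(* Let $\psi\in X=H^2_0(\Omega)$ be the solution of the weak problem $$a(\psi,\chi)+b(\psi;\psi,\chi)+c(\psi,\chi)=\ell(\chi)\quad\text{for all }\chi\in X,$$ let $\psi^H\in X^H$ be the solution of the nonlinear coarse-mesh problem $$a(\psi^H,\chi^H)+b(\psi^H;\psi^H,\chi^H)+c(\psi^H,\chi^H)=\ell(\chi^H)\quad\text{for all }\chi^H\in X^H,$$ and let $\psi^h\in X^h$ be the solution of the linear fine-mesh problem $$a(\psi^h,\chi^h)+b(\psi^H;\psi^h,\chi^h)+c(\psi^h,\chi^h)=\ell(\chi^h)\quad\text{for all }\chi^h\in X^h.$$ Then $$|\psi-\psi^h|_2\le C_1\inf_{\lambda^h\in X^h}|\psi-\lambda^h|_2+C_2\sqrt{|\ln h|}\,|\psi-\psi^H|_1,$$ where $C_1=2+Re\,Ro^{-1}\,\Gamma_2+Re^2\,Ro^{-1}\,\Gamma_1\|F\|_{-2}$ and $C_2=2\,Re^2\,Ro^{-1}\,C\,\|F\|_{-2}$.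
   Context: $\Omega\subset\mathbb{R}^2$ is a bounded simply connected domain, $Re>0$ and $Ro>0$ are constants (Reynolds and Rossby numbers), $F\in H^{-2}(\Omega)$, and $X=H^2_0(\Omega)$ (functions in $H^2(\Omega)$ with $\psi=\partial\psi/\partial\vec n=0$ on $\partial\Omega$). The forms on $X$ are $$a(\psi,\chi)=Re^{-1}\int_\Omega\Delta\psi\,\Delta\chi\,d\vec x,\qquad b(\zeta;\psi,\chi)=\int_\Omega\Delta\zeta\,(\psi_y\chi_x-\psi_x\chi_y)\,d\vec x,$$ $$c(\psi,\chi)=-Ro^{-1}\int_\Omega\psi_x\chi\,d\vec x,\qquad \ell(\chi)=Ro^{-1}\int_\Omega F\chi\,d\vec x,$$ the last integral being the duality pairing of $H^{-2}(\Omega)$ and $H^2_0(\Omega)$. Seminorms and norms: $|v|_1=\|\nabla v\|_{L^2(\Omega)}$; $|v|_2=\left(\int_\Omega v_{xx}^2+2v_{xy}^2+v_{yy}^2\,d\vec x\right)^{1/2}$, which equals $\|\Delta v\|_{L^2(\Omega)}$ on $H^2_0(\Omega)$ and is a norm there; $\|F\|_{-2}=\sup_{0\ne\chi\in X}|\langle F,\chi\rangle|/|\chi|_2$. $\Gamma_1,\Gamma_2>0$ are constants such that, for all $\zeta,\psi,\chi\in X$, $b(\zeta;\psi,\chi)\le\Gamma_1|\zeta|_2|\psi|_2|\chi|_2$ and $c(\psi,\chi)\le Ro^{-1}\Gamma_2|\psi|_2|\chi|_2$. $X^H,X^h\subset X$ are conforming finite element spaces (finite-dimensional subspaces of $H^2_0(\Omega)$)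 on triangulations of $\Omega$ with mesh sizes (maximum triangle diameters) $H>h>0$. The fine space satisfies the inverse inequality $\|\nabla\varphi^h\|_{L^\infty}\le c_0\sqrt{|\ln h|}\,|\varphi^h|_2$ for all $\varphi^h\in X^h$, with $c_0$ independent of $h$. Define $$b_0(\xi;\chi,\psi)=\int_\Omega(\xi_y\chi_{xy}-\xi_x\chi_{yy})\psi_y-(\xi_x\chi_{xy}-\xi_y\chi_{xx})\psi_x\,d\vec x .$$ $C>0$ denotes a constant, independent of $h$, such that for all $\chi^h\in X^h$ and $\psi,\xi\in H^2_0(\Omega)$, $$|b_0(\psi;\chi^h,\xi)|\le C\sqrt{|\ln h|}\,|\psi|_2\,|\xi|_1\,|\chi^h|_2 .$$ Standing assumption: the data $Re,Ro,F$ satisfy a small data condition ensuring that the weak problem and the nonlinear coarse-mesh problem each have a unique solution. *)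

(* Defs.v *)
(* The plane is R * R, with the product of the one-dimensional Lebesgue
   measures. *)
From HB Require Import structures.
From mathcomp Require Import all_boot all_order all_algebra.
From mathcomp Require Import all_classical all_reals all_analysis.

Set Implicit Arguments.
Unset Strict Implicit.
Unset Printing Implicit Defensive.

Import Order.TTheory GRing.Theory Num.Theory.
Import numFieldNormedType.Exports.

Local Open Scope classical_set_scope.
Local Open Scope ring_scope.

Notation plane R := (R * R)%type.

Definition mu2 (R : realType) :=
  (@lebesgue_measure R \x @lebesgue_measure R)%E.

Definition integ (R : realType) (Om : set (plane R)) (f : plane R -> R) : R :=
  \int[@mu2 R]_(z in Om) f z.

(** * Domains *)

Definition loop_in (R : realType) (Om : set (plane R)) (g : R -> plane R) :=
  [/\ {within `[0, 1], continuous g},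
      forall t, 0 <= t <= 1 -> Om (g t) & g 0 = g 1].

(* Every loop in Om contracts in Om to its base point. *)
Definition simply_connected (R : realType) (Om : set (plane R)) :=
  connected Om /\
  forall g, loop_in Om g -> exists G : plane R -> plane R,
    [/\ {within (`[0, 1] `*` `[0, 1]), continuous G},
        forall s t, 0 <= s <= 1 -> 0 <= t <= 1 -> Om (G (s, t)),
        forall t, 0 <= t <= 1 -> G (0, t) = g t /\ G (1, t) = g 0 &
        forall s, 0 <= s <= 1 -> G (s, 0) = g 0 /\ G (s, 1) = g 0].

Definition bounded_sc_domain (R : realType) (Om : set (plane R)) :=
  [/\ open Om, Om !=set0, bounded_set Om & simply_connected Om].

(** * Test functions *)

Definition dirx (R : realType) : plane R := (1, 0).
Definition diry (R : realType) : plane R := (0, 1).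

Fixpoint Cn (R : realType) (n : nat) (f : plane R -> R) : Prop :=
  continuous f /\
  if n is m.+1 then
    [/\ forall z, derivable f z (dirx R) /\ derivable f z (diry R),
        Cn m ('D_(dirx R) f) & Cn m ('D_(diry R) f)]
  else True.

(* \partial_x^i \partial_y^j f, classical *)
Definition partial (R : realType) (i j : nat) (f : plane R -> R) :
    plane R -> R :=
  iter i (fun g => 'D_(dirx R) g) (iter j (fun g => 'D_(diry R) g) f).

(* C_c^\infty(Om); a test function is extended by 0 to the whole plane. *)
Definition test_fun (R : realType) (Om : set (plane R)) : set (plane R -> R) :=
  [set f | [/\ forall n, Cn n f,
               compact (closure [set z | f z != 0]) &
               closure [set z | f z != 0] `<=` Om]].

(** * Weak derivatives and Sobolev spaces *)

(* Functions on Om are functions on the plane whose values outside Om are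
   irrelevant; they are not quotiented by almost everywhere equality. *)

Definition L2 (R : realType) (Om : set (plane R)) : set (plane R -> R) :=
  [set f | measurable_fun (Om : set (measurableTypeR R * measurableTypeR R))
             (f : measurableTypeR R * measurableTypeR R -> R) /\
           (\int[@mu2 R]_(z in Om) ((f z) ^+ 2)%:E < +oo)%E].

Definition is_wderiv (R : realType) (Om : set (plane R)) (i j : nat)
    (u g : plane R -> R) :=
  L2 Om g /\
  forall p, test_fun Om p ->
    integ Om (fun z => u z * partial i j p z) =
    (-1) ^+ (i + j) * integ Om (fun z => g z * p z).

(* A representative of the weak derivative \partial_x^i \partial_y^j u in
   L^2(Om), which is unique up to equality almost everywhere in Om; the zero
   function if there is none. *)
Definition wderiv (R : realType) (Om : set (plane R)) (i j : nat)
    (u : plane R -> R) : plane R -> R :=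
  xget (fun=> 0) [set g | is_wderiv Om i j u g].

Definition H2 (R : realType) (Om : set (plane R)) : set (plane R -> R) :=
  [set u | L2 Om u /\
           forall i j, (i + j <= 2)%N -> exists g, is_wderiv Om i j u g].

Definition dx (R : realType) (Om : set (plane R)) := @wderiv R Om 1 0.
Definition dy (R : realType) (Om : set (plane R)) := @wderiv R Om 0 1.
Definition dxx (R : realType) (Om : set (plane R)) := @wderiv R Om 2 0.
Definition dxy (R : realType) (Om : set (plane R)) := @wderiv R Om 1 1.
Definition dyy (R : realType) (Om : set (plane R)) := @wderiv R Om 0 2.

Definition lap (R : realType) (Om : set (plane R)) (u : plane R -> R) :
  plane R -> R := fun z => dxx Om u z + dyy Om u z.

Definition semi1 (R : realType) (Om : set (plane R)) (u : plane R -> R) : R :=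
  Num.sqrt (integ Om (fun z => dx Om u z ^+ 2 + dy Om u z ^+ 2)).

Definition semi2 (R : realType) (Om : set (plane R)) (u : plane R -> R) : R :=
  Num.sqrt (integ Om (fun z =>
    dxx Om u z ^+ 2 + 2 * dxy Om u z ^+ 2 + dyy Om u z ^+ 2)).

Definition normH2 (R : realType) (Om : set (plane R)) (u : plane R -> R) : R :=
  Num.sqrt (integ Om (fun z => u z ^+ 2) + semi1 Om u ^+ 2 + semi2 Om u ^+ 2).

(* The functions of H^2(Om) with vanishing value and normal derivative on the
   boundary, i.e. the closure of C_c^\infty(Om) in H^2(Om); this needs no
   regularity of the boundary. *)
Definition H20 (R : realType) (Om : set (plane R)) : set (plane R -> R) :=
  [set u | H2 Om u /\
           forall e, 0 < e -> exists2 p, test_fun Om p & normH2 Om (u - p) < e].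

(* the L^\infty(Om) norm of the Euclidean norm of the gradient *)
Definition grad_sup (R : realType) (Om : set (plane R)) (u : plane R -> R) :
    \bar R :=
  'N[@mu2 R]_+oo[
    EFin \o ((fun z => Num.sqrt (dx Om u z ^+ 2 + dy Om u z ^+ 2)) \_ Om)]%E.

Definition eq_on (R : realType) (Om : set (plane R)) (u v : plane R -> R) :=
  {ae @mu2 R, forall z, Om z -> u z = v z}.

(** * The space H^{-2}(Om) *)

(* Bounded linear functionals on H20 Om normed by semi2; their values outside
   H20 Om are irrelevant. *)
Definition Hm2 (R : realType) (Om : set (plane R)) :
    set ((plane R -> R) -> R) :=
  [set F | (forall (k : R) u v, H20 Om u -> H20 Om v ->
              F (fun z => k * u z + v z) = k * F u + F v) /\
           (exists M, forall u, H20 Om u -> `|F u| <= M * semi2 Om u)].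

Definition normHm2 (R : realType) (Om : set (plane R))
    (F : (plane R -> R) -> R) : R :=
  sup [set `|F u| / semi2 Om u | u in
        [set u | H20 Om u /\ ~ eq_on Om u (fun=> 0)]].

(** * Forms *)

Definition form_a (R : realType) (Om : set (plane R)) (Re : R)
    (psi chi : plane R -> R) : R :=
  Re^-1 * integ Om (fun z => lap Om psi z * lap Om chi z).

Definition form_b (R : realType) (Om : set (plane R))
    (zeta psi chi : plane R -> R) : R :=
  integ Om (fun z =>
    lap Om zeta z * (dy Om psi z * dx Om chi z - dx Om psi z * dy Om chi z)).

Definition form_c (R : realType) (Om : set (plane R)) (Ro : R)
    (psi chi : plane R -> R) : R :=
  - Ro^-1 * integ Om (fun z => dx Om psi z * chi z).

Definition form_l (R : realType) (Ro : R) (F : (plane R -> R) -> R)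
    (chi : plane R -> R) : R := Ro^-1 * F chi.

Definition form_b0 (R : realType) (Om : set (plane R))
    (xi chi psi : plane R -> R) : R :=
  integ Om (fun z =>
    (dy Om xi z * dxy Om chi z - dx Om xi z * dyy Om chi z) * dy Om psi z
    - (dx Om xi z * dxy Om chi z - dy Om xi z * dxx Om chi z) * dx Om psi z).

(** * Galerkin problems *)

(* With V = H20 Om this is the weak problem. *)
Definition nonlinear_sol (R : realType) (Om : set (plane R)) (Re Ro : R)
    (F : (plane R -> R) -> R) (V : set (plane R -> R)) (psi : plane R -> R) :=
  V psi /\ forall chi, V chi ->
    form_a Om Re psi chi + form_b Om psi psi chi + form_c Om Ro psi chi
    = form_l Ro F chi.

Definition linear_sol (R : realType) (Om : set (plane R)) (Re Ro : R)
    (F : (plane R -> R) -> R) (psiH : plane R -> R) (V : set (plane R -> R))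
    (psi : plane R -> R) :=
  V psi /\ forall chi, V chi ->
    form_a Om Re psi chi + form_b Om psiH psi chi + form_c Om Ro psi chi
    = form_l Ro F chi.

Definition uniquely_solvable (R : realType) (Om : set (plane R)) (Re Ro : R)
    (F : (plane R -> R) -> R) (V : set (plane R -> R)) :=
  exists2 psi, nonlinear_sol Om Re Ro F V psi &
    forall psi', nonlinear_sol Om Re Ro F V psi' -> eq_on Om psi' psi.

(** * Triangulations and finite element spaces *)

Definition hull (R : realType) (s : seq (plane R)) : set (plane R) :=
  [set z | exists w : 'I_(size s) -> R,
     [/\ forall i, 0 <= w i, \sum_i w i = 1 &
         z = \sum_i w i *: nth (0 : plane R) s i]].

(* The product norm on the plane is the max norm, whence an explicit
   Euclidean distance. *)
Definition edist (R : realType) (y z : plane R) : R :=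
  Num.sqrt ((y.1 - z.1) ^+ 2 + (y.2 - z.2) ^+ 2).

Definition diameter (R : realType) (A : set (plane R)) : R :=
  sup [set edist p.1 p.2 | p in A `*` A].

Definition nondegenerate_triangle (R : realType) (t : 3.-tuple (plane R)) :=
  let p := tnth t 0 in let q := tnth t 1 in let r := tnth t 2%:R in
  (q.1 - p.1) * (r.2 - p.2) - (q.2 - p.2) * (r.1 - p.1) != 0.

(* Two distinct triangles meet along the hull of their common vertices: the
   empty set, a common vertex or a common edge. *)
Definition triangulation (R : realType) (Om : set (plane R))
    (T : seq (3.-tuple (plane R))) :=
  [/\ {in T, forall t, nondegenerate_triangle t},
      {in T &, forall t t', t != t' ->
         (size [seq v <- t | v \in tval t'] < 3)%N /\
         hull t `&` hull t' = hull [seq v <- t | v \in tval t']} &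
      \bigcup_(t in [set` T]) hull t = closure Om].

Definition mesh_size (R : realType) (T : seq (3.-tuple (plane R))) : R :=
  \big[Num.max/0]_(t <- T) diameter (hull t).

Definition fe_space (R : realType) (Om : set (plane R))
    (T : seq (3.-tuple (plane R))) (V : set (plane R -> R)) :=
  [/\ triangulation Om T, V `<=` H20 Om &
      exists n (e : 'I_n -> plane R -> R),
        V = [set (fun z => \sum_(i < n) k i * e i z) | k in [set: 'I_n -> R]]].

(* Main.v *)
(* For lambda in X^h put eta = psi - lambda, phi = psi^h - lambda and
   zeta = psi - psi^H.  Subtracting the two problems tested with phi gives
     a(phi, phi) = a(eta, phi) + b(psi; eta, phi) + c(eta, phi)
                   + b(zeta; lambda, phi),
   because b(psi^H; phi, phi) = c(phi, phi) = 0 and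
   b(psi; lambda, phi) = b(psi^H; lambda, phi) + b(zeta; lambda, phi).
   Since lambda and phi both lie in X^h, the two terms of
     b(zeta; lambda, phi) = b0(phi; lambda, zeta) - b0(lambda; phi, zeta)
   are controlled by the logarithmic estimate for b0.  Replacing lambda by a
   suitable multiple, which is not further from psi, one may assume
   |lambda|_2 <= |psi|_2, and |psi|_2 <= Re Ro^-1 |F|_{-2}.

   The identities |v|_2 = |lap v|, c(v, v) = 0 and the one for b are checked on
   test functions and extended to H^2_0 by density.  This uses the uniqueness of
   weak derivatives, and, for the trilinear forms to be continuous, that
   gradients of functions in H^2_0 are in L^4 (Gagliardo-Nirenberg). *)

Require Import Defs.
From HB Require Import structures.
From mathcomp Require Import all_boot all_order all_algebra.
From mathcomp Require Import all_classical all_reals all_analysis.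
From mathcomp Require Import measurable_realfun ring lra.
Import Order.TTheory GRing.Theory Num.Theory.
Import numFieldNormedType.Exports.
Local Open Scope classical_set_scope.
Local Open Scope ring_scope.
Set Implicit Arguments.
Unset Strict Implicit.
Unset Printing Implicit Defensive.

(** The obstacle is [b(zeta; lambda, phi)]: it contains the Laplacian of [zeta], so a direct
    estimate would cost |psi - psi^H|_2. Passing to [form_b0] moves one derivative from [zeta] onto
    the Jacobian of the other two arguments, and only |psi - psi^H|_1 remains; the price is the
    factor |lambda|_2. In C1 the constant 2 is 1 + 1, from the triangle inequality and from a(eta,
    phi); in C2 the 2 counts the two [form_b0] terms. One factor Re comes from clearing Re^-1 in
    a(phi, phi), and the group Re Ro^-1 |F|_{-2} is the bound on |psi|_2. Uniqueness of weak
    derivatives rests on explicit test functions: products of exp(-1/x) profiles that tend to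
    indicators of open rectangles, combined with dominated convergence and a pi-lambda argument.
    These products separate the variables, so their mixed derivatives commute by inspection, and the
    symmetry of mixed derivatives of an arbitrary test function follows almost everywhere by
    duality. Equality almost everywhere suffices throughout, since [wderiv] is itself only a chosen
    representative. *)

Lemma discriminant_le (R : realType) (a b c : R) : 0 <= c ->
  (forall t, 0 <= a + t * (2 * b) + t ^+ 2 * c) -> b ^+ 2 <= a * c.
Proof.
rewrite le_eqVlt => /predU1P[<-|c0] h.
  rewrite mulr0; case: (eqVneq b 0) => [->|b0]; first by rewrite expr0n.
  (* For [c = 0] the hypothesis is affine in [t]; this [t] gives it the value -1, a
     contradiction. *)
  have := h (- (a + 1) / (2 * b)).
  rewrite mulr0 addr0 divfK ?mulf_neq0 //; lra.
have := h (- b / c).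
have -> : a + - b / c * (2 * b) + (- b / c) ^+ 2 * c = (a * c - b ^+ 2) / c.
  by field; rewrite gt_eqF.
by rewrite pmulr_lge0 ?invr_gt0 // subr_ge0.
Qed.

(** * Square-integrable functions on a measure space *)

Section l2_calculus.
Context d (T : measurableType d) (R : realType).
Variables (mu : {measure set T -> \bar R}) (D : set T) (mD : measurable D).
Implicit Types f g h u v : T -> R.

Definition intg f := mu.-integrable D (EFin \o f).

(** The condition defining [L2], over an arbitrary measure: for [mu2] the two are convertible, so
    the results proved here transfer directly. *)
Definition sqi f :=
  measurable_fun D f /\ (\int[mu]_(z in D) ((f z) ^+ 2)%:E < +oo)%E.

Local Notation I := (Rintegral mu D).

Lemma intg_meas f : intg f -> measurable_fun D f.
Proof. by move/measurable_int/measurable_EFinP. Qed.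

Lemma intgD f g : intg f -> intg g -> intg (fun z => f z + g z).
Proof. by move=> hf hg; exact: (integrableD mD hf hg). Qed.

Lemma intgB f g : intg f -> intg g -> intg (fun z => f z - g z).
Proof. by move=> hf hg; exact: (integrableB mD hf hg). Qed.

Lemma intgZ k f : intg f -> intg (fun z => k * f z).
Proof. by move=> hf; exact: (integrableZl mD k hf). Qed.

Lemma le_intg f g : measurable_fun D f -> intg g ->
  (forall z, D z -> `|f z| <= g z) -> intg f.
Proof.
move=> mf ig fg; apply: le_integrable (ig) => //; first exact/measurable_EFinP.
by move=> z Dz; rewrite /= lee_fin (le_trans (fg z Dz)) // ler_norm.
Qed.

Lemma ae_eqI f g : measurable_fun D f -> measurable_fun D g ->
  {ae mu, forall z, D z -> f z = g z} -> I f = I g.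
Proof.
move=> mf mg fg; rewrite /Rintegral; congr fine.
apply: ae_eq_integral => //; try exact/measurable_EFinP.
by apply: filterS fg => z h Dz; rewrite h.
Qed.

Lemma eq_intg f g : (forall z, D z -> f z = g z) -> intg f -> intg g.
Proof.
by move=> h; apply: eq_integrable => // z /set_mem/h /= ->.
Qed.

Lemma sqiP f : sqi f <-> measurable_fun D f /\ intg (fun z => f z ^+ 2).
Proof.
split=> -[mf h]; split=> //.
  apply/integrableP; split.
    by apply/measurable_EFinP; exact: measurable_funX.
  rewrite (le_lt_trans _ h) //; under eq_integral do
    rewrite /= ger0_norm ?sqr_ge0//.
  exact: lexx.
move/integrableP : h => [_]; apply: le_lt_trans.
under [leRHS]eq_integral do rewrite /= ger0_norm ?sqr_ge0//.
exact: lexx.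
Qed.

Lemma sqi_meas f : sqi f -> measurable_fun D f. Proof. by case. Qed.

Lemma sqi_sq f : sqi f -> intg (fun z => f z ^+ 2).
Proof. by move/sqiP => []. Qed.

Lemma sqiM f g : sqi f -> sqi g -> intg (fun z => f z * g z).
Proof.
move=> hf hg.
apply: (@le_intg _ (fun z => f z ^+ 2 + g z ^+ 2)).
- exact: measurable_funM (sqi_meas hf) (sqi_meas hg).
- exact: intgD (sqi_sq hf) (sqi_sq hg).
- move=> z _; rewrite ler_norml; apply/andP; split; nra.
Qed.

Lemma sqi_lin k f g : sqi f -> sqi g -> sqi (fun z => k * f z + g z).
Proof.
move=> hf hg; have mf := sqi_meas hf; have mg := sqi_meas hg.
apply/sqiP; split.
  apply: measurable_funD => //; exact: measurable_funM.
have h := intgD (intgZ (k ^+ 2) (sqi_sq hf))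
  (intgD (intgZ (2 * k) (sqiM hf hg)) (sqi_sq hg)).
apply: eq_intg h => z _ /=; ring.
Qed.

Lemma sqi_eq f g : (forall z, D z -> f z = g z) -> sqi f -> sqi g.
Proof.
move=> h /sqiP[mf hf]; apply/sqiP; split.
  by apply: eq_measurable_fun mf => z /set_mem/h.
by apply: eq_intg hf => z /h ->.
Qed.


Lemma sqiD f g : sqi f -> sqi g -> sqi (fun z => f z + g z).
Proof.
by move=> hf hg; apply: sqi_eq (sqi_lin 1 hf hg) => z _; rewrite mul1r.
Qed.

Lemma sqiB f g : sqi f -> sqi g -> sqi (fun z => f z - g z).
Proof.
by move=> hf hg; apply: sqi_eq (sqi_lin (-1) hg hf) => z _; rewrite mulN1r addrC.
Qed.

(** The integral of (f + t g)^2 is a nonnegative quadratic polynomial in t, so its discriminant has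
    a sign. *)
Lemma cauchy_schwarz f g : sqi f -> sqi g ->
  I (fun z => f z * g z) ^+ 2 <= I (fun z => f z ^+ 2) * I (fun z => g z ^+ 2).
Proof.
move=> hf hg; apply: discriminant_le => [|t].
  by apply: Rintegral_ge0 => z _; exact: sqr_ge0.
have hfg := sqiM hf hg; have hff := sqi_sq hf; have hgg := sqi_sq hg.
have <- : I (fun z => (f z + t * g z) ^+ 2) = I (fun z => f z ^+ 2) +
    t * (2 * I (fun z => f z * g z)) + t ^+ 2 * I (fun z => g z ^+ 2).
  rewrite mulrA -!RintegralZl // -!RintegralD //; try by do ?[apply: intgD|apply: intgZ].
  by apply: eq_Rintegral => z _; ring.
by apply: Rintegral_ge0 => z _; exact: sqr_ge0.
Qed.

Lemma cauchy_schwarz_norm f g : sqi f -> sqi g ->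
  `|I (fun z => f z * g z)| <=
    Num.sqrt (I (fun z => f z ^+ 2)) * Num.sqrt (I (fun z => g z ^+ 2)).
Proof.
move=> hf hg; rewrite -sqrtrM; last by apply: Rintegral_ge0 => z _; exact: sqr_ge0.
by rewrite -sqrtr_sqr; apply: ler_wsqrtr; exact: cauchy_schwarz.
Qed.

(* [f z ^+ 2] is truncated at height [M]; the truncated fourth power is
   Lipschitz, so its integral passes to the [L^2] limit. *)
Lemma sqi_sqr_limit f (K : R) : sqi f ->
  (forall e, 0 < e -> exists g, [/\ sqi g, sqi (fun z => g z ^+ 2),
     I (fun z => (f z - g z) ^+ 2) <= e &
     I (fun z => (g z ^+ 2) ^+ 2) <= K]) ->
  sqi (fun z => f z ^+ 2) /\ I (fun z => (f z ^+ 2) ^+ 2) <= K.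
Proof.
move=> hf happ; have mf := sqi_meas hf; have hff := sqi_sq hf.
have mf2 : measurable_fun D (fun z => f z ^+ 2) by exact: measurable_funX.
pose h (M : R) (x : R) := Num.min (x ^+ 2) M ^+ 2.
have hle M x : 0 <= M -> h M x <= M * x ^+ 2 /\ h M x <= (x ^+ 2) ^+ 2 /\ 0 <= h M x.
  move=> M0; rewrite /h; have := sqr_ge0 x; move: (x ^+ 2) => {}x.
  by case: (leP x M) => hM x0; (split; last split); rewrite ?expr2; nra.
have mh M g : measurable_fun D g -> measurable_fun D (fun z => h M (g z)).
  move=> mg; apply: measurable_funX.
  by apply: measurable_minr; [exact: measurable_funX|exact: measurable_cst].
have ih M g : 0 <= M -> sqi g -> intg (fun z => h M (g z)).
  move=> M0 hg; apply: (@le_intg _ (fun z => M * g z ^+ 2)).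
  - exact: mh (sqi_meas hg).
  - exact: intgZ (sqi_sq hg).
  - by move=> z _; rewrite ger0_norm; apply hle.
(* As a function of s = x^2, the square of min(s, M) has slope at most 2 M. *)
have lip M x y : 0 <= M -> h M x <= h M y + 2 * M * `|x ^+ 2 - y ^+ 2|.
  move=> M0; rewrite /h; have := sqr_ge0 x; have := sqr_ge0 y.
  move: (x ^+ 2) (y ^+ 2) => {}x {}y.
  move=> y0 x0; have a0 := normr_ge0 (x - y); have a1 := ler_norm (x - y).
  have p0 := mulr_ge0 M0 a0.
  have p1 : M * (x - y) <= M * `|x - y| by rewrite ler_wpM2l.
  by case: (leP x M) => hx; case: (leP y M) => hy; case: (leP x y) => hxy; nra.
have hmono (n m : nat) x : (n <= m)%N -> h n%:R x <= h m%:R x.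
  rewrite -(ler_nat R) /h => nm; have := sqr_ge0 x; have := ler0n R n.
  move: (x ^+ 2) n%:R m%:R nm => {}x a b ab.
  by rewrite /Num.min; case: ltP => ?; case: ltP => ? *; nra.
(* Young's inequality with weight [del]: the difference of squares costs a large multiple of (x -
   y)^2, which the approximation makes small, and a small multiple of x^2, whose integral is
   fixed. *)
have absB_sq_le (x y del : R) : 0 < del ->
    `|x ^+ 2 - y ^+ 2| <= (1 + del^-1) * (x - y) ^+ 2 + del * x ^+ 2.
  move=> d0; have : 0 <= del^-1 * (del * `|x| - `|x - y|) ^+ 2.
    by rewrite mulr_ge0 ?sqr_ge0 // invr_ge0 ltW.
  have -> : del^-1 * (del * `|x| - `|x - y|) ^+ 2 =
     del * x ^+ 2 + del^-1 * (x - y) ^+ 2 - 2 * (`|x| * `|x - y|).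
    rewrite -(real_normK (num_real x)) -(real_normK (num_real (x - y))).
    by field; rewrite gt_eqF.
  have -> : x ^+ 2 - y ^+ 2 = (x - y) * (2 * x - (x - y)) by ring.
  rewrite normrM => h0.
  have : `|2 * x - (x - y)| <= 2 * `|x| + `|x - y|.
    by rewrite (le_trans (ler_normB _ _)) // normrM ger0_norm.
  have := normr_ge0 (x - y); rewrite -(real_normK (num_real (x - y))).
  move: h0; rewrite -(real_normK (num_real (x - y))); nra.
have trunc M : 0 <= M -> I (fun z => h M (f z)) <= K.
  move=> M0; apply/ler_addgt0Pr => e e0.
  have I0 : 0 <= I (fun z => f z ^+ 2) by apply: Rintegral_ge0 => z _; exact: sqr_ge0.
  (* The error [e] is halved between the two terms of the Young bound: [del] is chosen through [A]
     for the fixed integral, then the quality of [g] through [B]. The added 1 keeps both divisors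
     positive. *)
  pose A := 2 * M * I (fun z => f z ^+ 2) + 1.
  have A0 : 0 < A by rewrite /A; nra.
  pose del := e / 2 / A.
  have del0 : 0 < del by rewrite /del !divr_gt0.
  pose B := 2 * M * (1 + del^-1) + 1.
  have di0 : 0 < del^-1 by rewrite invr_gt0.
  have B0 : 0 < B by rewrite /B; nra.
  have [g [hg hg2 hfg hgK]] := happ (e / 2 / B) ltac:(by rewrite !divr_gt0).
  have hd := sqiB hf hg.
  have i1 := intgZ (2 * M * (1 + del^-1)) (sqi_sq hd).
  have i2 := intgZ (2 * M * del) hff.
  have := @le_Rintegral _ _ _ mu D (fun z => h M (f z)) (fun z => (g z ^+ 2) ^+ 2 +
     (2 * M * (1 + del^-1) * (f z - g z) ^+ 2 + 2 * M * del * f z ^+ 2))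
     mD (ih _ _ M0 hf) (intgD (sqi_sq hg2) (intgD i1 i2)).
  rewrite RintegralD ?RintegralD ?RintegralZl //; [| exact: sqi_sq hd | exact: sqi_sq hg2 | exact: intgD].
  move=> /(_ _)/le_trans; apply.
    move=> z _; apply: (le_trans (lip _ _ (g z) M0)); apply: lerD.
      by apply hle.
    have -> : 2 * M * (1 + del^-1) * (f z - g z) ^+ 2 + 2 * M * del * f z ^+ 2 =
      2 * M * ((1 + del^-1) * (f z - g z) ^+ 2 + del * f z ^+ 2) by ring.
    rewrite ler_wpM2l ?mulr_ge0 //; exact: absB_sq_le.
  apply: lerD => //.
  have -> : e = e / 2 + e / 2 by field.
  apply: lerD.
    apply: (@le_trans _ _ (2 * M * (1 + del^-1) * (e / 2 / B))).
      by rewrite ler_wpM2l // !mulr_ge0 // addr_ge0 // ltW.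
    rewrite mulrCA; apply: ler_piMr; first by rewrite divr_ge0 // ltW.
    by rewrite ler_pdivrMr // mul1r /B; lra.
  rewrite mulrAC /del mulrCA; apply: ler_piMr; first by rewrite divr_ge0 // ltW.
  by rewrite ler_pdivrMr // mul1r /A; lra.
(* Monotone convergence along integer heights; at each point the truncation is inactive once the
   height exceeds f^2. *)
have lim4 : (\int[mu]_(z in D) (((f z ^+ 2) ^+ 2)%:E) <= K%:E)%E.
  have := @cvg_monotone_convergence _ _ _ mu D mD
    (fun n z => (h n%:R (f z))%:E).
  move=> /(_ _ _ _)/cvg_lim.
  have -> : (\int[mu]_(x in D) (fun x0 : T => limn (fun n => (h n%:R (f x0))%:E)) x =
    \int[mu]_(z in D) (((f z ^+ 2) ^+ 2)%:E))%E.
    apply: eq_integral => z _; apply: cvg_lim => //.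
    apply: cvg_near_cst; near=> n; rewrite /h min_l //.
    by near: n; exact: nbhs_infty_ger.
  move=> <- //.
  - apply: lime_le.
    + apply: ereal_nondecreasing_is_cvgn => n m nm; apply: ge0_le_integral => //;
        try (by apply/measurable_EFinP; exact: mh);
        by move=> z _; rewrite lee_fin ?hmono //; apply hle.
    + apply: nearW => n; have := trunc n%:R (ler0n _ _).
      have := ih n%:R _ (ler0n _ _) hf => /(integrable_fin_num mD)/fineK <-.
      by rewrite lee_fin.
  - by move=> n; apply/measurable_EFinP; exact: mh.
  - by move=> n z _; rewrite lee_fin; apply hle.
  - by move=> z _ n m nm; rewrite lee_fin; exact: hmono.
have sf : sqi (fun z => f z ^+ 2).
  by split => //; exact: le_lt_trans lim4 (ltry _).
split => //; rewrite -lee_fin /Rintegral fineK //.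
exact: (integrable_fin_num mD (sqi_sq sf)).
Unshelve. all: by end_near.
Qed.

End l2_calculus.

(** * Smooth functions and partial derivatives *)

Section smooth.
Variable R : realType.
Implicit Types f g : plane R -> R.

Definition smooth f := forall n, Cn n f.
(** [Dx] and [Dy] become opaque after this section, so that later computations handle derivatives
    only through the rules proved for them. *)
Definition Dx f : plane R -> R := 'D_(dirx R) f.
Definition Dy f : plane R -> R := 'D_(diry R) f.

Lemma CnS n f : Cn n.+1 f -> Cn n f.
Proof.
revert f; induction n as [|n IH]; intros f [cf H].
  split; [exact: cf|exact: I].
destruct H as [df hx hy]; split; [exact cf|].
split; [exact df|exact (IH _ hx)|exact (IH _ hy)].
Qed.

Lemma smooth_cont f : smooth f -> continuous f.
Proof. by move/(_ 0%N) => []. Qed.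

Lemma smooth_derx f z : smooth f -> derivable f z (dirx R).
Proof. by move/(_ 1%N) => [_ [/(_ z)[]]]. Qed.

Lemma smooth_dery f z : smooth f -> derivable f z (diry R).
Proof. by move/(_ 1%N) => [_ [/(_ z)[]]]. Qed.

Lemma smooth_Dx f : smooth f -> smooth (Dx f).
Proof. by move=> h n; have [_ []] := h n.+1. Qed.

Lemma smooth_Dy f : smooth f -> smooth (Dy f).
Proof. by move=> h n; have [_ []] := h n.+1. Qed.

Lemma D_cst (k : R) (v : plane R) :
  'D_v (fun _ : plane R => k) = (fun=> 0) :> (plane R -> R).
Proof. by apply/funext => z; exact: derive_cst. Qed.

Lemma Cn_cst n (k : R) : Cn n (fun _ : plane R => k).
Proof.
have cc (k' : R) : continuous (fun _ : plane R => k') by exact: cst_continuous.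
elim: n k => [|n IH] k; first by split; [exact: cc|].
split; first exact: cc.
split.
- by move=> z; split; exact (derivable_cst _ _ _).
- by rewrite D_cst.
- by rewrite D_cst.
Qed.

Lemma CnD n f g : Cn n f -> Cn n g -> Cn n (fun z => f z + g z).
Proof.
have cD (f1 f2 : plane R -> R) : continuous f1 -> continuous f2 ->
    continuous (fun z => f1 z + f2 z).
  by move=> c1 c2 z; apply: cvgD; [exact: c1|exact: c2].
revert f g; induction n as [|n IH]; intros f g [cf hf] [cg hg].
  split; [exact (cD _ _ cf cg)|exact: I].
split; first exact (cD _ _ cf cg).
destruct hf as [df hfx hfy]; destruct hg as [dg hgx hgy].
have Ex : 'D_(dirx R) (fun z => f z + g z) =
  (fun z => 'D_(dirx R) f z + 'D_(dirx R) g z) :> (plane R -> R).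
  by apply/funext => z; exact (deriveD (df z).1 (dg z).1).
have Ey : 'D_(diry R) (fun z => f z + g z) =
  (fun z => 'D_(diry R) f z + 'D_(diry R) g z) :> (plane R -> R).
  by apply/funext => z; exact (deriveD (df z).2 (dg z).2).
split.
- move=> z; split; [exact (derivableD (df z).1 (dg z).1)|exact (derivableD (df z).2 (dg z).2)].
- rewrite Ex; exact (IH _ _ hfx hgx).
- rewrite Ey; exact (IH _ _ hfy hgy).
Qed.

Lemma CnM n f g : Cn n f -> Cn n g -> Cn n (fun z => f z * g z).
Proof.
have cM (f1 f2 : plane R -> R) : continuous f1 -> continuous f2 ->
    continuous (fun z => f1 z * f2 z).
  by move=> c1 c2 z; apply: cvgM; [exact: c1|exact: c2].
revert f g; induction n as [|n IH]; intros f g hf0 hg0;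
  destruct (hf0) as [cf hf]; destruct (hg0) as [cg hg].
  split; [exact (cM _ _ cf cg)|exact: I].
split; first exact (cM _ _ cf cg).
destruct hf as [df hfx hfy]; destruct hg as [dg hgx hgy].
have Ex : 'D_(dirx R) (fun z => f z * g z) =
  (fun z => f z * 'D_(dirx R) g z + g z * 'D_(dirx R) f z) :> (plane R -> R).
  by apply/funext => z; exact (deriveM (df z).1 (dg z).1).
have Ey : 'D_(diry R) (fun z => f z * g z) =
  (fun z => f z * 'D_(diry R) g z + g z * 'D_(diry R) f z) :> (plane R -> R).
  by apply/funext => z; exact (deriveM (df z).2 (dg z).2).
(* The product rule keeps an undifferentiated factor in each term; it is needed at order [n]
   only. *)
have hf1 := CnS hf0; have hg1 := CnS hg0.
split.
- move=> z; split; [exact (derivableM (df z).1 (dg z).1)|exact (derivableM (df z).2 (dg z).2)].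
- rewrite Ex; exact (CnD (IH _ _ hf1 hgx) (IH _ _ hg1 hfx)).
- rewrite Ey; exact (CnD (IH _ _ hf1 hgy) (IH _ _ hg1 hfy)).
Qed.

Lemma smoothD f g : smooth f -> smooth g -> smooth (fun z => f z + g z).
Proof. by move=> hf hg n; exact: CnD. Qed.

Lemma smoothM f g : smooth f -> smooth g -> smooth (fun z => f z * g z).
Proof. by move=> hf hg n; exact: CnM. Qed.

Lemma smooth_cst k : smooth (fun=> k).
Proof. by move=> n; exact: Cn_cst. Qed.

Lemma smoothZ k f : smooth f -> smooth (fun z => k * f z).
Proof. by move=> hf; apply: smoothM => //; exact: smooth_cst. Qed.

Lemma DxD f g : smooth f -> smooth g ->
  Dx (fun z => f z + g z) = fun z => Dx f z + Dx g z.
Proof.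
by move=> hf hg; apply/funext => z; exact (deriveD (smooth_derx hf) (smooth_derx hg)).
Qed.

Lemma DyD f g : smooth f -> smooth g ->
  Dy (fun z => f z + g z) = fun z => Dy f z + Dy g z.
Proof.
by move=> hf hg; apply/funext => z; exact (deriveD (smooth_dery hf) (smooth_dery hg)).
Qed.

Lemma DxM f g : smooth f -> smooth g ->
  Dx (fun z => f z * g z) = fun z => f z * Dx g z + g z * Dx f z.
Proof.
by move=> hf hg; apply/funext => z; exact (deriveM (smooth_derx hf) (smooth_derx hg)).
Qed.

Lemma DyM f g : smooth f -> smooth g ->
  Dy (fun z => f z * g z) = fun z => f z * Dy g z + g z * Dy f z.
Proof.
by move=> hf hg; apply/funext => z; exact (deriveM (smooth_dery hf) (smooth_dery hg)).
Qed.

Lemma DxZ k f : smooth f -> Dx (fun z => k * f z) = fun z => k * Dx f z.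
Proof.
move=> hf; rewrite DxM //; last exact: smooth_cst.
by apply/funext => z; rewrite [Dx (fun=> k) z]derive_cst mulr0 addr0.
Qed.

Lemma DyZ k f : smooth f -> Dy (fun z => k * f z) = fun z => k * Dy f z.
Proof.
move=> hf; rewrite DyM //; last exact: smooth_cst.
by apply/funext => z; rewrite [Dy (fun=> k) z]derive_cst mulr0 addr0.
Qed.

(** The directional and the one-variable derivative are limits of literally the same difference
    quotient, which reduces partial derivatives to calculus on a line. *)
Lemma quotient_line f (z v : plane R) (t h : R) :
  h^-1 *: ((f \o shift (z + t *: v)) (h *: v) - f (z + t *: v)) =
  h^-1 *: (((fun s : R => f (z + s *: v)) \o shift t) (h *: (1 : R)) -
           f (z + t *: v)).
Proof.
congr (_ *: (f _ - _)) => /=.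
by rewrite [h *: (1 : R)]mulr1 scalerDl addrCA.
Qed.

Lemma derivable_line f (z v : plane R) (t : R) :
  derivable f (z + t *: v) v <-> derivable (fun s : R => f (z + s *: v)) t 1.
Proof.
by rewrite /derivable; under eq_fun do rewrite quotient_line.
Qed.

Lemma derive_line f (z v : plane R) (t : R) :
  'D_v f (z + t *: v) = 'D_1 (fun s : R => f (z + s *: v)) t.
Proof.
by rewrite /derive; under eq_fun do rewrite quotient_line.
Qed.

Lemma line_x (x y t : R) : ((x, y) + t *: dirx R)%R = (x + t, y).
Proof. by congr pair; rewrite /= /GRing.scale /=; ring. Qed.

Lemma line_y (x y t : R) : ((x, y) + t *: diry R)%R = (x, y + t).
Proof. by congr pair; rewrite /= /GRing.scale /=; ring. Qed.

Lemma Dx_line f (x y : R) : Dx f (x, y) = 'D_1 (fun s : R => f (s, y)) x.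
Proof.
rewrite /Dx /Dy; have := @derive_line f (0, y) (dirx R) x.
rewrite line_x add0r => ->; congr ('D_1 _ x).
by apply/funext => s; rewrite line_x add0r.
Qed.

Lemma Dy_line f (x y : R) : Dy f (x, y) = 'D_1 (fun s : R => f (x, s)) y.
Proof.
rewrite /Dx /Dy; have := @derive_line f (x, 0) (diry R) y.
rewrite line_y add0r => ->; congr ('D_1 _ y).
by apply/funext => s; rewrite line_y add0r.
Qed.

Lemma derivable_linex f (x y : R) :
  derivable f (x, y) (dirx R) <-> derivable (fun s : R => f (s, y)) x 1.
Proof.
have := @derivable_line f (0, y) (dirx R) x.
rewrite line_x add0r (_ : (fun s => f ((0, y) + s *: dirx R)) = fun s => f (s, y)) //.
by apply/funext => s; rewrite line_x add0r.
Qed.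

Lemma derivable_liney f (x y : R) :
  derivable f (x, y) (diry R) <-> derivable (fun s : R => f (x, s)) y 1.
Proof.
have := @derivable_line f (x, 0) (diry R) y.
rewrite line_y add0r (_ : (fun s => f ((x, 0) + s *: diry R)) = fun s => f (x, s)) //.
by apply/funext => s; rewrite line_y add0r.
Qed.

Lemma DxE f : 'D_(dirx R) f = Dx f. Proof. by []. Qed.
Lemma DyE f : 'D_(diry R) f = Dy f. Proof. by []. Qed.

Lemma partialSx i j f : partial i.+1 j f = Dx (partial i j f). Proof. by []. Qed.
Lemma partial0S j f : partial 0 j.+1 f = Dy (partial 0 j f). Proof. by []. Qed.
Lemma partial00 f : partial 0 0 f = f. Proof. by []. Qed.
Definition partialE := (partialSx, partial0S, partial00).

End smooth.

Global Opaque Dx Dy.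

(** * Flat functions and plateaux *)

Section flat.
Variable R : realType.
Implicit Types (Q : {poly R}) (x t : R).

(** The classical flat function exp(-1/x) times a polynomial in 1/x. The polynomial factor makes the
    family closed under differentiation, so that smoothness is a single induction. *)
Definition flat Q x : R := if 0 < x then Q.[x^-1] * expR (- x^-1) else 0.

(** Chain rule: the derivative of Q(1/x) exp(-1/x) is x^-2 (Q - Q')(1/x) exp(-1/x). *)
Definition flatd Q : {poly R} := 'X^2 * (Q - Q^`()).

(** With t = 1/x, the inequality t^(i+1)/(i+1)! <= exp(t) gives t^i exp(-t) <= (i+1)! x for each
    monomial. This linear decay settles differentiability at 0. *)
Lemma flat_bound Q : exists2 C, 0 <= C & forall x, 0 < x -> `|flat Q x| <= C * x.
Proof.
exists (\sum_(i < size Q) `|Q`_i| * (i.+1)`!%:R).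
  by apply: sumr_ge0 => i _; rewrite mulr_ge0.
move=> x x0; rewrite /flat x0 horner_coef mulr_suml mulr_suml.
apply: (le_trans (ler_norm_sum _ _ _)); apply: ler_sum => i _.
rewrite -mulrA normrM -mulrA; apply: ler_wpM2l => //; rewrite normrM.
have t0 : 0 < x^-1 by rewrite invr_gt0.
rewrite (gtr0_norm (expR_gt0 _)) ger0_norm; last by rewrite exprn_ge0 // ltW.
rewrite expRN. rewrite ler_pdivrMr ?expR_gt0 //.
have /(le_trans _) := expR_ge1Dxn i (ltW t0).
move=> /(_ (x^-1 ^+ i.+1 / (i.+1)`!%:R)).
rewrite lerDr => /(_ ler01) h.
have f0 : 0 < (i.+1)`!%:R :> R by rewrite ltr0n fact_gt0.
rewrite ler_pdivrMr // in h.
rewrite -(ler_pM2l t0) -exprS (le_trans h) // le_eqVlt; apply/orP; left.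
apply/eqP; field; exact: lt0r_neq0.
Qed.

Lemma is_derive_inv x : x != 0 -> is_derive x 1 (fun y : R => y^-1) (- x^-1 ^+ 2).
Proof.
move=> x0; have := @is_deriveV R (fun y : R => y) x 1 1 x0 (is_derive_id _ _).
by rewrite exprVn [_ *: _]mulr1.
Qed.

Lemma flat_derive Q x : is_derive x 1 (flat Q) (flat (flatd Q) x).
Proof.
have [x0|x0|x0] := ltgtP x 0.
- rewrite {2}/flat ltNge (ltW x0) /=.
  apply: near_eq_is_derive (is_derive_cst 0 x 1).
  near=> y; rewrite /flat ifF //; apply/negbTE; rewrite -leNgt ltW //.
  by near: y; exact: lt_nbhsl.
- rewrite {2}/flat x0.
  have hi := is_derive_inv (lt0r_neq0 x0).
  have h1 := is_derive1_comp (is_derive_poly Q x^-1) hi.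
  have hn : is_derive x 1 (fun y : R => - y^-1) (- - x^-1 ^+ 2) := is_deriveN hi.
  have h2 := @is_derive1_comp R expR (fun y : R => - y^-1) x _ _
    (is_derive_expR (- x^-1)) hn.
  have h := is_deriveM h1 h2.
  apply: (near_eq_is_derive _ _ (df := _)); last first.
    apply: (@is_derive_eq _ _ _ _ _ _ _ _ h).
    rewrite /flatd hornerM hornerXn hornerD hornerN /= /GRing.scale /=.
    by ring.
  near=> y; rewrite /flat ifT //.
  by near: y; exact: lt_nbhsr.
- have f0 : flat Q 0 = 0 by rewrite /flat ltxx.
  rewrite x0 {2}/flat ltxx.
  (* Dividing by the increment multiplies by one more power of 1/x: the difference quotient at 0 is
     the flat function of 'X * Q, which is again O(h). *)
  have [C C0 hC] := flat_bound ('X * Q).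
  have key (h : R) : h != 0 ->
      `|h^-1 *: ((flat Q \o shift 0) (h *: (1 : R)) - flat Q 0)| <= C * `|h|.
    move=> h0; rewrite f0 subr0 /= addr0 [h *: (1 : R)]mulr1.
    have [hn|hp|h00] := ltgtP h 0; last by rewrite h00 eqxx in h0.
      by rewrite /flat ltNge (ltW hn) /= scaler0 normr0 mulr_ge0.
    rewrite (gtr0_norm hp); apply: le_trans (hC _ hp).
    by rewrite /flat hp hornerM hornerX [_ *: _]mulrA.
  have lim : (fun h : R => h^-1 *: ((flat Q \o shift 0) (h *: (1 : R)) - flat Q 0))
      @ 0^' --> (0 : R).
    apply: (@cvg_to_0_linear _ _ C 1) => [//|u /andP[u0 _]].
    by apply: key; rewrite -normr_gt0.
  apply: DeriveDef; first by apply/cvg_ex; exists 0.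
  exact: cvg_lim lim.
Unshelve. all: by end_near.
Qed.

Lemma flat_cont Q : continuous (flat Q).
Proof.
move=> x; apply: differentiable_continuous; apply/derivable1_diffP.
by have [] := flat_derive Q x.
Qed.

Definition ramp Q (a b c : R) : plane R -> R :=
  fun z => flat Q (a * z.1 + b * z.2 + c).

Lemma ramp_cont Q a b c : continuous (ramp Q a b c).
Proof.
move=> z; apply: (@continuous_comp _ _ _ (fun z : plane R => a * z.1 + b * z.2 + c)).
  apply: cvgD; last exact: cvg_cst.
  apply: cvgD; (apply: cvgM; first exact: cvg_cst).
    exact: cvg_fst.
  exact: cvg_snd.
exact: flat_cont.
Qed.

Lemma is_derive_ramp Q (a k x : R) :
  is_derive x 1 (fun s : R => flat Q (a * s + k)) (a * flat (flatd Q) (a * x + k)).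
Proof.
have h1 : is_derive x (1 : R) (fun s : R => a * s + k) a.
  have := @is_deriveD R _ _ (fun s : R => a *: s) (fun=> k) x 1 _ _
    (is_deriveZ a (is_derive_id x 1)) (is_derive_cst k x 1).
  by rewrite addr0 [a *: _]mulr1.
by have := @is_derive1_comp R (flat Q) (fun s : R => a * s + k) x _ _ (flat_derive Q (a * x + k)) h1; rewrite mulrC.
Qed.

Lemma ramp_derx Q a b c z : derivable (ramp Q a b c) z (dirx R) /\
  'D_(dirx R) (ramp Q a b c) z = a * ramp (flatd Q) a b c z.
Proof.
case: z => x y.
have [h1 h2] := is_derive_ramp Q a (b * y + c) x.
have E : (fun s => ramp Q a b c (s, y)) = fun s => flat Q (a * s + (b * y + c)).
  by apply/funext => s; rewrite /ramp /= addrA.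
split; first by apply/derivable_linex; rewrite E.
by rewrite -[LHS]/(Dx (ramp Q a b c) (x, y)) Dx_line E h2 /ramp /= addrA.
Qed.

Lemma ramp_dery Q a b c z : derivable (ramp Q a b c) z (diry R) /\
  'D_(diry R) (ramp Q a b c) z = b * ramp (flatd Q) a b c z.
Proof.
case: z => x y.
have [h1 h2] := is_derive_ramp Q b (a * x + c) y.
have E : (fun s => ramp Q a b c (x, s)) = fun s => flat Q (b * s + (a * x + c)).
  by apply/funext => s; rewrite /ramp /= addrCA addrA.
split; first by apply/derivable_liney; rewrite E.
by rewrite -[LHS]/(Dy (ramp Q a b c) (x, y)) Dy_line E h2 /ramp /= addrCA addrA.
Qed.

(** The induction is over all [Q] at once, because a partial derivative of a ramp is a multiple of
    the ramp of another polynomial. *)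
Lemma smooth_ramp Q a b c : smooth (ramp Q a b c).
Proof.
move=> n; revert Q; induction n as [|n IH]; intro Q.
  split; [exact: ramp_cont|exact: I].
split; first exact: ramp_cont.
split.
- move=> z; split; [exact (ramp_derx Q a b c z).1|exact (ramp_dery Q a b c z).1].
- have -> : 'D_(dirx R) (ramp Q a b c) =
     (fun z => a * ramp (flatd Q) a b c z) :> (plane R -> R).
    by apply/funext => z; exact (ramp_derx Q a b c z).2.
  exact (CnM (Cn_cst n a) (IH _)).
- have -> : 'D_(diry R) (ramp Q a b c) =
     (fun z => b * ramp (flatd Q) a b c z) :> (plane R -> R).
    by apply/funext => z; exact (ramp_dery Q a b c z).2.
  exact (CnM (Cn_cst n b) (IH _)).
Qed.

End flat.

(** * Algebra of test functions and their supports *)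

Section test_functions.
Variables (R : realType) (Om : set (plane R)).
Implicit Types f g p q : plane R -> R.

Definition tsupp f : set (plane R) := closure [set z | f z != 0].

Lemma tsupp0 f z : ~ tsupp f z -> f z = 0.
Proof.
move=> h; apply/eqP/negPn/negP => fz; apply: h.
exact: subset_closure.
Qed.

Lemma tsupp_sub f (K : set (plane R)) : closed K ->
  (forall z, ~ K z -> f z = 0) -> tsupp f `<=` K.
Proof.
move=> cK h; rewrite /tsupp closureE; apply: smallest_sub => // z /= fz.
by apply: contrapT => /h fz0; rewrite fz0 eqxx in fz.
Qed.

Lemma tsupp_closed f : closed (tsupp f).
Proof. exact: closed_closure. Qed.

Lemma tsupp_near0 f z : ~ tsupp f z -> \forall w \near z, f w = 0.
Proof.
move=> h; have : nbhs z (~` tsupp f).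
  by apply: open_nbhs_nbhs; split; [rewrite openC; exact: tsupp_closed|].
by apply: filterS => w /tsupp0.
Qed.

Lemma tsupp_D f v z : ~ tsupp f z -> 'D_v f z = 0.
Proof.
move=> /tsupp_near0 h.
rewrite (near_eq_derive v h); exact: derive_cst.
Qed.

Lemma test_smooth p : test_fun Om p -> smooth p.
Proof. by case. Qed.

Lemma test_out p z : test_fun Om p -> ~ Om z -> p z = 0.
Proof. by case=> _ _ h nz; apply: tsupp0 => /h. Qed.

Lemma test_sub p q : test_fun Om p -> smooth q ->
  (forall z, ~ tsupp p z -> q z = 0) -> test_fun Om q.
Proof.
move=> [sp cp ip] sq h.
have s : tsupp q `<=` tsupp p by apply: tsupp_sub => //; exact: tsupp_closed.
split => //; last exact: subset_trans ip.
exact: subclosed_compact (@tsupp_closed q) cp s.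
Qed.

Lemma test_Dx p : test_fun Om p -> test_fun Om (Dx p).
Proof.
move=> hp; apply: (test_sub hp); first exact/smooth_Dx/test_smooth.
by move=> z; rewrite -DxE; exact: tsupp_D.
Qed.

Lemma test_Dy p : test_fun Om p -> test_fun Om (Dy p).
Proof.
move=> hp; apply: (test_sub hp); first exact/smooth_Dy/test_smooth.
by move=> z; rewrite -DyE; exact: tsupp_D.
Qed.

Lemma test_mul f p : smooth f -> test_fun Om p -> test_fun Om (fun z => f z * p z).
Proof.
move=> sf hp; apply: (test_sub hp); first exact: smoothM (test_smooth hp).
by move=> z /tsupp0 ->; rewrite mulr0.
Qed.

Lemma testZ k p : test_fun Om p -> test_fun Om (fun z => k * p z).
Proof. by apply: test_mul; exact: smooth_cst. Qed.

Lemma testD p q : test_fun Om p -> test_fun Om q -> test_fun Om (fun z => p z + q z).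
Proof.
move=> hp hq; have [sp cp ip] := hp; have [sq cq iq] := hq.
have s : tsupp (fun z => p z + q z) `<=` tsupp p `|` tsupp q.
  apply: tsupp_sub.
    by apply: closedU; exact: tsupp_closed.
  by move=> z /not_orP[/tsupp0 -> /tsupp0 ->]; rewrite addr0.
split; first exact: smoothD.
  apply: (subclosed_compact (@tsupp_closed _) _ s).
  have := @bigsetU_compact _ _ (fun b : bool => if b then tsupp p else tsupp q)
    [:: true; false] xpredT.
  by rewrite !big_cons big_nil setU0; apply => -[].
by apply: subset_trans s _ => z [/ip|/iq].
Qed.

Lemma test_lin k p q : test_fun Om p -> test_fun Om q ->
  test_fun Om (fun z => k * p z + q z).
Proof. by move=> hp hq; apply: testD => //; exact: testZ. Qed.

Lemma testB p q : test_fun Om p -> test_fun Om q -> test_fun Om (fun z => p z - q z).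
Proof.
move=> hp hq; have := test_lin (-1) hq hp.
by rewrite (_ : (fun z => -1 * q z + p z) = (fun z => p z - q z)) //;
  apply/funext => z; ring.
Qed.

Lemma test0 : test_fun Om (fun=> 0).
Proof.
have E : tsupp (fun=> 0) = set0.
  rewrite -subset0; apply: tsupp_sub => //; exact: closed0.
split; first exact: smooth_cst.
  by rewrite -/(tsupp _) E; exact: compact0.
by rewrite -/(tsupp _) E.
Qed.

End test_functions.

Section plateaus.
Variable R : realType.
Implicit Types (f g : plane R -> R) (a b c d : R).

Definition orect a b c d : set (plane R) := `]a, b[ `*` `]c, d[.
Definition crect a b c d : set (plane R) := `[a, b] `*` `[c, d].

Lemma crect_compact a b c d : compact (crect a b c d).
Proof. by apply: compact_setX; exact: segment_compact. Qed.

Lemma crect_closed a b c d : closed (crect a b c d).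
Proof. by apply: compact_closed (@crect_compact a b c d); exact: norm_hausdorff. Qed.

Lemma flat1E x : flat 1 x = if 0 < x then expR (- x^-1) else 0 :> R.
Proof. by rewrite /flat hornerC mul1r. Qed.

Lemma flat1_ge0 x : 0 <= flat 1 x :> R.
Proof. by rewrite flat1E; case: ifP => // _; exact: expR_ge0. Qed.

Lemma flat1_le1 x : flat 1 x <= 1 :> R.
Proof.
rewrite flat1E; case: ifP => // x0.
by rewrite -(@expR0 R) ler_expR oppr_le0 invr_ge0 ltW.
Qed.

(** A smooth profile in x alone: for k > 0 it is positive exactly on ]a, b[, and it tends to 1 there
    as k grows. Keeping the variables in separate factors is what later makes mixed derivatives
    commute. *)
Definition plateaux k a b : plane R -> R :=
  fun z => ramp 1 k 0 (- (k * a)) z * ramp 1 (- k) 0 (k * b) z.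
Definition plateauy k c d : plane R -> R :=
  fun z => ramp 1 0 k (- (k * c)) z * ramp 1 0 (- k) (k * d) z.
Definition plateau k a b c d : plane R -> R := fun z => plateaux k a b z * plateauy k c d z.

Lemma plateauxE k a b z : plateaux k a b z = flat 1 (k * (z.1 - a)) * flat 1 (k * (b - z.1)).
Proof. by rewrite /plateaux /ramp; congr (flat _ _ * flat _ _); ring. Qed.

Lemma plateauyE k c d z : plateauy k c d z = flat 1 (k * (z.2 - c)) * flat 1 (k * (d - z.2)).
Proof. by rewrite /plateauy /ramp; congr (flat _ _ * flat _ _); ring. Qed.

Lemma smooth_plateaux k a b : smooth (plateaux k a b).
Proof. by apply: smoothM; exact: smooth_ramp. Qed.

Lemma smooth_plateauy k a b : smooth (plateauy k a b).
Proof. by apply: smoothM; exact: smooth_ramp. Qed.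

Lemma smooth_plateau k a b c d : smooth (plateau k a b c d).
Proof. by apply: smoothM; [exact: smooth_plateaux|exact: smooth_plateauy]. Qed.

Lemma flat_pair0 k a b x : 0 < k -> ~ `]a, b[%classic x ->
  flat 1 (k * (x - a)) * flat 1 (k * (b - x)) = 0 :> R.
Proof.
move=> k0; rewrite /= in_itv /= => /negP; rewrite negb_and -!leNgt !flat1E.
by case/orP => h; [rewrite (_ : (0 < k * (x - a)) = false)|
  rewrite (_ : (0 < k * (b - x)) = false)]; rewrite ?mul0r ?mulr0 //;
  apply/negbTE; rewrite -leNgt pmulr_rle0 // subr_le0.
Qed.

Lemma plateau0 k a b c d z : 0 < k -> ~ orect a b c d z -> plateau k a b c d z = 0.
Proof.
move=> k0 /not_andP[h|h]; rewrite /plateau.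
  by rewrite plateauxE flat_pair0 // mul0r.
by rewrite plateauyE flat_pair0 // mulr0.
Qed.

Lemma plateau_ge0 k a b c d z : 0 <= plateau k a b c d z.
Proof. by rewrite /plateau plateauxE plateauyE !mulr_ge0 ?flat1_ge0. Qed.

Lemma plateau_le1 k a b c d z : plateau k a b c d z <= 1.
Proof.
rewrite /plateau plateauxE plateauyE.
by rewrite !mulr_ile1 ?mulr_ge0 ?flat1_ge0 ?flat1_le1.
Qed.

Lemma plateau_test (Om : set (plane R)) k a b c d : 0 < k ->
  crect a b c d `<=` Om -> test_fun Om (plateau k a b c d).
Proof.
move=> k0 h.
have s : tsupp (plateau k a b c d) `<=` crect a b c d.
  apply: tsupp_sub; first exact: crect_closed.
  move=> z hz; apply: plateau0 => // -[/= h1 h2]; apply: hz; split => /=.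
    by move: h1; rewrite !in_itv /= => /andP[/ltW -> /ltW ->].
  by move: h2; rewrite !in_itv /= => /andP[/ltW -> /ltW ->].
split; first exact: smooth_plateau.
  exact: subclosed_compact (@tsupp_closed _ _) (@crect_compact a b c d) s.
exact: subset_trans s h.
Qed.

Lemma flat1_cvg x : 0 < x -> flat 1 (n.+1%:R * x) @[n --> \oo] --> (1 : R).
Proof.
move=> x0.
have -> : (fun n => flat 1 (n.+1%:R * x)) = expR \o (fun n => - (x^-1 * harmonic n)).
  by apply/funext => n; rewrite flat1E /= mulr_gt0 // invfM mulrC.
rewrite -(@expR0 R); apply: continuous_cvg; first exact: continuous_expR.
rewrite -oppr0; apply: cvgN; rewrite -[X in _ --> X](mulr0 x^-1).
by apply: cvgM; [exact: cvg_cst|exact: cvg_harmonic].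
Qed.

(** Inside the open rectangle all four factors tend to 1; outside, boundary included, every plateau
    is exactly 0. The slope n + 1 is positive from the start. *)
Lemma plateau_cvg a b c d z :
  plateau n.+1%:R a b c d z @[n --> \oo] --> (\1_(orect a b c d) z : R).
Proof.
rewrite indicE; case: (boolP (z \in _)) => [/set_mem[/= h1 h2]|/negP h].
  move: h1 h2; rewrite !in_itv /= => /andP[h1 h2] /andP[h3 h4].
  rewrite [X in _ --> X](_ : _ = 1 * 1 * (1 * 1)); last by rewrite !mulr1.
  under eq_fun do rewrite /plateau plateauxE plateauyE.
  by apply: cvgM; apply: cvgM; apply: flat1_cvg; rewrite subr_gt0.
have hz : ~ orect a b c d z by move=> hz; apply: h; exact: mem_set.
under eq_fun do rewrite plateau0 //.
exact: cvg_cst.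
Qed.

Definition xonly f := forall x y y', f (x, y) = f (x, y').
Definition yonly f := forall x x' y, f (x, y) = f (x', y).

Lemma Dy_xonly f : xonly f -> Dy f = fun=> 0.
Proof.
move=> h; apply/funext => -[x y]; rewrite Dy_line.
by rewrite (_ : (fun s => _) = fun=> f (x, 0)) ?derive_cst //; apply/funext => s.
Qed.

Lemma Dx_yonly f : yonly f -> Dx f = fun=> 0.
Proof.
move=> h; apply/funext => -[x y]; rewrite Dx_line.
by rewrite (_ : (fun s => _) = fun=> f (0, y)) ?derive_cst //; apply/funext => s.
Qed.

Lemma Dx_xonly f : xonly f -> xonly (Dx f).
Proof.
move=> h x y y'; rewrite !Dx_line; congr ('D_1 _ x).
by apply/funext => s.
Qed.

Lemma Dy_yonly f : yonly f -> yonly (Dy f).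
Proof.
move=> h x x' y; rewrite !Dy_line; congr ('D_1 _ y).
by apply/funext => s.
Qed.

Lemma plateaux_xonly k a b : xonly (plateaux k a b).
Proof. by move=> x y y'; rewrite !plateauxE. Qed.

Lemma plateauy_yonly k a b : yonly (plateauy k a b).
Proof. by move=> x x' y; rewrite !plateauyE. Qed.

(** For a function of x times a function of y, both mixed derivatives are the product of the two
    one-variable derivatives. *)
Lemma plateau_DxDy k a b c d : Dx (Dy (plateau k a b c d)) = Dy (Dx (plateau k a b c d)).
Proof.
have sx := smooth_plateaux k a b; have sy := smooth_plateauy k c d.
have sx' := smooth_Dx sx; have sy' := smooth_Dy sy.
have hx := @plateaux_xonly k a b; have hy := @plateauy_yonly k c d.
have E1 : Dy (plateau k a b c d) = fun z => plateaux k a b z * Dy (plateauy k c d) z.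
  rewrite [LHS]DyM // (Dy_xonly hx); apply/funext => z; by rewrite mulr0 addr0.
have E2 : Dx (plateau k a b c d) = fun z => plateauy k c d z * Dx (plateaux k a b) z.
  rewrite [LHS]DxM // (Dx_yonly hy); apply/funext => z; by rewrite mulr0 add0r.
rewrite E1 E2 DxM // DyM // (Dx_yonly (Dy_yonly hy)) (Dy_xonly (Dx_xonly hx)).
by apply/funext => z; ring.
Qed.

End plateaus.

(** * The fundamental lemma of the calculus of variations *)

Section pi_lambda.
Context d (T : measurableType d) (R : realType).
Variable mu : {measure set T -> \bar R}.

(** The sets A for which the integral over Q and A vanishes form a Dynkin system: the zero integral
    over Q handles complements, sigma-additivity handles disjoint unions. Containing the pi-system
    [G], it contains every measurable set, and a function with zero integral on every measurable
    part of Q is zero almost everywhere. *)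
Lemma integral_pi_system (G : set (set T)) (Q : set T) (g : T -> \bar R) :
  d.-measurable = <<s G >> -> setI_closed G -> d.-measurable Q ->
  mu.-integrable Q g ->
  (\int[mu]_(z in Q) g z = 0)%E ->
  (forall A, G A -> \int[mu]_(z in Q `&` A) g z = 0)%E ->
  ae_eq mu Q g (cst 0%E).
Proof.
move=> mG GI mQ ig gQ gG.
pose H := [set A : set T | d.-measurable A /\ (\int[mu]_(z in Q `&` A) g z = 0)%E].
have igA A : d.-measurable A -> mu.-integrable (Q `&` A) g.
  move=> mA; apply: integrableS ig => //; exact: measurableI.
have H_dynkin : dynkin H.
  split.
  - by split; [exact: measurableT|rewrite setIT].
  - move=> A [mA hA]; split; first exact: measurableC.
    have := gQ.
    have mA' := measurableC mA.
    have mQA := measurableI _ _ mQ mA; have mQA' := measurableI _ _ mQ mA'.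
    have mgU : measurable_fun ((Q `&` A) `|` (Q `&` ~` A)) g.
      by rewrite -setIUr setUv setIT; exact: measurable_int ig.
    have dA : [disjoint Q `&` A & Q `&` ~` A].
      by apply/disj_setPS => z [[_ ?] [_ ]].
    rewrite -{1}(setIT Q) -(setUv A) setIUr (integral_setU mu mQA mQA' mgU dA).
    by rewrite hA add0e.
  - move=> F tF hF; split; first by apply: bigcupT_measurable => n; apply hF.
    rewrite setI_bigcupr integral_bigcup.
    + by apply: eseries0 => n _ _; apply hF.
    + exact: trivIset_setIl.
    + by move=> n; apply: measurableI => //; apply hF.
    + rewrite -setI_bigcupr; apply: igA; apply: bigcupT_measurable => n; apply hF.
have allH A : d.-measurable A -> H A.
  rewrite mG.
  apply: (@lambda_system_subset _ G GI setT H); first exact/dynkin_lambda_system.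
    move=> B GB; split; last exact: gG.
    by rewrite mG; exact: sub_sigma_algebra.
  by [].
apply: integral_ae_eq => //.
move=> E EQ mE; rewrite integral_cst // mul0e.
by have [_] := allH E mE; rewrite setIC (setIidl EQ).
Qed.

End pi_lambda.

(** * Open rectangles generate the measurable sets of the plane *)

Section plane_measurable.
Variable R : realType.
Notation P := (measurableTypeR R * measurableTypeR R)%type.

(** Rational corners leave countably many rectangles. The closed rectangle is kept inside [U] so
    that plateaux on it are test functions of [U]. *)
Lemma open_crect (U : set (plane R)) z : open U -> U z ->
  exists q : rat * rat * (rat * rat),
    orect (ratr q.1.1) (ratr q.1.2) (ratr q.2.1) (ratr q.2.2) z /\
    crect (ratr q.1.1) (ratr q.1.2) (ratr q.2.1) (ratr q.2.2) `<=` U.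
Proof.
move=> oU Uz; have /nbhs_ballP[e /= e0 be] : nbhs z U by exact: open_nbhs_nbhs.
case: z Uz be => x y Uz be.
have [a] := rat_in_itvoo (ltac:(by rewrite ltrBlDr ltrDl) : x - e < x).
have [b] := rat_in_itvoo (ltac:(by rewrite ltrDl) : x < x + e).
have [c] := rat_in_itvoo (ltac:(by rewrite ltrBlDr ltrDl) : y - e < y).
have [d] := rat_in_itvoo (ltac:(by rewrite ltrDl) : y < y + e).
rewrite !in_itv /= => /andP[d1 d2] /andP[c1 c2] /andP[b1 b2] /andP[a1 a2].
exists (a, b, (c, d)) => /=; split.
  by split; rewrite /= in_itv /= ?a2 ?c2.
move=> [s t] [/=]; rewrite !in_itv /= => /andP[s1 s2] /andP[t1 t2].
apply: be; split; rewrite /ball /= /ball_ /= ltr_norml; apply/andP; split; lra.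
Qed.

Lemma open_bigcup_orect (U : set (plane R)) : open U ->
  exists r : nat -> R * R * (R * R),
    (forall n, crect (r n).1.1 (r n).1.2 (r n).2.1 (r n).2.2 `<=` U) /\
    U = \bigcup_n orect (r n).1.1 (r n).1.2 (r n).2.1 (r n).2.2.
Proof.
move=> oU.
pose f (q : rat * rat * (rat * rat)) : R * R * (R * R) :=
  (ratr q.1.1, ratr q.1.2, (ratr q.2.1, ratr q.2.2)).
pose good q := crect (f q).1.1 (f q).1.2 (f q).2.1 (f q).2.2 `<=` U.
(* Indices that decode to no admissible rectangle get the corners 1 and 0, that is, the empty
   rectangle. *)
pose r n := if unpickle n is Some q then
  (if `[< good q >] then f q else (1, 0, (1, 0))) else (1, 0, (1, 0)).
have c0 : crect 1 0 1 0 `<=` U.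
  by move=> [s t] [/=]; rewrite in_itv /=; lra.
have rU n : crect (r n).1.1 (r n).1.2 (r n).2.1 (r n).2.2 `<=` U.
  rewrite /r; case: unpickle => [q|] //; case: asboolP => //.
exists r; split => //; apply/seteqP; split => z.
  move=> /(open_crect oU)[q [zq qU]]; exists (pickle q) => //.
  by rewrite /r pickleK; case: asboolP.
move=> [n _ [h1 h2]]; apply: (rU n).
by split; [move: h1|move: h2]; rewrite /= !in_itv /= => /andP[/ltW -> /ltW ->].
Qed.

Definition orects : set (set (plane R)) :=
  [set A | exists q : R * R * (R * R), A = orect q.1.1 q.1.2 q.2.1 q.2.2].

Lemma open_orects_sigma (U : set (plane R)) : open U -> <<s orects >> U.
Proof.
move=> /open_bigcup_orect[r [_ ->]].
apply: sigma_algebra_bigcup => n.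
by apply: sub_sigma_algebra; exists (r n).
Qed.

Lemma orect_measurable (a b c d : R) : measurable (orect a b c d : set P).
Proof. by apply: measurableX; exact: measurable_itv. Qed.

(** The product sigma-algebra is generated by the two projections; they are measurable for [orects]
    because preimages of open intervals are open, hence countable unions of open rectangles. *)
Lemma plane_measurableE : (measurable : set (set P)) = <<s orects >>.
Proof.
apply/seteqP; split; last first.
  apply: smallest_sub; first exact: sigma_algebra_measurable.
  by move=> _ [q ->]; exact: orect_measurable.
have m1 : measurable_fun setT (fst : g_sigma_algebraType orects -> measurableTypeR R).
  apply: (measurability _ (RGenOpens.measurableE R)).
  move=> _ [_ [a [b ->] <-]]; rewrite setTI; apply: open_orects_sigma.
  apply: open_comp; last exact: interval_open.
  by move=> z _; exact: cvg_fst.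
have m2 : measurable_fun setT (snd : g_sigma_algebraType orects -> measurableTypeR R).
  apply: (measurability _ (RGenOpens.measurableE R)).
  move=> _ [_ [a [b ->] <-]]; rewrite setTI; apply: open_orects_sigma.
  apply: open_comp; last exact: interval_open.
  by move=> z _; exact: cvg_snd.
apply: smallest_sub; first exact: smallest_sigma_algebra.
move=> A [[B mB <-]|[B mB <-]].
  exact: (m1 measurableT B mB).
exact: (m2 measurableT B mB).
Qed.

Lemma open_measurable2 (U : set (plane R)) : open U -> measurable (U : set P).
Proof. by rewrite plane_measurableE; exact: open_orects_sigma. Qed.

Lemma continuous_measurable2 (f : plane R -> R) (D : set P) : measurable D ->
  continuous f -> measurable_fun D (f : P -> measurableTypeR R).
Proof.
move=> mD cf; apply: measurable_funTS.
apply: (measurability _ (RGenOpens.measurableE R)).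
move=> _ [_ [a [b ->] <-]]; rewrite setTI; apply: open_measurable2.
by apply: open_comp => //; exact: interval_open.
Qed.

End plane_measurable.

Section fundamental.
Variable R : realType.
Notation P := (measurableTypeR R * measurableTypeR R)%type.
Notation mu := (@mu2 R : {measure set P -> \bar R}).
Implicit Types (f g : P -> R) (a b c d : R).

Lemma ae2S (A B : P -> Prop) : (forall z, A z -> B z) ->
  {ae @mu2 R, forall z, A z} -> {ae @mu2 R, forall z, B z}.
Proof. exact: (@filterS _ _ (ae_filter_ringOfSetsType mu)). Qed.

Lemma ae2S2 (A B C : P -> Prop) : (forall z, A z -> B z -> C z) ->
  {ae @mu2 R, forall z, A z} -> {ae @mu2 R, forall z, B z} ->
  {ae @mu2 R, forall z, C z}.
Proof. exact: (@filterS2 _ _ (ae_filter_ringOfSetsType mu)). Qed.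

Lemma mu2_orect a b c d : (mu (orect a b c d) < +oo)%E.
Proof.
rewrite /orect [X in (X < _)%E](@product_measure1E _ _ _ _ _ _ _) //=.
rewrite !lebesgue_measure_itv /=.
by case: ifP => _; case: ifP => _; rewrite -?EFinB ?mule0 ?mul0e ?ltry.
Qed.

Lemma intg_indic (A Om : set P) : measurable A -> measurable Om ->
  (mu A < +oo)%E -> intg mu Om (\1_A : P -> R).
Proof.
move=> mA mOm fA; apply/integrableP; split.
  by apply/measurable_EFinP; exact: measurable_indic.
rewrite (eq_integral (fun x => (\1_A x)%:E)); last first.
  by move=> t _; rewrite gee0_abs// lee_fin.
rewrite integral_indic//; apply: le_lt_trans fA.
by apply: le_measure; rewrite ?inE //; exact: measurableI.
Qed.

Lemma intg_orect a b c d (Om : set P) : measurable Om ->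
  intg mu Om (\1_(orect a b c d) : P -> R).
Proof.
by move=> mOm; apply: intg_indic => //; [exact: orect_measurable|exact: mu2_orect].
Qed.

Lemma orectI a b c d a' b' c' d' :
  orect a b c d `&` orect a' b' c' d' =
  orect (Num.max a a') (Num.min b b') (Num.max c c') (Num.min d d') :> set (plane R).
Proof.
rewrite /orect -setXI; congr (_ `*` _); apply/seteqP; split => x /=;
  rewrite !in_itv /= gt_max lt_min.
- by move=> [/andP[-> ->] /andP[-> ->]].
- by move=> /andP[/andP[-> ->] /andP[-> ->]].
- by move=> [/andP[-> ->] /andP[-> ->]].
- by move=> /andP[/andP[-> ->] /andP[-> ->]].
Qed.

Lemma orects_setI : setI_closed (@orects R).
Proof.
move=> _ _ [[[a b] [c d]] ->] [[[a' b'] [c' d']] ->]; rewrite orectI /=.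
by exists (Num.max a a', Num.min b b', (Num.max c c', Num.min d d')).
Qed.

Variables (Om : set (plane R)) (oOm : open Om).

Let mOm : measurable (Om : set P). Proof. exact: open_measurable2. Qed.

(** Plateaux with growing slopes turn the hypothesis into a zero integral over each open rectangle
    whose closure is in [Om]. Inside one such rectangle the pi-lambda argument gives g = 0 almost
    everywhere, and countably many of them cover [Om]. *)
Lemma fundamental_lemma g : sqi mu Om g ->
  (forall k a b c d, 0 < k -> crect a b c d `<=` Om ->
     \int[mu]_(z in Om) (g z * plateau k a b c d z) = 0) ->
  {ae mu, forall z, Om z -> g z = 0}.
Proof.
move=> hg h0.
have mg := sqi_meas hg.
have sub a b c d : crect a b c d `<=` Om -> orect a b c d `<=` Om.
  move=> h z [h1 h2]; apply: h.
  by split; [move: h1|move: h2]; rewrite /= !in_itv /= => /andP[/ltW -> /ltW ->].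
(* Rectangles have finite measure and |g| <= g^2 + 1, so [g] is integrable on each of them. *)
have ig a b c d : intg mu Om (fun z => g z * \1_(orect a b c d) z).
  apply: (@le_intg _ _ _ _ _ mOm _ (fun z => g z ^+ 2 + \1_(orect a b c d) z)).
  - apply: measurable_funM => //; apply: measurable_indic; exact: orect_measurable.
  - by apply: intgD => //; [exact: sqi_sq|exact: intg_orect].
  - move=> z _; rewrite indicE; case: (_ \in _) => /=.
      by rewrite mulr1 ler_norml; apply/andP; split; nra.
    by rewrite mulr0 normr0 addr0 sqr_ge0.
have hR a b c d : crect a b c d `<=` Om ->
    (\int[mu]_(z in orect a b c d) (g z)%:E = 0)%E /\
    mu.-integrable (orect a b c d) (EFin \o g).
  move=> cO.
  have io := ig a b c d.
  have mo : measurable (orect a b c d : set P) := @orect_measurable R a b c d.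
  have iO : mu.-integrable (orect a b c d) (EFin \o g).
    apply: (@eq_integrable _ _ _ mu _ mo (EFin \o (fun z => g z * \1_(orect a b c d) z))).
      by move=> z zo /=; rewrite indicE zo mulr1.
    by apply: integrableS io => //; exact: sub.
  split=> //.
  have mb (n : nat) : measurable_fun Om
      (fun z : P => (g z * plateau n.+1%:R a b c d z)%:E).
    apply/measurable_EFinP; apply: measurable_funM => //.
    apply: continuous_measurable2 => //; exact: smooth_cont (smooth_plateau _ _ _ _ _).
  have cb : {ae mu, forall z, Om z ->
      (g z * plateau n.+1%:R a b c d z)%:E @[n --> \oo] -->
      (g z * \1_(orect a b c d) z)%:E}.
    apply: aeW => z _; apply: cvg_EFin; first exact: nearW.
    by apply: cvgM; [exact: cvg_cst|exact: plateau_cvg].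
  (* A plateau takes values in [0, 1] and vanishes off its rectangle, so [g] restricted to the
     rectangle dominates. *)
  have dbp (n : nat) z :
      `|g z * plateau n.+1%:R a b c d z| <= `|g z * \1_(orect a b c d) z|.
    rewrite normrM [leRHS]normrM; apply: ler_wpM2l => //; rewrite indicE.
    rewrite (ger0_norm (plateau_ge0 _ _ _ _ _ _)).
    case: (boolP (z \in _)) => /= hz.
      by rewrite normr1 plateau_le1.
    rewrite plateau0 ?normr0 // => hz'; move/negP: hz; apply; exact: mem_set.
  have db : {ae mu, forall z (n : nat), Om z ->
      (`|(g z * plateau n.+1%:R a b c d z)%:E| <= `|g z * \1_(orect a b c d) z|%:E)%E}.
    by apply: aeW => z n _; rewrite /= lee_fin.
  have [_ _ cvg0] := dominated_convergence mOm mb (measurable_int _ io) cb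
    (integrable_norm io) db.
  have : (\int[mu]_(z in Om) (g z * \1_(orect a b c d) z)%:E = 0)%E.
    rewrite -(cvg_lim _ cvg0) //; apply: lim_near_cst => //.
    apply: nearW => n.
    have ip : intg mu Om (fun z => g z * plateau n.+1%:R a b c d z).
      apply: (@le_intg _ _ _ _ _ mOm _ (fun z => `|g z * \1_(orect a b c d) z|)) => //.
        by apply/measurable_EFinP; exact: (mb n).
      exact: integrable_norm io.
    rewrite -[LHS](fineK (integrable_fin_num mOm ip)).
    exact: (congr1 EFin (h0 n.+1%:R a b c d (ltr0Sn _ _) cO)).
  move=> <-; rewrite -[in LHS](setIidr (sub _ _ _ _ cO)) integral_mkcondr.
  apply: eq_integral => z _; rewrite patchE indicE.
  by case: (z \in _); rewrite ?mulr1 ?mulr0.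
have hz (r : R * R * (R * R)) : crect r.1.1 r.1.2 r.2.1 r.2.2 `<=` Om ->
    {ae mu, forall z, orect r.1.1 r.1.2 r.2.1 r.2.2 z -> g z = 0}.
  move=> rO; have [g0 igr] := hR _ _ _ _ rO.
  have mr : measurable (orect r.1.1 r.1.2 r.2.1 r.2.2 : set P) := @orect_measurable R _ _ _ _.
  (* The intersection with another rectangle is a rectangle whose closed version is still inside
     [Om], so [hR] covers the whole pi-system. *)
  have gA (A : set P) : @orects R A ->
      (\int[mu]_(z in orect r.1.1 r.1.2 r.2.1 r.2.2 `&` A) (EFin \o g) z = 0)%E.
    move=> [q ->]; rewrite orectI; apply: (hR _ _ _ _ _).1.
    apply: subset_trans rO => z [/=]; rewrite !in_itv /= !ge_max !le_min.
    by move=> /andP[/andP[h1 _] /andP[h2 _]] /andP[/andP[h3 _] /andP[h4 _]];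
      split; rewrite /= in_itv /= ?h1 ?h3.
  have := @integral_pi_system _ _ _ mu (@orects R) _ _ (@plane_measurableE R)
    orects_setI mr igr g0 gA.
  by apply: filterS => z h zr; have [] := h zr.
have [r [rO ->]] := open_bigcup_orect oOm.
have : \forall z \ae mu, forall n, orect (r n).1.1 (r n).1.2 (r n).2.1 (r n).2.2 z -> g z = 0.
  by apply: ae_foralln => n; exact: hz (rO n).
by apply: ae2S => z hz' [n _ zn]; exact: hz' zn.
Qed.

End fundamental.

(** * Integration by parts and the Gagliardo-Nirenberg inequality *)

Section one_dim.
Variable R : realType.
Notation leb := (@lebesgue_measure R).
Implicit Types (phi dphi : R -> R) (a b x y M : R).

Lemma FTC_itv phi dphi a b : a <= b -> continuous dphi ->
  (forall x, is_derive x (1 : R) phi (dphi x)) ->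
  (\int[leb]_(x in `[a, b]) (dphi x)%:E = (phi b - phi a)%:E)%E.
Proof.
rewrite le_eqVlt => /predU1P[->|ab] cd dp.
  by rewrite set_itv1 integral_set1 subrr.
have cp : continuous phi.
  move=> x; apply: differentiable_continuous; apply/derivable1_diffP.
  by have [] := dp x.
rewrite (@continuous_FTC2 R dphi phi a b) //.
- exact: continuous_subspaceT.
- split.
  + by move=> x _; have [] := dp x.
  + exact: cvg_at_right_filter (cp a).
  + exact: cvg_at_left_filter (cp b).
- by move=> x _; rewrite derive1E; have [] := dp x.
Qed.

Lemma derive_out phi dphi M : (forall x, is_derive x (1 : R) phi (dphi x)) ->
  (forall x, ~ (- M <= x <= M) -> phi x = 0) ->
  forall x, ~ (- M <= x <= M) -> dphi x = 0.
Proof.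
move=> dp p0 x hx.
have h : \forall y \near x, phi y = 0.
  move/negP: hx; rewrite negb_and -!ltNge => /orP[h|h].
    near=> y; apply: p0 => /andP[h1 _]; move: h1; rewrite leNgt => /negP; apply.
    by near: y; exact: lt_nbhsl.
  near=> y; apply: p0 => /andP[_ h1]; move: h1; rewrite leNgt => /negP; apply.
  by near: y; exact: lt_nbhsr.
have [_ <-] := dp x.
rewrite (near_eq_derive (1 : R) h); exact: derive_cst.
Unshelve. all: by end_near.
Qed.

Lemma int_derive_compact phi dphi M : 0 < M -> continuous dphi ->
  (forall x, is_derive x (1 : R) phi (dphi x)) ->
  (forall x, ~ (- M <= x <= M) -> phi x = 0) ->
  (\int[leb]_x (dphi x)%:E = 0)%E.
Proof.
move=> M0 cd dp p0; have d0 := derive_out dp p0.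
(* The interval is enlarged by 1 because [phi] is known to vanish only strictly outside [-M, M], and
   its endpoint values are needed. *)
have -> : (\int[leb]_x (dphi x)%:E =
    \int[leb]_(x in `[(- (M + 1))%R, (M + 1)%R]) (dphi x)%:E)%E.
  rewrite [RHS]integral_mkcond; apply: eq_integral => x _.
  rewrite patchE; case: (boolP (x \in _)) => // /negP hx; rewrite d0 // => hM.
  apply: hx; apply: mem_set; rewrite /= in_itv /=; move: hM; lra.
rewrite (FTC_itv _ cd dp); last lra.
rewrite !p0 ?subrr //; lra.
Qed.

(** Integrate [dphi] from -(M + 1), where [phi] vanishes, up to [x], then enlarge the domain of the
    absolute value to the whole line. *)
Lemma le_int_derive phi dphi M x : continuous dphi ->
  (forall x, is_derive x (1 : R) phi (dphi x)) ->
  (forall x, ~ (- M <= x <= M) -> phi x = 0) ->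
  (`|phi x|%:E <= \int[leb]_t `|dphi t|%:E)%E.
Proof.
move=> cd dp p0.
have mn : measurable_fun setT (fun t => `|dphi t|%:E).
  by apply/measurable_EFinP; apply: measurableT_comp => //; exact: continuous_measurable_fun.
case: (pselect (- M <= x <= M)) => [/andP[hx1 hx2]|/p0 ->]; last first.
  by rewrite normr0; apply: integral_ge0 => t _; rewrite lee_fin.
have e1 : phi (- (M + 1)) = 0 by apply: p0; lra.
have := @FTC_itv phi dphi (- (M + 1)) x ltac:(lra) cd dp.
rewrite e1 subr0 => e2.
have -> : (`|phi x|%:E = `|(phi x)%:E|)%E by [].
rewrite -e2; apply: le_trans (le_abse_integral _ _ _) _ => //.
  apply/measurable_EFinP; apply: measurable_funTS; exact: continuous_measurable_fun.
by apply: ge0_subset_integral => // ; exact: measurableT.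
Qed.

End one_dim.

Lemma ibp_twice_eq (R : realType) (A B C D E : R) :
  C = - A -> D = - B -> E = - C -> E = - D -> A - B = 0.
Proof. by move=> -> -> ->; rewrite !opprK => ->; rewrite subrr. Qed.

Section plane_tests.
Variable R : realType.
Notation P := (measurableTypeR R * measurableTypeR R)%type.
Notation mu := (@mu2 R : {measure set P -> \bar R}).
Notation leb := (@lebesgue_measure R).
Implicit Types (f g p q v : plane R -> R) (x y : R).

Variables (Om : set (plane R)) (oOm : open Om).

Lemma test_box p : test_fun Om p -> exists2 M, 0 < M &
  forall z, ~ (- M < z.1 < M /\ - M < z.2 < M) -> p z = 0.
Proof.
move=> [_ /compact_bounded[M [_ hM]] _].
(* Boundedness provides a bound for every number above [M]; |M| + 1 is one, and one more unit makes
   the box inequalities strict. *)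
exists (`|M| + 2); first by have := normr_ge0 M; lra.
move=> z hz; apply: tsupp0 => hs; apply: hz.
have h1 : M < `|M| + 1 by have := ler_norm M; lra.
have : Num.max `|z.1| `|z.2| <= `|M| + 1 by exact: (hM _ h1 _ hs).
rewrite ge_max => /andP[]; rewrite !ler_norml => /andP[h2 h3] /andP[h4 h5].
lra.
Qed.

Lemma test_bounded p : test_fun Om p -> exists2 B, 0 < B & forall z, `|p z| <= B.
Proof.
move=> hp; have [sp cp _] := hp.
have : compact (p @` tsupp p).
  apply: continuous_compact => //; apply: continuous_subspaceT.
  exact: smooth_cont sp.
move=> /compact_bounded[M [_ hM]]; exists (`|M| + 1).
  by have := normr_ge0 M; lra.
move=> z; case: (pselect (tsupp p z)) => hz.
  by apply: (hM (`|M| + 1)); [have := ler_norm M; lra|exists z].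
by rewrite (tsupp0 hz) normr0; have := normr_ge0 M; lra.
Qed.

Lemma test_meas (D : set P) p : measurable D -> test_fun Om p ->
  measurable_fun D (p : P -> R).
Proof.
move=> mD hp; apply: continuous_measurable2 => //.
exact: smooth_cont (test_smooth hp).
Qed.

Lemma test_intg (D : set P) p : measurable D -> test_fun Om p -> intg mu D p.
Proof.
move=> mD hp; have [M M0 hM] := test_box hp; have [B B0 hB] := test_bounded hp.
apply: (@le_intg _ _ _ _ _ mD _ (fun z => B * \1_(orect (- M) M (- M) M) z)).
- exact: test_meas.
- by apply: intgZ => //; exact: intg_orect.
- move=> z _; rewrite indicE; case: (boolP (z \in _)) => [_|/negP hz].
    by rewrite mulr1.
  rewrite hM ?normr0 ?mulr0 // => -[h1 h2]; apply: hz; apply: mem_set.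
  by split; rewrite /= in_itv.
Qed.

Lemma test_sqi (D : set P) p : measurable D -> test_fun Om p -> sqi mu D p.
Proof.
move=> mD hp; apply/sqiP; split; first exact: test_meas.
exact: (test_intg mD (test_mul (test_smooth hp) hp)).
Qed.

Lemma is_deriveDx f x y : smooth f ->
  is_derive x (1 : R) (fun s : R => f (s, y)) (Dx f (x, y)).
Proof.
move=> sf; apply: DeriveDef; last by rewrite Dx_line.
by apply/derivable_linex; exact: smooth_derx.
Qed.

Lemma is_deriveDy f x y : smooth f ->
  is_derive y (1 : R) (fun s : R => f (x, s)) (Dy f (x, y)).
Proof.
move=> sf; apply: DeriveDef; last by rewrite Dy_line.
by apply/derivable_liney; exact: smooth_dery.
Qed.

Lemma cont_linex f y : continuous f -> continuous (fun s : R => f (s, y)).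
Proof.
move=> cf s; apply: (@continuous_comp _ _ _ (fun s : R => (s, y)) f); last exact: cf.
move=> A [[B C] /= [nB nC] BC]; apply: filterS nB => t Bt; apply: BC.
by split => //=; exact: nbhs_singleton nC.
Qed.

Lemma cont_liney f x : continuous f -> continuous (fun s : R => f (x, s)).
Proof.
move=> cf s; apply: (@continuous_comp _ _ _ (fun s : R => (x, s)) f); last exact: cf.
move=> A [[B C] /= [nB nC] BC]; apply: filterS nC => t Ct; apply: BC.
by split => //=; exact: nbhs_singleton nB.
Qed.

Lemma test_lines p : test_fun Om p -> exists2 M, 0 < M &
  (forall y x, ~ (- M <= x <= M) -> p (x, y) = 0) /\
  (forall x y, ~ (- M <= y <= M) -> p (x, y) = 0).
Proof.
move=> /test_box[M M0 hM]; exists M => //; split => y x h; apply: hM => /= -[h1 h2];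
  apply: h; lra.
Qed.

(** By Fubini, since on each horizontal line the derivative of a compactly supported function
    integrates to 0. *)
Lemma int_Dx p : test_fun Om p -> \int[mu]_z Dx p z = 0.
Proof.
move=> hp; have [M M0 [hx hy]] := test_lines hp.
have sp := test_smooth hp.
have hi : intg mu setT (Dx p) by apply: test_intg => //; exact: test_Dx.
rewrite /Rintegral -(integral21_prod_meas1 hi) integral0_eq // => y _.
rewrite /fubini_G.
apply: (int_derive_compact M0 _ _ (hx y)).
- by apply: (cont_linex (f := Dx p)); exact: smooth_cont (smooth_Dx sp).
- by move=> x; exact: is_deriveDx.
Qed.

Lemma int_Dy p : test_fun Om p -> \int[mu]_z Dy p z = 0.
Proof.
move=> hp; have [M M0 [hx hy]] := test_lines hp.
have sp := test_smooth hp.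
have hi : intg mu setT (Dy p) by apply: test_intg => //; exact: test_Dy.
rewrite /Rintegral -(integral12_prod_meas1 hi) integral0_eq // => x _.
rewrite /fubini_F.
apply: (int_derive_compact M0 _ _ (hy x)).
- by apply: (cont_liney (f := Dy p)); exact: smooth_cont (smooth_Dy sp).
- by move=> y; exact: is_deriveDy.
Qed.

Lemma int_out f : (forall z, ~ Om z -> f z = 0) ->
  \int[mu]_(z in Om) f z = \int[mu]_z f z.
Proof.
move=> h; rewrite Rintegral_mkcond; apply: eq_Rintegral => z _.
by rewrite patchE; case: (boolP (z \in _)) => // /negP hz; rewrite h // => /mem_set.
Qed.

Let mOm : measurable (Om : set P). Proof. exact: open_measurable2. Qed.

Lemma ibp_x p q : smooth p -> test_fun Om q ->
  \int[mu]_(z in Om) (p z * Dx q z) = - \int[mu]_(z in Om) (Dx p z * q z).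
Proof.
move=> sp hq; have sq := test_smooth hq.
have h1 := test_mul sp (test_Dx hq); have h2 := test_mul (smooth_Dx sp) hq.
have := int_Dx (test_mul sp hq).
rewrite -int_out; last by move=> z; exact: test_out (test_Dx (test_mul sp hq)).
rewrite DxM //.
under eq_Rintegral do rewrite (mulrC (q _)).
rewrite RintegralD //; [|exact: (test_intg mOm h1)|exact: (test_intg mOm h2)].
by move=> /eqP; rewrite addr_eq0 => /eqP.
Qed.

Lemma ibp_y p q : smooth p -> test_fun Om q ->
  \int[mu]_(z in Om) (p z * Dy q z) = - \int[mu]_(z in Om) (Dy p z * q z).
Proof.
move=> sp hq; have sq := test_smooth hq.
have h1 := test_mul sp (test_Dy hq); have h2 := test_mul (smooth_Dy sp) hq.
have := int_Dy (test_mul sp hq).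
rewrite -int_out; last by move=> z; exact: test_out (test_Dy (test_mul sp hq)).
rewrite DyM //.
under eq_Rintegral do rewrite (mulrC (q _)).
rewrite RintegralD //; [|exact: (test_intg mOm h1)|exact: (test_intg mOm h2)].
by move=> /eqP; rewrite addr_eq0 => /eqP.
Qed.

(* Tested against plateaux, on which the two derivatives commute. *)
Lemma DxDy_ae p : test_fun Om p ->
  {ae @mu2 R, forall z, Om z -> Dx (Dy p) z = Dy (Dx p) z}.
Proof.
move=> hp; have sp := test_smooth hp.
have h1 := test_Dx (test_Dy hp); have h2 := test_Dy (test_Dx hp).
apply: ae2S (@fundamental_lemma R Om oOm (fun z => Dx (Dy p) z - Dy (Dx p) z)
  (test_sqi mOm (testB h1 h2)) _).
  by move=> z h /h /eqP; rewrite subr_eq0 => /eqP.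
move=> k a b c d k0 cO.
have hq := plateau_test k0 cO; set q := plateau k a b c d in hq *.
have sq := test_smooth hq.
transitivity (\int[mu]_(z in Om) (Dx (Dy p) z * q z) -
    \int[mu]_(z in Om) (Dy (Dx p) z * q z)).
  rewrite -(RintegralB mOm (test_intg mOm (test_mul (test_smooth h1) hq))
    (test_intg mOm (test_mul (test_smooth h2) hq))).
  by apply: eq_Rintegral => z _; rewrite mulrBl.
have e1 := ibp_x (smooth_Dy sp) hq.
have e2 := ibp_y (smooth_Dx sp) hq.
have e3 := ibp_y sp (test_Dx hq).
have e4 := ibp_x sp (test_Dy hq).
have e5 : Dx (Dy q) = Dy (Dx q) by exact: plateau_DxDy.
rewrite e5 in e4.
exact (ibp_twice_eq e1 e2 e3 e4).
Qed.

End plane_tests.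

Lemma eq_le_mul (R : realType) (a a' b b' c c' : R) :
  a = a' -> b = b' -> c = c' -> a' <= b' * c' -> a <= b * c.
Proof. by move=> -> -> ->. Qed.

Lemma le_fineM (R : realType) (a b c : \bar R) :
  a \is a fin_num -> b \is a fin_num -> c \is a fin_num ->
  (a <= b * c)%E -> fine a <= fine b * fine c.
Proof. by move: a b c => [a| |] [b| |] [c| |]. Qed.

Lemma normr_double (R : realType) (a b : R) : `|a * b + a * b| = 2 * (`|a| * `|b|).
Proof.
have -> : a * b + a * b = 2 * (a * b) by ring.
by rewrite normrM normrM ger0_norm.
Qed.

Lemma le_double_prod (R : realType) (X Y v a b : R) :
  0 <= X -> 0 <= Y -> 0 <= v ->
  X <= 2 * (Num.sqrt v * a) -> Y <= 2 * (Num.sqrt v * b) ->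
  X * Y <= 4 * v * (a * b).
Proof.
move=> X0 Y0 v0 hX hY; apply: (le_trans (ler_pM X0 Y0 hX hY)).
rewrite -[X in _ <= 4 * X * _](sqr_sqrtr v0).
by rewrite le_eqVlt; apply/orP; left; apply/eqP; ring.
Qed.

Section gagliardo.
Variable R : realType.
Notation P := (measurableTypeR R * measurableTypeR R)%type.
Notation mu := (@mu2 R : {measure set P -> \bar R}).
Notation leb := (@lebesgue_measure R).
Implicit Types (f g p q v : plane R -> R) (x y : R).

Variables (Om : set (plane R)) (oOm : open Om).
Let mOm : measurable (Om : set P). Proof. exact: open_measurable2. Qed.

(** Bound one factor |f(x, y)| by the integral A(y) of |Dx f| along the horizontal line, the other
    by the integral B(x) of |Dy f| along the vertical line. The product A(y) B(x) separates, and
    integrating it gives the right-hand side. *)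
Lemma gagliardo_nirenberg f : test_fun Om f ->
  \int[mu]_(z in Om) (f z ^+ 2) <=
  (\int[mu]_(z in Om) `|Dx f z|) * (\int[mu]_(z in Om) `|Dy f z|).
Proof.
move=> hf; have sf := test_smooth hf; have [M M0 [hx hy]] := test_lines hf.
have hfx := test_Dx hf; have hfy := test_Dy hf.
have e2 : \int[mu]_(z in Om) (f z ^+ 2) = \int[mu]_z (f z ^+ 2).
  by apply: int_out => z /(test_out hf) ->; rewrite expr0n.
have ex : \int[mu]_(z in Om) `|Dx f z| = \int[mu]_z `|Dx f z|.
  by apply: int_out => z /(test_out hfx) ->; rewrite normr0.
have ey : \int[mu]_(z in Om) `|Dy f z| = \int[mu]_z `|Dy f z|.
  by apply: int_out => z /(test_out hfy) ->; rewrite normr0.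
have mx : measurable_fun setT (fun z : P => `|Dx f z|%:E).
  by apply/measurable_EFinP; apply: measurableT_comp => //; exact: test_meas hfx.
have my : measurable_fun setT (fun z : P => `|Dy f z|%:E).
  by apply/measurable_EFinP; apply: measurableT_comp => //; exact: test_meas hfy.
have m2 : measurable_fun setT (fun z : P => (f z ^+ 2)%:E).
  by apply/measurable_EFinP; apply: measurable_funX; exact: test_meas hf.
pose A y := (\int[leb]_s `|Dx f (s, y)|%:E)%E.
pose B x := (\int[leb]_t `|Dy f (x, t)|%:E)%E.
have ax0 (z : P) : (0 <= `|Dx f z|%:E)%E by rewrite lee_fin.
have ay0 (z : P) : (0 <= `|Dy f z|%:E)%E by rewrite lee_fin.
have a20 (z : P) : (0 <= (f z ^+ 2)%:E)%E by rewrite lee_fin sqr_ge0.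
have A0 y : (0 <= A y)%E by apply: integral_ge0 => s _; rewrite lee_fin.
have B0 x : (0 <= B x)%E by apply: integral_ge0 => s _; rewrite lee_fin.
have mA : measurable_fun setT A.
  exact: (@measurable_fun_fubini_tonelli_G _ _ _ _ _ leb _ mx ax0).
have mB : measurable_fun setT B.
  exact: (@measurable_fun_fubini_tonelli_F _ _ _ _ _ leb _ my ay0).
have IA : (\int[mu]_z `|Dx f z|%:E = \int[leb]_y A y)%E.
  exact (@fubini_tonelli2 _ _ _ _ _ leb leb _ mx ax0).
have IB' : (\int[mu]_z `|Dy f z|%:E = \int[leb]_x B x)%E.
  exact (@fubini_tonelli1 _ _ _ _ _ leb leb _ my ay0).
(* The inequality is proved in the extended reals, where Tonelli needs no integrability of [A] or
   [B]; finiteness of the three plane integrals brings it back to reals. *)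
have key : (\int[mu]_z (f z ^+ 2)%:E <=
    (\int[mu]_z `|Dx f z|%:E) * (\int[mu]_z `|Dy f z|%:E))%E.
  rewrite IA IB' (@fubini_tonelli1 _ _ _ _ _ leb leb _ m2 a20).
  have IA0 : (0 <= \int[leb]_y A y)%E by apply: integral_ge0.
  have eAB : (\int[leb]_x ((\int[leb]_y A y) * B x) =
     (\int[leb]_y A y) * (\int[leb]_x B x))%E.
    exact: (ge0_integralZl leb measurableT mB (fun x _ => B0 x) IA0).
  rewrite -eAB.
  apply: ge0_le_integral.
  - exact: measurableT.
  - by move=> x _; apply: integral_ge0 => y _; exact: a20.
  - exact: (@measurable_fun_fubini_tonelli_F _ _ _ _ _ leb _ m2 a20).
  - by apply: emeasurable_funM; [exact: measurable_cst|exact: mB].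
  - move=> x _; rewrite /fubini_F.
    have eB : (\int[leb]_y (B x * A y) = B x * (\int[leb]_y A y))%E.
      exact: (ge0_integralZl leb measurableT mA (fun y _ => A0 y) (B0 x)).
    rewrite [leRHS]muleC -eB.
    apply: ge0_le_integral.
    + exact: measurableT.
    + by move=> y _; exact: a20.
    + apply/measurable_EFinP; apply: measurable_funX.
      apply: continuous_measurable_fun; exact: cont_liney (smooth_cont sf).
    + by apply: emeasurable_funM; [exact: measurable_cst|exact: mA].
    + move=> y _; have -> : f (x, y) ^+ 2 = `|f (x, y)| * `|f (x, y)|.
        by rewrite -expr2 real_normK ?num_real.
      rewrite EFinM.
      apply: lee_pmul; rewrite ?lee_fin //.
      * apply: (@le_int_derive R (fun t => f (x, t)) (fun t => Dy f (x, t)) M y).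
        - by apply: (cont_liney (f := Dy f)); exact: smooth_cont (smooth_Dy sf).
        - by move=> t; exact: is_deriveDy.
        - exact: hy.
      * apply: (@le_int_derive R (fun t => f (t, y)) (fun t => Dx f (t, y)) M x).
        - by apply: (cont_linex (f := Dx f)); exact: smooth_cont (smooth_Dx sf).
        - by move=> t; exact: is_deriveDx.
        - exact: hx.
have i1 : intg mu setT (fun z => f z ^+ 2).
  exact: (sqi_sq (test_sqi measurableT hf)).
have i2 : intg mu setT (fun z => `|Dx f z|).
  exact: integrable_norm (test_intg measurableT hfx).
have i3 : intg mu setT (fun z => `|Dy f z|).
  exact: integrable_norm (test_intg measurableT hfy).
apply: (eq_le_mul e2 ex ey).
exact: (le_fineM (integrable_fin_num measurableT i1)
  (integrable_fin_num measurableT i2) (integrable_fin_num measurableT i3) key).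
Qed.

(** Ladyzhenskaya's inequality: [gagliardo_nirenberg] applied to v^2, whose partial derivatives are
    2 v Dx v and 2 v Dy v, followed by Cauchy-Schwarz on each factor. The 4 is the product of the
    two 2s. *)
Lemma test_L4 v : test_fun Om v ->
  \int[mu]_(z in Om) ((v z ^+ 2) ^+ 2) <=
  4 * \int[mu]_(z in Om) (v z ^+ 2) *
  (Num.sqrt (\int[mu]_(z in Om) (Dx v z ^+ 2)) *
   Num.sqrt (\int[mu]_(z in Om) (Dy v z ^+ 2))).
Proof.
move=> hv; have sv := test_smooth hv.
have := gagliardo_nirenberg (test_mul sv hv).
move=> /le_trans; apply.
have bd (w : plane R -> R) : test_fun Om w ->
    \int[mu]_(z in Om) (2 * (`|v z| * `|w z|)) <=
    2 * (Num.sqrt (\int[mu]_(z in Om) (v z ^+ 2)) *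
         Num.sqrt (\int[mu]_(z in Om) (w z ^+ 2))).
  move=> hw.
  have nsq (u : plane R -> R) : test_fun Om u -> sqi mu Om (fun z => `|u z|).
    move=> hu; apply/sqiP; split.
      by apply: measurableT_comp => //; exact: (test_meas mOm hu).
    apply: (eq_intg mOm _ (sqi_sq (test_sqi mOm hu))) => z _.
    by rewrite real_normK ?num_real.
  have h := cauchy_schwarz_norm mOm (nsq _ hv) (nsq _ hw).
  rewrite RintegralZl //; last exact: (sqiM mOm (nsq _ hv) (nsq _ hw)).
  apply: ler_wpM2l => //; apply: le_trans (ler_norm _) _.
  apply: le_trans h _; rewrite le_eqVlt; apply/orP; left; apply/eqP.
  by congr (Num.sqrt _ * Num.sqrt _); apply: eq_Rintegral => z _; rewrite real_normK ?num_real.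
have hx := bd _ (test_Dx hv); have hy := bd _ (test_Dy hv).
have E (w : plane R -> R) z : `|v z * w z + v z * w z| = 2 * (`|v z| * `|w z|).
  exact: normr_double.
rewrite (DxM sv sv) (DyM sv sv).
apply: le_double_prod.
- by apply: Rintegral_ge0 => z _; exact: normr_ge0.
- by apply: Rintegral_ge0 => z _; exact: normr_ge0.
- by apply: Rintegral_ge0 => z _; exact: sqr_ge0.
- by under eq_Rintegral do rewrite E; exact: hx.
- by under eq_Rintegral do rewrite E; exact: hy.
Qed.

End gagliardo.

(** * Weak derivatives *)

Section wrappers.
Variable R : realType.
Notation P := (measurableTypeR R * measurableTypeR R)%type.
Notation mu := (@mu2 R : {measure set P -> \bar R}).
Implicit Types (f g h p q : plane R -> R) (k : R).

(** Together with [integ] and [L2] it is made opaque after this section; the lemmas up to there are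
    the interface to measure theory used by everything later. *)
Definition Lone (Om : set (plane R)) f := intg mu Om f.

Definition ae_on (Om : set (plane R)) (A : plane R -> Prop) :=
  {ae @mu2 R, forall z, Om z -> A z}.

Variables (Om : set (plane R)) (oOm : open Om).
Let mOm : measurable (Om : set P). Proof. exact: open_measurable2. Qed.

Notation L1 := (Lone Om).
Notation L2 := (L2 Om).
Notation I := (integ Om).

Lemma ae_onS (A B : plane R -> Prop) : (forall z, Om z -> A z -> B z) ->
  ae_on Om A -> ae_on Om B.
Proof. by move=> h; apply: ae2S => z hz Oz; apply: h => //; exact: hz. Qed.

Lemma ae_onS2 (A B C : plane R -> Prop) : (forall z, Om z -> A z -> B z -> C z) ->
  ae_on Om A -> ae_on Om B -> ae_on Om C.
Proof.
by move=> h; apply: ae2S2 => z h1 h2 Oz; apply: h => //; [exact: h1|exact: h2].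
Qed.

Lemma ae_onT (A : plane R -> Prop) : (forall z, Om z -> A z) -> ae_on Om A.
Proof. by move=> h; apply: aeW. Qed.

Lemma L1D f g : L1 f -> L1 g -> L1 (fun z => f z + g z).
Proof. exact: intgD. Qed.

Lemma L1B f g : L1 f -> L1 g -> L1 (fun z => f z - g z).
Proof. exact: intgB. Qed.

Lemma L1Z k f : L1 f -> L1 (fun z => k * f z).
Proof. exact: intgZ. Qed.

Lemma L2_lin k f g : L2 f -> L2 g -> L2 (fun z => k * f z + g z).
Proof. exact: sqi_lin. Qed.

Lemma L2D f g : L2 f -> L2 g -> L2 (fun z => f z + g z).
Proof. exact: sqiD. Qed.

Lemma L2B f g : L2 f -> L2 g -> L2 (fun z => f z - g z).
Proof. exact: sqiB. Qed.

Lemma L2M f g : L2 f -> L2 g -> L1 (fun z => f z * g z).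
Proof. exact: sqiM. Qed.

Lemma L2sq f : L2 f -> L1 (fun z => f z ^+ 2).
Proof. exact: sqi_sq. Qed.

Lemma L2_test p : test_fun Om p -> L2 p.
Proof. by move=> hp; exact: (test_sqi mOm hp). Qed.

Lemma integD f g : L1 f -> L1 g -> I (fun z => f z + g z) = I f + I g.
Proof. by move=> hf hg; exact: (RintegralD mOm hf hg). Qed.

Lemma integB f g : L1 f -> L1 g -> I (fun z => f z - g z) = I f - I g.
Proof. by move=> hf hg; exact: (RintegralB mOm hf hg). Qed.

Lemma integZ k f : L1 f -> I (fun z => k * f z) = k * I f.
Proof. by move=> hf; exact: (RintegralZl k mOm hf). Qed.

Lemma integ_ge0 f : (forall z, Om z -> 0 <= f z) -> 0 <= I f.
Proof. by move=> h; exact: Rintegral_ge0. Qed.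

Lemma integ_le f g : L1 f -> L1 g -> (forall z, Om z -> f z <= g z) -> I f <= I g.
Proof. by move=> hf hg h; exact: (le_Rintegral mOm hf hg h). Qed.

Lemma integ_eq f g : (forall z, Om z -> f z = g z) -> I f = I g.
Proof. by move=> h; apply: eq_Rintegral => z /set_mem; exact: h. Qed.

Lemma L1_meas f : L1 f -> measurable_fun (Om : set P) (f : P -> R).
Proof. exact: intg_meas. Qed.

Lemma L1_ext f g : (forall z, Om z -> f z = g z) -> L1 f -> L1 g.
Proof. by move=> h hf; exact: (eq_intg mOm h hf). Qed.

Lemma integ_ae f g : L1 f -> L1 g -> ae_on Om (fun z => f z = g z) -> I f = I g.
Proof.
move=> hf hg h.
exact: (ae_eqI mOm (L1_meas hf) (L1_meas hg) h).
Qed.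

Lemma integ_CS f g : L2 f -> L2 g ->
  `|I (fun z => f z * g z)| <=
    Num.sqrt (I (fun z => f z ^+ 2)) * Num.sqrt (I (fun z => g z ^+ 2)).
Proof. by move=> hf hg; exact: (cauchy_schwarz_norm mOm hf hg). Qed.

Lemma L2_sqr_limit f (K : R) : L2 f ->
  (forall e, 0 < e -> exists g, [/\ L2 g, L2 (fun z => g z ^+ 2),
     I (fun z => (f z - g z) ^+ 2) <= e &
     I (fun z => (g z ^+ 2) ^+ 2) <= K]) ->
  L2 (fun z => f z ^+ 2) /\ I (fun z => (f z ^+ 2) ^+ 2) <= K.
Proof. by move=> hf h; exact: (sqi_sqr_limit mOm hf h). Qed.

Lemma integ_test_L4 v : test_fun Om v ->
  I (fun z => (v z ^+ 2) ^+ 2) <= 4 * I (fun z => v z ^+ 2) *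
  (Num.sqrt (I (fun z => Dx v z ^+ 2)) * Num.sqrt (I (fun z => Dy v z ^+ 2))).
Proof. by move=> hv; exact: (test_L4 oOm hv). Qed.

Lemma integ_ibp_x p q : smooth p -> test_fun Om q ->
  I (fun z => p z * Dx q z) = - I (fun z => Dx p z * q z).
Proof. by move=> hp hq; exact: (ibp_x oOm hp hq). Qed.

Lemma integ_ibp_y p q : smooth p -> test_fun Om q ->
  I (fun z => p z * Dy q z) = - I (fun z => Dy p z * q z).
Proof. by move=> hp hq; exact: (ibp_y oOm hp hq). Qed.

Lemma L2_fundamental g : L2 g ->
  (forall p, test_fun Om p -> I (fun z => g z * p z) = 0) ->
  ae_on Om (fun z => g z = 0).
Proof.
move=> hg h; apply: (fundamental_lemma oOm hg) => k a b c d k0 cO.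
exact: h (plateau_test k0 cO).
Qed.

Lemma L2_meas f : L2 f -> measurable_fun (Om : set P) (f : P -> R).
Proof. by case. Qed.

Lemma L2_mul f g : L2 f -> L2 g -> L2 (fun z => f z ^+ 2) -> L2 (fun z => g z ^+ 2) ->
  L2 (fun z => f z * g z).
Proof.
move=> hf hg hf2 hg2; apply/sqiP; split.
  by apply: measurable_funM; [exact: (L2_meas hf)|exact: (L2_meas hg)].
apply: (eq_intg mOm _ (sqiM mOm hf2 hg2)) => z _.
by rewrite exprMn.
Qed.

End wrappers.

Global Opaque integ Lone L2.

Section sobolev.
Variable R : realType.
Implicit Types (f g h p q u v w : plane R -> R) (k : R).
Variables (Om : set (plane R)) (oOm : open Om).

Notation L1 := (Lone Om).
Notation L2 := (L2 Om).
Notation I := (integ Om).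
Notation test := (test_fun Om).

(** The intersection of L^2 and L^4, phrased through [L2] so that Cauchy-Schwarz is the only
    inequality required; [l4norm] is the fourth root as a nested square root. *)
Definition Lfour f := L2 f /\ L2 (fun z => f z ^+ 2).

Definition l2norm f := Num.sqrt (I (fun z => f z ^+ 2)).
Definition l4norm f := Num.sqrt (Num.sqrt (I (fun z => (f z ^+ 2) ^+ 2))).

Notation L4 := Lfour.
Notation n2 := l2norm.
Notation n4 := l4norm.

Lemma L4_mul g h : L4 g -> L4 h ->
  L2 (fun z => g z * h z) /\ n2 (fun z => g z * h z) <= n4 g * n4 h.
Proof.
move=> [hg hg2] [hh hh2].
have hgh := L2_mul oOm hg hh hg2 hh2.
split=> //; rewrite /l2norm /l4norm -sqrtrM ?sqrtr_ge0 //; apply: ler_wsqrtr.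
have e : I (fun z => (g z * h z) ^+ 2) = I (fun z => g z ^+ 2 * h z ^+ 2).
  by apply: integ_eq => z _; rewrite exprMn.
rewrite e; apply: le_trans (ler_norm _) _.
exact: (integ_CS oOm hg2 hh2).
Qed.

(** Hoelder's inequality with exponents 2, 4, 4, as two applications of Cauchy-Schwarz. *)
Lemma tri_bound f g h : L2 f -> L4 g -> L4 h ->
  L1 (fun z => f z * (g z * h z)) /\
  `|I (fun z => f z * (g z * h z))| <= n2 f * (n4 g * n4 h).
Proof.
move=> hf hg hh; have [hgh le_gh] := L4_mul hg hh.
split; first exact: (L2M oOm hf hgh).
apply: le_trans (integ_CS oOm hf hgh) _.
by apply: ler_wpM2l le_gh; exact: sqrtr_ge0.
Qed.

Lemma is_wderiv_L2 i j u g : is_wderiv Om i j u g -> L2 g.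
Proof. by case. Qed.

Lemma is_wderiv_test i j u g p : is_wderiv Om i j u g -> test p ->
  I (fun z => u z * partial i j p z) = (-1) ^+ (i + j) * I (fun z => g z * p z).
Proof. by move=> [_]; apply. Qed.

(** This makes the choice in [wderiv] harmless: any weak derivative that can be exhibited agrees
    almost everywhere with the chosen one. *)
Lemma is_wderiv_unique i j u g h : is_wderiv Om i j u g -> is_wderiv Om i j u h ->
  ae_on Om (fun z => g z = h z).
Proof.
move=> hg hh.
have lg := is_wderiv_L2 hg; have lh := is_wderiv_L2 hh.
have : ae_on Om (fun z => g z - h z = 0).
  apply: (L2_fundamental oOm); first exact: (L2B oOm lg lh).
  move=> p hp; have lp := L2_test oOm hp.
  have e : I (fun z => (g z - h z) * p z) = I (fun z => g z * p z) - I (fun z => h z * p z).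
    rewrite -(integB oOm (L2M oOm lg lp) (L2M oOm lh lp)).
    by apply: integ_eq => z _; rewrite mulrBl.
  have e1 := is_wderiv_test hg hp; have e2 := is_wderiv_test hh hp.
  have e3 : (-1) ^+ (i + j) * I (fun z => g z * p z) =
            (-1) ^+ (i + j) * I (fun z => h z * p z).
    by rewrite -e1 -e2.
  have /mulfI/(_ _ _ e3) e4 : (-1) ^+ (i + j) != 0 :> R by rewrite signr_eq0.
  by rewrite e e4 subrr.
by apply: ae_onS => z _ /eqP; rewrite subr_eq0 => /eqP.
Qed.

Lemma test_partial i j p : test p -> test (partial i j p).
Proof.
move=> hp.
elim: i => [|i IH]; last by rewrite partialSx; exact: test_Dx.
by elim: j => [|j IH]; rewrite ?partial00 // partial0S; exact: test_Dy.
Qed.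

Lemma is_wderiv_lin i j k u v g h : L2 u -> L2 v ->
  is_wderiv Om i j u g -> is_wderiv Om i j v h ->
  is_wderiv Om i j (fun z => k * u z + v z) (fun z => k * g z + h z).
Proof.
move=> lu lv hg hh; have lg := is_wderiv_L2 hg; have lh := is_wderiv_L2 hh.
split; first exact: (L2_lin oOm k lg lh).
move=> p hp; have lp := L2_test oOm hp.
have lq := L2_test oOm (test_partial i j hp).
have e1 := is_wderiv_test hg hp; have e2 := is_wderiv_test hh hp.
have lin (a b c : plane R -> R) : L2 a -> L2 b -> L2 c ->
  I (fun z => (k * a z + b z) * c z) = k * I (fun z => a z * c z) + I (fun z => b z * c z).
  move=> la lb lc.
  rewrite -(integZ oOm k (L2M oOm la lc)).
  rewrite -(integD oOm (L1Z oOm k (L2M oOm la lc)) (L2M oOm lb lc)).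
  by apply: integ_eq => z _; rewrite mulrDl mulrA.
rewrite (lin _ _ _ lu lv lq) (lin _ _ _ lg lh lp) e1 e2.
by rewrite mulrDr mulrCA.
Qed.

Lemma H2_L2 u : H2 Om u -> L2 u.
Proof. by case. Qed.

Lemma wderivP i j u : H2 Om u -> (i + j <= 2)%N ->
  is_wderiv Om i j u (wderiv Om i j u).
Proof.
move=> [_ h] ij; have [g hg] := h i j ij.
exact (@xgetPex _ (fun=> 0) [set g | is_wderiv Om i j u g] (ex_intro _ g hg)).
Qed.

Lemma wderiv_eq i j u g : is_wderiv Om i j u g ->
  ae_on Om (fun z => wderiv Om i j u z = g z).
Proof.
move=> hg; apply: is_wderiv_unique (hg).
exact (@xgetPex _ (fun=> 0) [set g | is_wderiv Om i j u g] (ex_intro _ g hg)).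
Qed.

Opaque wderiv.

Lemma H2_lin k u v : H2 Om u -> H2 Om v -> H2 Om (fun z => k * u z + v z).
Proof.
move=> hu hv; have [lu _] := hu; have [lv _] := hv.
split; first exact: (L2_lin oOm k lu lv).
move=> i j ij; exists (fun z => k * wderiv Om i j u z + wderiv Om i j v z).
by apply: is_wderiv_lin => //; exact: wderivP.
Qed.

Lemma wderiv_lin i j k u v : H2 Om u -> H2 Om v -> (i + j <= 2)%N ->
  ae_on Om (fun z => wderiv Om i j (fun z => k * u z + v z) z =
    k * wderiv Om i j u z + wderiv Om i j v z).
Proof.
move=> hu hv ij; apply: wderiv_eq.
by apply: is_wderiv_lin; [case: hu|case: hv|exact: wderivP|exact: wderivP].
Qed.

Lemma is_wderiv_x p : test p -> is_wderiv Om 1 0 p (Dx p).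
Proof.
move=> hp; split; first exact: (L2_test oOm (test_Dx hp)).
move=> q hq; rewrite expr1 mulN1r !partialE.
exact: (integ_ibp_x oOm (test_smooth hp) hq).
Qed.

Lemma is_wderiv_y p : test p -> is_wderiv Om 0 1 p (Dy p).
Proof.
move=> hp; split; first exact: (L2_test oOm (test_Dy hp)).
move=> q hq; rewrite expr1 mulN1r !partialE.
exact: (integ_ibp_y oOm (test_smooth hp) hq).
Qed.

Lemma is_wderiv_xx p : test p -> is_wderiv Om 2 0 p (Dx (Dx p)).
Proof.
move=> hp; split; first exact: (L2_test oOm (test_Dx (test_Dx hp))).
move=> q hq; rewrite !partialE sqrrN expr1n mul1r.
have sp := test_smooth hp.
rewrite (integ_ibp_x oOm sp (test_Dx hq)).
by rewrite (integ_ibp_x oOm (smooth_Dx sp) hq) opprK.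
Qed.

Lemma is_wderiv_yy p : test p -> is_wderiv Om 0 2 p (Dy (Dy p)).
Proof.
move=> hp; split; first exact: (L2_test oOm (test_Dy (test_Dy hp))).
move=> q hq; rewrite !partialE sqrrN expr1n mul1r.
have sp := test_smooth hp.
rewrite (integ_ibp_y oOm sp (test_Dy hq)).
by rewrite (integ_ibp_y oOm (smooth_Dy sp) hq) opprK.
Qed.

(** Integration by parts first removes the outer [Dx] from [Dx (Dy q)], so the derivatives fall on
    [p] in the opposite order. *)
Lemma is_wderiv_xy p : test p -> is_wderiv Om 1 1 p (Dy (Dx p)).
Proof.
move=> hp; split; first exact: (L2_test oOm (test_Dy (test_Dx hp))).
move=> q hq; rewrite !partialE sqrrN expr1n mul1r.
have sp := test_smooth hp.
rewrite (integ_ibp_x oOm sp (test_Dy hq)).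
by rewrite (integ_ibp_y oOm (smooth_Dx sp) hq) opprK.
Qed.

Lemma is_wderiv_id u : L2 u -> is_wderiv Om 0 0 u u.
Proof.
by move=> lu; split=> // q hq; rewrite expr0 mul1r.
Qed.

Lemma test_H2 p : test p -> H2 Om p.
Proof.
move=> hp; split; first exact: (L2_test oOm hp).
move=> [|[|[|i]]] [|[|[|j]]] //= _.
- by exists p; exact: is_wderiv_id (L2_test oOm hp).
- by exists (Dy p); exact: is_wderiv_y.
- by exists (Dy (Dy p)); exact: is_wderiv_yy.
- by exists (Dx p); exact: is_wderiv_x.
- by exists (Dy (Dx p)); exact: is_wderiv_xy.
- by exists (Dx (Dx p)); exact: is_wderiv_xx.
Qed.

(** Both orders of the mixed derivative are listed, since the product rule applied to a Jacobian
    produces both; [DxDy_ae] identifies them. *)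
Lemma test_derivs p : test p -> ae_on Om (fun z =>
  [/\ dx Om p z = Dx p z, dy Om p z = Dy p z &
  [/\ dxx Om p z = Dx (Dx p) z, dxy Om p z = Dx (Dy p) z,
      dxy Om p z = Dy (Dx p) z & dyy Om p z = Dy (Dy p) z]]).
Proof.
move=> hp.
have h1 := wderiv_eq (is_wderiv_x hp); have h2 := wderiv_eq (is_wderiv_y hp).
have h3 := wderiv_eq (is_wderiv_xx hp); have h4 := wderiv_eq (is_wderiv_xy hp).
have h5 := wderiv_eq (is_wderiv_yy hp).
have h6 : ae_on Om (fun z => Dx (Dy p) z = Dy (Dx p) z) := DxDy_ae oOm hp.
have h12 := ae_onS2 (fun z _ a b => conj a b) h1 h2.
have h34 := ae_onS2 (fun z _ a b => conj a b) h3 h4.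
have h56 := ae_onS2 (fun z _ a b => conj a b) h5 h6.
have h14 := ae_onS2 (fun z _ a b => conj a b) h12 h34.
apply: ae_onS2 h14 h56 => z _ [[a1 a2] [a3 a4]] [a5 a6].
exact: (And3 a1 a2 (And4 a3 (etrans a4 (esym a6)) a4 a5)).
Qed.

(** The separate [w] allows functions that have this form only up to a proved equality, such as a
    difference u - v. *)
Lemma lin_derivs k u v w : H2 Om u -> H2 Om v -> w = (fun z => k * u z + v z) ->
  ae_on Om (fun z =>
  [/\ dx Om w z = k * dx Om u z + dx Om v z,
      dy Om w z = k * dy Om u z + dy Om v z &
  [/\ dxx Om w z = k * dxx Om u z + dxx Om v z,
      dxy Om w z = k * dxy Om u z + dxy Om v z &
      dyy Om w z = k * dyy Om u z + dyy Om v z]]).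
Proof.
move=> hu hv ->.
have h1 := @wderiv_lin 1 0 k u v hu hv isT.
have h2 := @wderiv_lin 0 1 k u v hu hv isT.
have h3 := @wderiv_lin 2 0 k u v hu hv isT.
have h4 := @wderiv_lin 1 1 k u v hu hv isT.
have h5 := @wderiv_lin 0 2 k u v hu hv isT.
have h12 := ae_onS2 (fun z _ a b => conj a b) h1 h2.
have h34 := ae_onS2 (fun z _ a b => conj a b) h3 h4.
have h14 := ae_onS2 (fun z _ a b => conj a b) h12 h34.
apply: ae_onS2 h14 h5 => z _ [[a1 a2] [a3 a4]] a5; exact: (And3 a1 a2 (And3 a3 a4 a5)).
Qed.

Lemma L2_dx u : H2 Om u -> L2 (dx Om u).
Proof. by move=> hu; exact: is_wderiv_L2 (wderivP hu (isT : (1 + 0 <= 2)%N)). Qed.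
Lemma L2_dy u : H2 Om u -> L2 (dy Om u).
Proof. by move=> hu; exact: is_wderiv_L2 (wderivP hu (isT : (0 + 1 <= 2)%N)). Qed.
Lemma L2_dxx u : H2 Om u -> L2 (dxx Om u).
Proof. by move=> hu; exact: is_wderiv_L2 (wderivP hu (isT : (2 + 0 <= 2)%N)). Qed.
Lemma L2_dxy u : H2 Om u -> L2 (dxy Om u).
Proof. by move=> hu; exact: is_wderiv_L2 (wderivP hu (isT : (1 + 1 <= 2)%N)). Qed.
Lemma L2_dyy u : H2 Om u -> L2 (dyy Om u).
Proof. by move=> hu; exact: is_wderiv_L2 (wderivP hu (isT : (0 + 2 <= 2)%N)). Qed.
Lemma L2_lap u : H2 Om u -> L2 (lap Om u).
Proof. by move=> hu; exact: (L2D oOm (L2_dxx hu) (L2_dyy hu)). Qed.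

End sobolev.

Global Opaque wderiv.

(** * Density of test functions *)

Lemma sqrt_le_of_sum (R : realType) (a b : R) : 0 <= a -> a <= b ^+ 2 -> 0 <= b ->
  Num.sqrt a <= b.
Proof. by move=> a0 ab b0; rewrite -(ger0_norm b0) -sqrtr_sqr; exact: ler_wsqrtr. Qed.

Lemma sum6_ge (R : realType) (a b c d e f : R) : 0 <= a -> 0 <= b -> 0 <= c ->
  0 <= d -> 0 <= e -> 0 <= f ->
  [/\ a <= a + b + c + d + 2 * e + f, b <= a + b + c + d + 2 * e + f,
    c <= a + b + c + d + 2 * e + f &
   [/\ d <= a + b + c + d + 2 * e + f, e <= a + b + c + d + 2 * e + f,
    f <= a + b + c + d + 2 * e + f & 0 <= a + b + c + d + 2 * e + f]].
Proof. by move=> *; split; [lra|lra|lra|split; lra]. Qed.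

Lemma sum6_le (R : realType) (k a b c d e f a' b' c' d' e' f' A B C D E F N M L : R) :
  N = A + B + C + D + 2 * E + F -> M = a + b + c + d + 2 * e + f ->
  L = a' + b' + c' + d' + 2 * e' + f' ->
  A <= 2 * k ^+ 2 * a + 2 * a' -> B <= 2 * k ^+ 2 * b + 2 * b' ->
  C <= 2 * k ^+ 2 * c + 2 * c' -> D <= 2 * k ^+ 2 * d + 2 * d' ->
  E <= 2 * k ^+ 2 * e + 2 * e' -> F <= 2 * k ^+ 2 * f + 2 * f' ->
  N <= 2 * k ^+ 2 * M + 2 * L.
Proof. by move=> -> -> ->; move: (k ^+ 2) => K *; lra. Qed.

Lemma sum6_eq0 (R : realType) (n A B C D E F : R) :
  n ^+ 2 = A + B + C + D + 2 * E + F ->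
  A = 0 -> B = 0 -> C = 0 -> D = 0 -> E = 0 -> F = 0 -> n = 0.
Proof.
move=> h a b c d e f; apply/eqP; rewrite -sqrf_eq0 h a b c d e f.
by rewrite mulr0 !addr0.
Qed.

Lemma small_comb (R : realType) (k e a b x : R) : 0 < e ->
  0 <= a -> 0 <= b -> 0 <= x ->
  a < e / (2 * (`|k| + 1)) -> b < e / 4 ->
  x ^+ 2 <= 2 * k ^+ 2 * a ^+ 2 + 2 * b ^+ 2 -> x < e.
Proof.
move=> e0 a0 b0 x0 ha hb hx.
have k0 := normr_ge0 k.
have h1 : `|k| * a < e / 2.
  have d0 : 0 < 2 * (`|k| + 1) by lra.
  rewrite ltr_pdivlMr // in ha.
  nra.
have ka0 : 0 <= `|k| * a by rewrite mulr_ge0.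
rewrite -(ltr_pXn2r (n := 2)) ?nnegrE // ?(ltW e0) //.
apply: le_lt_trans hx _.
have -> : 2 * k ^+ 2 * a ^+ 2 = 2 * (`|k| * a) ^+ 2.
  by rewrite -(real_normK (num_real k)); ring.
by move: h1 ka0 hb; move: (`|k| * a) => y *; nra.
Qed.

Lemma sq_lin_le (R : realType) (k a b : R) :
  (k * a + b) ^+ 2 <= 2 * k ^+ 2 * a ^+ 2 + 2 * b ^+ 2.
Proof.
have -> : 2 * k ^+ 2 * a ^+ 2 + 2 * b ^+ 2 = (k * a + b) ^+ 2 + (k * a - b) ^+ 2 by ring.
by rewrite lerDl sqr_ge0.
Qed.

Lemma lin_sub_eq (R : realType) (k a b c d : R) :
  k * (a - b) + (c - d) = k * a + c - (k * b + d).
Proof. by ring. Qed.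

Lemma sq3_ge0 (R : realType) (a b c : R) : 0 <= a ^+ 2 + 2 * b ^+ 2 + c ^+ 2.
Proof. by have := sqr_ge0 a; have := sqr_ge0 b; have := sqr_ge0 c; lra. Qed.

Section density.
Variable R : realType.
Implicit Types (f g h p q u v w : plane R -> R) (k : R).
Variables (Om : set (plane R)) (oOm : open Om).

Notation L1 := (Lone Om).
Notation L2 := (L2 Om).
Notation I := (integ Om).
Notation test := (test_fun Om).
Notation H20 := (H20 Om).
Notation H2 := (H2 Om).
Notation n2 := (l2norm Om).
Notation n4 := (l4norm Om).
Notation normH2 := (normH2 Om).

Lemma Isq_ge0 f : 0 <= I (fun z => f z ^+ 2).
Proof. by apply: integ_ge0 => z _; exact: sqr_ge0. Qed.

Lemma semi1_sq u : H2 u -> semi1 Om u ^+ 2 =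
  I (fun z => dx Om u z ^+ 2) + I (fun z => dy Om u z ^+ 2).
Proof.
move=> hu; rewrite /semi1 sqr_sqrtr; last first.
  by apply: integ_ge0 => z _; rewrite addr_ge0 ?sqr_ge0.
exact: (integD oOm (L2sq (L2_dx hu)) (L2sq (L2_dy hu))).
Qed.

Lemma semi2_sq u : H2 u -> semi2 Om u ^+ 2 =
  I (fun z => dxx Om u z ^+ 2) + 2 * I (fun z => dxy Om u z ^+ 2) +
  I (fun z => dyy Om u z ^+ 2).
Proof.
move=> hu; rewrite /semi2 sqr_sqrtr; last first.
  by apply: integ_ge0 => z _; exact: sq3_ge0.
have hxx := L2sq (L2_dxx hu); have hxy := L2sq (L2_dxy hu); have hyy := L2sq (L2_dyy hu).
rewrite (integD oOm (L1D oOm hxx (L1Z oOm 2 hxy)) hyy).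
by rewrite (integD oOm hxx (L1Z oOm 2 hxy)) (integZ oOm 2 hxy).
Qed.

Lemma normH2_sq u : H2 u -> normH2 u ^+ 2 =
  I (fun z => u z ^+ 2) + I (fun z => dx Om u z ^+ 2) + I (fun z => dy Om u z ^+ 2)
  + I (fun z => dxx Om u z ^+ 2) + 2 * I (fun z => dxy Om u z ^+ 2) +
  I (fun z => dyy Om u z ^+ 2).
Proof.
move=> hu; rewrite /Defs.normH2 sqr_sqrtr; last first.
  by rewrite !addr_ge0 ?sqr_ge0 ?Isq_ge0.
by rewrite (semi1_sq hu) (semi2_sq hu) !addrA.
Qed.

Lemma normH2_ge0 u : 0 <= normH2 u. Proof. exact: sqrtr_ge0. Qed.

Lemma n2_le_normH2 u : H2 u ->
  [/\ n2 u <= normH2 u, n2 (dx Om u) <= normH2 u, n2 (dy Om u) <= normH2 u &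
   [/\ n2 (dxx Om u) <= normH2 u, n2 (dxy Om u) <= normH2 u & n2 (dyy Om u) <= normH2 u]].
Proof.
move=> hu; have e := normH2_sq hu; have h0 := normH2_ge0 u.
have [h1 h2 h3 [h4 h5 h6 _]] := sum6_ge (Isq_ge0 u) (Isq_ge0 (dx Om u)) (Isq_ge0 (dy Om u))
  (Isq_ge0 (dxx Om u)) (Isq_ge0 (dxy Om u)) (Isq_ge0 (dyy Om u)).
rewrite -e in h1 h2 h3 h4 h5 h6.
split; [|exact: (sqrt_le_of_sum (Isq_ge0 _) h2 h0)|exact: (sqrt_le_of_sum (Isq_ge0 _) h3 h0)|].
  exact: (sqrt_le_of_sum (Isq_ge0 _) h1 h0).
split; [exact: (sqrt_le_of_sum (Isq_ge0 _) h4 h0)|exact: (sqrt_le_of_sum (Isq_ge0 _) h5 h0)|].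
exact: (sqrt_le_of_sum (Isq_ge0 _) h6 h0).
Qed.

Lemma Isq_lin_le k a b : L2 a -> L2 b ->
  I (fun z => (k * a z + b z) ^+ 2) <=
  2 * k ^+ 2 * I (fun z => a z ^+ 2) + 2 * I (fun z => b z ^+ 2).
Proof.
move=> la lb.
rewrite -(integZ oOm _ (L2sq la)) -(integZ oOm _ (L2sq lb)).
have i1 := L1Z oOm (2 * k ^+ 2) (L2sq la); have i2 := L1Z oOm 2 (L2sq lb).
rewrite -(integD oOm i1 i2).
apply: (integ_le oOm (L2sq (L2_lin oOm k la lb)) (L1D oOm i1 i2)) => z _.
exact: sq_lin_le.
Qed.

Lemma Isq_lin_ae k a b c : L2 a -> L2 b -> L2 c ->
  ae_on Om (fun z => c z = k * a z + b z) ->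
  I (fun z => c z ^+ 2) <=
  2 * k ^+ 2 * I (fun z => a z ^+ 2) + 2 * I (fun z => b z ^+ 2).
Proof.
move=> la lb lc h; apply: le_trans (Isq_lin_le k la lb).
rewrite (integ_ae oOm (L2sq lc) (L2sq (L2_lin oOm k la lb))) //.
by apply: ae_onS h => z _ ->.
Qed.

(** A substitute for the triangle inequality, from (k a + b)^2 <= 2 k^2 a^2 + 2 b^2; the lost factor
    is harmless in density arguments. *)
Lemma normH2_lin k u v : H2 u -> H2 v ->
  normH2 (fun z => k * u z + v z) ^+ 2 <= 2 * k ^+ 2 * normH2 u ^+ 2 + 2 * normH2 v ^+ 2.
Proof.
move=> hu hv; have hw := H2_lin oOm k hu hv.
have h := lin_derivs oOm hu hv (erefl (fun z => k * u z + v z)).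
apply: (sum6_le (normH2_sq hw) (normH2_sq hu) (normH2_sq hv)).
- exact: (Isq_lin_le k (H2_L2 hu) (H2_L2 hv)).
- by apply: (Isq_lin_ae (L2_dx hu) (L2_dx hv) (L2_dx hw)); apply: ae_onS h => z _ [].
- by apply: (Isq_lin_ae (L2_dy hu) (L2_dy hv) (L2_dy hw)); apply: ae_onS h => z _ [].
- by apply: (Isq_lin_ae (L2_dxx hu) (L2_dxx hv) (L2_dxx hw)); apply: ae_onS h => z _ [_ _ []].
- by apply: (Isq_lin_ae (L2_dxy hu) (L2_dxy hv) (L2_dxy hw)); apply: ae_onS h => z _ [_ _ []].
- by apply: (Isq_lin_ae (L2_dyy hu) (L2_dyy hv) (L2_dyy hw)); apply: ae_onS h => z _ [_ _ []].
Qed.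

Lemma integ0 : I (fun=> 0) = 0.
Proof.
have l0 := L2_test oOm (test0 Om).
have e := etrans (integZ oOm 0 (L2M oOm l0 l0)) (mul0r _).
by apply: (etrans _ e); apply: integ_eq => z _; rewrite mul0r.
Qed.

(** Not a computation: the weak derivatives of 0 are chosen representatives, known to vanish only
    almost everywhere. *)
Lemma normH2_test0 : normH2 (fun=> 0) = 0.
Proof.
have t0 := test0 Om; have h0 := test_H2 oOm t0.
have E : Dx (fun _ : plane R => 0) = fun=> 0 by rewrite -DxE D_cst.
have F : Dy (fun _ : plane R => 0) = fun=> 0 by rewrite -DyE D_cst.
have := test_derivs oOm t0; rewrite !(E, F) => h.
have z0 c : L2 c -> ae_on Om (fun z => c z = 0) -> I (fun z => c z ^+ 2) = 0.
  move=> lc hc; rewrite -integ0; apply: (integ_ae oOm (L2sq lc)).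
    by apply: L1_ext (L2sq (L2_test oOm t0)) => // z _; rewrite expr0n.
  by apply: ae_onS hc => z _ ->; rewrite expr0n.
apply: (sum6_eq0 (normH2_sq h0)).
- by apply: z0 => //; [exact: H2_L2|exact: ae_onT].
- by apply: z0; [exact: L2_dx|apply: ae_onS h => z _ []].
- by apply: z0; [exact: L2_dy|apply: ae_onS h => z _ []].
- by apply: z0; [exact: L2_dxx|apply: ae_onS h => z _ [_ _ []]].
- by apply: z0; [exact: L2_dxy|apply: ae_onS h => z _ [_ _ []]].
- by apply: z0; [exact: L2_dyy|apply: ae_onS h => z _ [_ _ []]].
Qed.

Lemma H20_H2 u : H20 u -> H2 u. Proof. by case. Qed.

Lemma test_H20 p : test p -> H20 p.
Proof.
move=> hp; split; first exact: test_H2.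
move=> e e0; exists p => //.
by rewrite (_ : p - p = fun=> 0) ?normH2_test0 //; apply/funext => z; rewrite /= subrr.
Qed.

Lemma H20_lin k u v : H20 u -> H20 v -> H20 (fun z => k * u z + v z).
Proof.
move=> [hu au] [hv av]; split; first exact: H2_lin.
move=> e e0.
have k0 := normr_ge0 k.
(* With tolerances e / (2 (|k| + 1)) and e / 4, [normH2_lin] bounds the squared error by e^2 (1/2 +
   1/8); the + 1 covers k = 0. *)
have [p hp up] := au (e / (2 * (`|k| + 1))) ltac:(by rewrite divr_gt0 // mulr_gt0 // ltr_wpDl).
have [q hq vq] := av (e / 4) ltac:(by rewrite divr_gt0).
exists (fun z => k * p z + q z); first exact: test_lin.
have Hs (a b : plane R -> R) : H2 a -> H2 b -> H2 (a - b).
  move=> ha hb; rewrite (_ : a - b = fun z => -1 * b z + a z); first exact: H2_lin.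
  by apply/funext => z; rewrite mulN1r addrC.
have hup := Hs _ _ hu (test_H2 oOm hp); have hvq := Hs _ _ hv (test_H2 oOm hq).
have := normH2_lin k hup hvq.
rewrite (_ : (fun z => k * (u - p) z + (v - q) z) =
  (fun z => k * u z + v z) - (fun z => k * p z + q z)); last first.
  by apply/funext => z; exact: lin_sub_eq.
exact: (small_comb e0 (normH2_ge0 _) (normH2_ge0 _) (normH2_ge0 _) up vq).
Qed.

Lemma H20B u v : H20 u -> H20 v -> H20 (u - v).
Proof.
move=> hu hv; rewrite (_ : u - v = fun z => -1 * v z + u z); first exact: H20_lin.
by apply/funext => z; rewrite mulN1r addrC.
Qed.

End density.

(** * Gradients of functions in H^2_0 are in L^4 *)

Lemma sqr_bound_2m (R : realType) (m x y w : R) : 0 < m -> 0 <= x -> 0 <= y -> 0 <= w ->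
  x <= m -> y <= m ->
  w ^+ 2 <= 2 * (-1) ^+ 2 * x ^+ 2 + 2 * y ^+ 2 -> w <= 2 * m.
Proof.
move=> m0 x0 y0 w0 xm ym; rewrite sqrrN expr1n mulr1 => h.
rewrite -(ler_pXn2r (n := 2)) ?nnegrE //; last by rewrite mulr_ge0 // ltW.
by apply: le_trans h _; nra.
Qed.

(** The inequality for test functions yields 64 m^4, rounded up to 81 m^4 so that the L^4 norm is
    bounded by 3 m. *)
Lemma L4_arith (R : realType) (m A B C J : R) : 0 < m -> 0 <= A -> 0 <= B -> 0 <= C ->
  A <= (2 * m) ^+ 2 -> B <= 2 * m -> C <= 2 * m ->
  J <= 4 * A * (B * C) -> J <= ((3 * m) ^+ 2) ^+ 2.
Proof.
move=> m0 A0 B0 C0 hA hB hC /le_trans; apply.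
have h1 : B * C <= 2 * m * (2 * m) by apply: ler_pM.
have h2 : 4 * A <= 4 * (2 * m) ^+ 2 by rewrite ler_pM2l.
have h3 : 4 * A * (B * C) <= 4 * (2 * m) ^+ 2 * (2 * m * (2 * m)).
  by apply: ler_pM => //; rewrite ?mulr_ge0.
apply: le_trans h3 _.
have -> : 4 * (2 * m) ^+ 2 * (2 * m * (2 * m)) = 64 * (m ^+ 2) ^+ 2 by ring.
have -> : ((3 * m) ^+ 2) ^+ 2 = 81 * (m ^+ 2) ^+ 2 by ring.
by apply: ler_wpM2r => //; rewrite ?sqr_ge0 // ler_nat.
Qed.

Section forms.
Variable R : realType.
Implicit Types (f g h p q u v w : plane R -> R) (k m : R).
Variables (Om : set (plane R)) (oOm : open Om).

Notation L1 := (Lone Om).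
Notation L2 := (L2 Om).
Notation I := (integ Om).
Notation test := (test_fun Om).
Notation H20 := (H20 Om).
Notation H2 := (H2 Om).
Notation n2 := (l2norm Om).
Notation n4 := (l4norm Om).
Notation L4 := (Lfour Om).
Notation normH2 := (normH2 Om).

Lemma Isq_ae a b : L2 a -> L2 b -> ae_on Om (fun z => a z = b z) ->
  I (fun z => a z ^+ 2) = I (fun z => b z ^+ 2).
Proof.
move=> la lb h; apply: (integ_ae oOm (L2sq la) (L2sq lb)).
by apply: ae_onS h => z _ ->.
Qed.

Lemma Isq_n2 a : I (fun z => a z ^+ 2) = n2 a ^+ 2.
Proof. by rewrite /l2norm sqr_sqrtr //; exact: Isq_ge0. Qed.

Lemma sub_linE u v : u - v = (fun z => -1 * v z + u z).
Proof. by apply/funext => z; rewrite mulN1r addrC. Qed.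

(** Approximation within min(m, sqrt e) serves both claims: sqrt e controls the error, and m gives
    the norm bound through p = -(u - p) + u and [normH2_lin]. *)
Lemma approx u e m : H20 u -> 0 < e -> 0 < m -> normH2 u <= m ->
  exists p, [/\ test p, normH2 (u - p) ^+ 2 <= e & normH2 p <= 2 * m].
Proof.
move=> [hu au] e0 m0 um.
have s0 : 0 < Num.sqrt e by rewrite sqrtr_gt0.
have [p hp up] := au (Num.min m (Num.sqrt e)) ltac:(by rewrite lt_min m0).
move: up; rewrite lt_min => /andP[/ltW u1 /ltW u2].
exists p; split => //.
  rewrite -(sqr_sqrtr (ltW e0)).
  by rewrite ler_pXn2r ?nnegrE ?sqrtr_ge0 //; exact: normH2_ge0.
have h2p := test_H2 oOm hp.
have hup : H2 (u - p) by rewrite sub_linE; exact: H2_lin.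
have := normH2_lin oOm (-1) hup hu.
rewrite (_ : (fun z => -1 * (u - p) z + u z) = p); last first.
  by apply/funext => z; rewrite -[(u - p) z]/(u z - p z) mulN1r opprB subrK.
exact: (sqr_bound_2m m0 (normH2_ge0 _ _) (normH2_ge0 _ _) (normH2_ge0 _ _) u1 um).
Qed.

(** [D] stands for a weak first derivative of [u] and [Dt] for its classical counterpart. The bounds
    on [Dt p] and its gradient make the L^4 bound uniform over the approximating test functions, so
    [L2_sqr_limit] carries it to [D]. *)
Lemma L4_from_approx u m (D : plane R -> R) (Dt : (plane R -> R) -> plane R -> R) :
  H20 u -> 0 < m -> normH2 u <= m -> L2 D ->
  (forall p, test p -> [/\ test (Dt p), I (fun z => (D z - Dt p z) ^+ 2) <= normH2 (u - p) ^+ 2,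
     n2 (Dt p) <= normH2 p, n2 (Dx (Dt p)) <= normH2 p & n2 (Dy (Dt p)) <= normH2 p]) ->
  L4 D /\ n4 D <= 3 * m.
Proof.
move=> hu m0 um lD hD.
have K0 : 0 <= 3 * m by rewrite mulr_ge0 // ltW.
have : L2 (fun z => D z ^+ 2) /\ I (fun z => (D z ^+ 2) ^+ 2) <= ((3 * m) ^+ 2) ^+ 2.
  apply: (L2_sqr_limit oOm lD) => e e0.
  have [p [hp up pm]] := approx hu e0 m0 um.
  have [t1 t2 t3 t4 t5] := hD p hp.
  exists (Dt p); split.
  - exact: L2_test.
  - by apply: L2_test => //; exact: (test_mul (test_smooth t1) t1).
  - exact: (le_trans t2 up).
  - apply: (L4_arith m0 _ _ _ _ _ _ (integ_test_L4 oOm t1)).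
    + exact: Isq_ge0.
    + exact: sqrtr_ge0.
    + exact: sqrtr_ge0.
    + rewrite Isq_n2 ler_pXn2r ?nnegrE ?sqrtr_ge0 ?mulr_ge0 ?(ltW m0) //.
      exact: (le_trans t3 pm).
    + exact: (le_trans t4 pm).
    + exact: (le_trans t5 pm).
move=> [l4 l4le]; split; first by split.
apply: (sqrt_le_of_sum (sqrtr_ge0 _) _ K0).
apply: (sqrt_le_of_sum _ l4le (sqr_ge0 _)).
by apply: integ_ge0 => z _; exact: sqr_ge0.
Qed.

Lemma L4_grad u m : H20 u -> 0 < m -> normH2 u <= m ->
  [/\ L4 (dx Om u), L4 (dy Om u), n4 (dx Om u) <= 3 * m & n4 (dy Om u) <= 3 * m].
Proof.
move=> hu m0 um; have h2u := H20_H2 hu.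
have n2ae (a b : plane R -> R) : L2 a -> L2 b -> ae_on Om (fun z => a z = b z) -> n2 a = n2 b.
  by move=> la lb h; rewrite /l2norm; congr Num.sqrt; exact: (Isq_ae la lb h).
have [l4x n4x] : L4 (dx Om u) /\ n4 (dx Om u) <= 3 * m.
  apply: (@L4_from_approx u m (dx Om u) (@Dx R) hu m0 um (L2_dx h2u)) => p hp.
  have hp2 := test_H2 oOm hp; have tp := test_derivs oOm hp.
  have tx := test_Dx hp; have lx := L2_test oOm tx.
  have lxx := L2_test oOm (test_Dx tx); have lxy := L2_test oOm (test_Dy tx).
  have [_ b1 b2 [b3 b4 b5]] := n2_le_normH2 oOm hp2.
  have hup : H2 (u - p) by rewrite sub_linE; exact: H2_lin.
  split => //.
  - have [_ c1 _ _] := n2_le_normH2 oOm hup.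
    have hl := lin_derivs oOm hp2 h2u (sub_linE u p).
    have e : I (fun z => (dx Om u z - Dx p z) ^+ 2) = n2 (dx Om (u - p)) ^+ 2.
      rewrite -Isq_n2; apply: (Isq_ae (L2B oOm (L2_dx h2u) lx) (L2_dx hup)).
      apply: ae_onS2 tp hl => z _ [a1 _ _] [a2 _ _].
      by rewrite a2 a1 mulN1r addrC.
    rewrite e ler_pXn2r ?nnegrE ?sqrtr_ge0 //.
  - rewrite -(n2ae _ _ (L2_dx hp2) lx) //.
    by apply: ae_onS tp => z _ [].
  - rewrite -(n2ae _ _ (L2_dxx hp2) lxx) //.
    by apply: ae_onS tp => z _ [_ _ []].
  - rewrite -(n2ae _ _ (L2_dxy hp2) lxy) //.
    by apply: ae_onS tp => z _ [_ _ []].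
have [l4y n4y] : L4 (dy Om u) /\ n4 (dy Om u) <= 3 * m.
  apply: (@L4_from_approx u m (dy Om u) (@Dy R) hu m0 um (L2_dy h2u)) => p hp.
  have hp2 := test_H2 oOm hp; have tp := test_derivs oOm hp.
  have ty := test_Dy hp; have ly := L2_test oOm ty.
  have lxy := L2_test oOm (test_Dx ty); have lyy := L2_test oOm (test_Dy ty).
  have [_ b1 b2 [b3 b4 b5]] := n2_le_normH2 oOm hp2.
  have hup : H2 (u - p) by rewrite sub_linE; exact: H2_lin.
  split => //.
  - have [_ _ c1 _] := n2_le_normH2 oOm hup.
    have hl := lin_derivs oOm hp2 h2u (sub_linE u p).
    have e : I (fun z => (dy Om u z - Dy p z) ^+ 2) = n2 (dy Om (u - p)) ^+ 2.
      rewrite -Isq_n2; apply: (Isq_ae (L2B oOm (L2_dy h2u) ly) (L2_dy hup)).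
      apply: ae_onS2 tp hl => z _ [_ a1 _] [_ a2 _].
      by rewrite a2 a1 mulN1r addrC.
    rewrite e ler_pXn2r ?nnegrE ?sqrtr_ge0 //.
  - rewrite -(n2ae _ _ (L2_dy hp2) ly) //.
    by apply: ae_onS tp => z _ [].
  - rewrite -(n2ae _ _ (L2_dxy hp2) lxy) //.
    by apply: ae_onS tp => z _ [_ _ []].
  - rewrite -(n2ae _ _ (L2_dyy hp2) lyy) //.
    by apply: ae_onS tp => z _ [_ _ []].
by [].
Qed.

End forms.

(** * The forms on H20 *)

Lemma normB_le2 (R : realType) (x y c : R) : `|x| <= c -> `|y| <= c -> `|x - y| <= 2 * c.
Proof. by move=> hx hy; apply: le_trans (ler_normB _ _) _; lra. Qed.

Lemma norm4_le (R : realType) (x y z t c : R) : `|x| <= c -> `|y| <= c ->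
  `|z| <= c -> `|t| <= c -> `|x - y - (z - t)| <= 4 * c.
Proof.
move=> hx hy hz ht; have h1 := normB_le2 hx hy; have h2 := normB_le2 hz ht.
by apply: le_trans (ler_normB _ _) _; lra.
Qed.

Lemma prod3_le (R : realType) (n a b N A B : R) : 0 <= n -> 0 <= a -> 0 <= b ->
  n <= N -> a <= A -> b <= B -> n * (a * b) <= N * (A * B).
Proof. by move=> *; apply: ler_pM => //; rewrite ?mulr_ge0 //; exact: ler_pM. Qed.

Lemma lin_b1 (R : realType) (k l l' a b c d : R) :
  (k * l + l') * (a * b - c * d) = k * (l * (a * b - c * d)) + l' * (a * b - c * d).
Proof. by ring. Qed.
Lemma lin_b2 (R : realType) (k l a a' b c c' d : R) :
  l * ((k * a + a') * b - (k * c + c') * d) =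
  k * (l * (a * b - c * d)) + l * (a' * b - c' * d).
Proof. by ring. Qed.
Lemma lin_b3 (R : realType) (k l a b b' c d d' : R) :
  l * (a * (k * b + b') - c * (k * d + d')) =
  k * (l * (a * b - c * d)) + l * (a * b' - c * d').
Proof. by ring. Qed.
Lemma lin_b01 (R : realType) (k x x' y y' cxx cxy cyy px py : R) :
  ((k * y + y') * cxy - (k * x + x') * cyy) * py -
  ((k * x + x') * cxy - (k * y + y') * cxx) * px =
  k * ((y * cxy - x * cyy) * py - (x * cxy - y * cxx) * px) +
  ((y' * cxy - x' * cyy) * py - (x' * cxy - y' * cxx) * px).
Proof. by ring. Qed.
Lemma lin_b02 (R : realType) (k x y cxx cxy cyy cxx' cxy' cyy' px py : R) :
  (y * (k * cxy + cxy') - x * (k * cyy + cyy')) * py -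
  (x * (k * cxy + cxy') - y * (k * cxx + cxx')) * px =
  k * ((y * cxy - x * cyy) * py - (x * cxy - y * cxx) * px) +
  ((y * cxy' - x * cyy') * py - (x * cxy' - y * cxx') * px).
Proof. by ring. Qed.
Lemma b0_split (R : realType) (x y cxx cxy cyy px py : R) :
  cxy * (y * py) - cyy * (x * py) - (cxy * (x * px) - cxx * (y * px)) =
  (y * cxy - x * cyy) * py - (x * cxy - y * cxx) * px.
Proof. by ring. Qed.
Lemma b_split (R : realType) (l a b c d : R) :
  l * (a * b) - l * (c * d) = l * (a * b - c * d).
Proof. by ring. Qed.

Lemma two_sq_le (R : realType) (x y m L S A B : R) : L = S ->
  S <= 2 * 1 ^+ 2 * A + 2 * B -> A = x ^+ 2 -> B = y ^+ 2 ->
  0 <= x -> 0 <= y -> x <= m -> y <= m -> L <= (2 * m) ^+ 2.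
Proof. by move=> -> h ? ? *; subst; apply: le_trans h _; nra. Qed.

Section forms.
Variable R : realType.
Implicit Types (f g h p q u v w : plane R -> R) (k m : R).
Variables (Om : set (plane R)) (oOm : open Om).

Notation L1 := (Lone Om).
Notation L2 := (L2 Om).
Notation I := (integ Om).
Notation test := (test_fun Om).
Notation H20 := (H20 Om).
Notation H2 := (H2 Om).
Notation n2 := (l2norm Om).
Notation n4 := (l4norm Om).
Notation L4 := (Lfour Om).
Notation normH2 := (normH2 Om).

Lemma integ_lin_ae k f g h : L1 f -> L1 g -> L1 h ->
  ae_on Om (fun z => h z = k * f z + g z) -> I h = k * I f + I g.
Proof.
move=> hf hg hh hae.
rewrite (integ_ae oOm hh (L1D oOm (L1Z oOm k hf) hg) hae).
by rewrite (integD oOm (L1Z oOm k hf) hg) (integZ oOm k hf).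
Qed.

(** If G u were nonzero, a test function within |G u| / (K + 1) of [u] would give |G u| <= K |G u| /
    (K + 1) < |G u|. Additivity is stated with a coefficient 1 to match the linearity lemmas. *)
Lemma H20_density (G : (plane R -> R) -> R) (K : R) : 0 <= K ->
  (forall u v, H20 u -> H20 v -> G (fun z => 1 * u z + v z) = 1 * G u + G v) ->
  (forall u m, H20 u -> 0 < m -> normH2 u <= m -> `|G u| <= K * m) ->
  (forall p, test p -> G p = 0) ->
  forall u, H20 u -> G u = 0.
Proof.
move=> K0 Gadd Gbd Gtest u hu; apply/eqP; apply: contrapT => /negP Gu.
have g0 : 0 < `|G u| by rewrite normr_gt0.
have K1 : 0 < K + 1 by rewrite ltr_wpDl.
have m0 : 0 < `|G u| / (K + 1) by rewrite divr_gt0.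
have [_ /(_ _ m0)[p hp up]] := hu.
have hp20 := test_H20 oOm hp; have hup := H20B oOm hu hp20.
have := Gadd _ _ hup hp20.
rewrite (_ : (fun z => 1 * (u - p) z + p z) = u); last first.
  by apply/funext => z; rewrite mul1r -[(u - p) z]/(u z - p z) subrK.
rewrite (Gtest _ hp) addr0 mul1r => Gup.
have := Gbd _ _ hup m0 (ltW up); rewrite -Gup => h.
have : `|G u| < `|G u|.
  apply: le_lt_trans h _; rewrite mulrA ltr_pdivrMr // mulrC ltr_pM2l //.
  by rewrite ltrDl.
by rewrite ltxx.
Qed.

Lemma n2_lap u m : H2 u -> normH2 u <= m -> n2 (lap Om u) <= 2 * m.
Proof.
move=> hu um; have m0 : 0 <= m := le_trans (normH2_ge0 Om u) um.
have [_ _ _ [b1 b2 b3]] := n2_le_normH2 oOm hu.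
have h := Isq_lin_le oOm 1 (L2_dxx hu) (L2_dyy hu).
have e : I (fun z => (1 * dxx Om u z + dyy Om u z) ^+ 2) = I (fun z => lap Om u z ^+ 2).
  by apply: integ_eq => z _; rewrite mul1r.
apply: (sqrt_le_of_sum (Isq_ge0 Om _) _ _); last by rewrite mulr_ge0.
exact: (two_sq_le (esym e) h (Isq_n2 Om _) (Isq_n2 Om _) (sqrtr_ge0 _) (sqrtr_ge0 _)
  (le_trans b1 um) (le_trans b3 um)).
Qed.

(* All the triple products below have one factor in L^2 and two gradient factors in L^4. *)
Lemma form_b_L1 z0 u v m a b : H20 z0 -> H20 u -> H20 v ->
  0 < m -> 0 < a -> 0 < b -> normH2 z0 <= m -> normH2 u <= a -> normH2 v <= b ->
  L1 (fun z => lap Om z0 z * (dy Om u z * dx Om v z - dx Om u z * dy Om v z)) /\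
  `|form_b Om z0 u v| <= 2 * (2 * m * (3 * a * (3 * b))).
Proof.
move=> hz hu hv m0 a0 b0 zm ua vb.
have [ux uy nux nuy] := L4_grad oOm hu a0 ua.
have [vx vy nvx nvy] := L4_grad oOm hv b0 vb.
have lz := L2_lap oOm (H20_H2 hz); have nz := n2_lap (H20_H2 hz) zm.
have [i1 b1] := tri_bound oOm lz uy vx.
have [i2 b2] := tri_bound oOm lz ux vy.
have e z : Om z -> lap Om z0 z * (dy Om u z * dx Om v z) - lap Om z0 z * (dx Om u z * dy Om v z)
  = lap Om z0 z * (dy Om u z * dx Om v z - dx Om u z * dy Om v z).
  by move=> _; exact: b_split.
split; first exact: (L1_ext oOm e (L1B oOm i1 i2)).
have E : form_b Om z0 u v = I (fun z => lap Om z0 z * (dy Om u z * dx Om v z)) -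
    I (fun z => lap Om z0 z * (dx Om u z * dy Om v z)).
  exact: (etrans (esym (integ_eq e)) (integB oOm i1 i2)).
rewrite E; apply: normB_le2.
  exact: (le_trans b1 (prod3_le (sqrtr_ge0 _) (sqrtr_ge0 _) (sqrtr_ge0 _) nz nuy nvx)).
exact: (le_trans b2 (prod3_le (sqrtr_ge0 _) (sqrtr_ge0 _) (sqrtr_ge0 _) nz nux nvy)).
Qed.

Lemma form_b0_L1 x0 u v m a b : H20 x0 -> H20 u -> H20 v ->
  0 < m -> 0 < a -> 0 < b -> normH2 x0 <= m -> normH2 u <= a -> normH2 v <= b ->
  L1 (fun z =>
    (dy Om x0 z * dxy Om u z - dx Om x0 z * dyy Om u z) * dy Om v z
    - (dx Om x0 z * dxy Om u z - dy Om x0 z * dxx Om u z) * dx Om v z) /\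
  `|form_b0 Om x0 u v| <= 4 * (a * (3 * m * (3 * b))).
Proof.
move=> hz hu hv m0 a0 b0 zm ua vb.
have [xx xy nxx nxy] := L4_grad oOm hz m0 zm.
have [vx vy nvx nvy] := L4_grad oOm hv b0 vb.
have h2u := H20_H2 hu.
have [_ _ _ [c1 c2 c3]] := n2_le_normH2 oOm h2u.
have [i1 b1] := tri_bound oOm (L2_dxy h2u) xy vy.
have [i2 b2] := tri_bound oOm (L2_dyy h2u) xx vy.
have [i3 b3] := tri_bound oOm (L2_dxy h2u) xx vx.
have [i4 b4] := tri_bound oOm (L2_dxx h2u) xy vx.
have e z : Om z ->
    dxy Om u z * (dy Om x0 z * dy Om v z) - dyy Om u z * (dx Om x0 z * dy Om v z) -
    (dxy Om u z * (dx Om x0 z * dx Om v z) - dxx Om u z * (dy Om x0 z * dx Om v z)) =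
    (dy Om x0 z * dxy Om u z - dx Om x0 z * dyy Om u z) * dy Om v z
    - (dx Om x0 z * dxy Om u z - dy Om x0 z * dxx Om u z) * dx Om v z.
  by move=> _; exact: b0_split.
split; first exact: (L1_ext oOm e (L1B oOm (L1B oOm i1 i2) (L1B oOm i3 i4))).
have E : form_b0 Om x0 u v = I (fun z => dxy Om u z * (dy Om x0 z * dy Om v z)) -
    I (fun z => dyy Om u z * (dx Om x0 z * dy Om v z)) -
    (I (fun z => dxy Om u z * (dx Om x0 z * dx Om v z)) -
     I (fun z => dxx Om u z * (dy Om x0 z * dx Om v z))).
  apply: (etrans (esym (integ_eq e))).
  apply: (etrans (integB oOm (L1B oOm i1 i2) (L1B oOm i3 i4))).
  exact: (congr2 (fun x y => x - y) (integB oOm i1 i2) (integB oOm i3 i4)).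
have c1' := le_trans c1 ua; have c2' := le_trans c2 ua; have c3' := le_trans c3 ua.
rewrite E; apply: norm4_le.
- exact: (le_trans b1 (prod3_le (sqrtr_ge0 _) (sqrtr_ge0 _) (sqrtr_ge0 _) c2' nxy nvy)).
- exact: (le_trans b2 (prod3_le (sqrtr_ge0 _) (sqrtr_ge0 _) (sqrtr_ge0 _) c3' nxx nvy)).
- exact: (le_trans b3 (prod3_le (sqrtr_ge0 _) (sqrtr_ge0 _) (sqrtr_ge0 _) c2' nxx nvx)).
- exact: (le_trans b4 (prod3_le (sqrtr_ge0 _) (sqrtr_ge0 _) (sqrtr_ge0 _) c1' nxy nvx)).
Qed.

Lemma normH2_bd u : exists2 m, 0 < m & normH2 u <= m.
Proof.
exists (normH2 u + 1); first by rewrite ltr_wpDl // normH2_ge0.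
by rewrite lerDl.
Qed.

Lemma L1_form_b z0 u v : H20 z0 -> H20 u -> H20 v ->
  L1 (fun z => lap Om z0 z * (dy Om u z * dx Om v z - dx Om u z * dy Om v z)).
Proof.
move=> hz hu hv; have [m m0 hm] := normH2_bd z0; have [a a0 ha] := normH2_bd u.
have [b b0 hb] := normH2_bd v.
exact: (form_b_L1 hz hu hv m0 a0 b0 hm ha hb).1.
Qed.

Lemma L1_form_b0 x0 u v : H20 x0 -> H20 u -> H20 v ->
  L1 (fun z =>
    (dy Om x0 z * dxy Om u z - dx Om x0 z * dyy Om u z) * dy Om v z
    - (dx Om x0 z * dxy Om u z - dy Om x0 z * dxx Om u z) * dx Om v z).
Proof.
move=> hz hu hv; have [m m0 hm] := normH2_bd x0; have [a a0 ha] := normH2_bd u.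
have [b b0 hb] := normH2_bd v.
exact: (form_b0_L1 hz hu hv m0 a0 b0 hm ha hb).1.
Qed.

Lemma lap_lin k u v w : H2 u -> H2 v -> w = (fun z => k * u z + v z) ->
  ae_on Om (fun z => lap Om w z = k * lap Om u z + lap Om v z).
Proof.
move=> hu hv hw; apply: ae_onS (lin_derivs oOm hu hv hw) => z _ [_ _ [a _ b]].
by rewrite /lap a b mulrDr addrACA.
Qed.

Lemma form_b_lin1 k z1 z2 u v : H20 z1 -> H20 z2 -> H20 u -> H20 v ->
  form_b Om (fun z => k * z1 z + z2 z) u v = k * form_b Om z1 u v + form_b Om z2 u v.
Proof.
move=> h1 h2 hu hv.
apply: (integ_lin_ae (L1_form_b h1 hu hv) (L1_form_b h2 hu hv)
  (L1_form_b (H20_lin oOm k h1 h2) hu hv)).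
apply: ae_onS (lap_lin (k := k) (H20_H2 h1) (H20_H2 h2) (erefl _)) => z _ ->.
exact: lin_b1.
Qed.

Lemma form_b_lin2 k z0 u u' v : H20 z0 -> H20 u -> H20 u' -> H20 v ->
  form_b Om z0 (fun z => k * u z + u' z) v = k * form_b Om z0 u v + form_b Om z0 u' v.
Proof.
move=> hz hu hu' hv.
apply: (integ_lin_ae (L1_form_b hz hu hv) (L1_form_b hz hu' hv)
  (L1_form_b hz (H20_lin oOm k hu hu') hv)).
apply: ae_onS (lin_derivs oOm (k := k) (H20_H2 hu) (H20_H2 hu') (erefl _)) => z _ [-> -> _].
exact: lin_b2.
Qed.

Lemma form_b_lin3 k z0 u v v' : H20 z0 -> H20 u -> H20 v -> H20 v' ->
  form_b Om z0 u (fun z => k * v z + v' z) = k * form_b Om z0 u v + form_b Om z0 u v'.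
Proof.
move=> hz hu hv hv'.
apply: (integ_lin_ae (L1_form_b hz hu hv) (L1_form_b hz hu hv')
  (L1_form_b hz hu (H20_lin oOm k hv hv'))).
apply: ae_onS (lin_derivs oOm (k := k) (H20_H2 hv) (H20_H2 hv') (erefl _)) => z _ [-> -> _].
exact: lin_b3.
Qed.

Lemma form_b0_lin1 k x x' u v : H20 x -> H20 x' -> H20 u -> H20 v ->
  form_b0 Om (fun z => k * x z + x' z) u v = k * form_b0 Om x u v + form_b0 Om x' u v.
Proof.
move=> hx hx' hu hv.
apply: (integ_lin_ae (L1_form_b0 hx hu hv) (L1_form_b0 hx' hu hv)
  (L1_form_b0 (H20_lin oOm k hx hx') hu hv)).
apply: ae_onS (lin_derivs oOm (k := k) (H20_H2 hx) (H20_H2 hx') (erefl _)) => z _ [-> -> _].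
exact: lin_b01.
Qed.

Lemma form_b0_lin2 k x u u' v : H20 x -> H20 u -> H20 u' -> H20 v ->
  form_b0 Om x (fun z => k * u z + u' z) v = k * form_b0 Om x u v + form_b0 Om x u' v.
Proof.
move=> hx hu hu' hv.
apply: (integ_lin_ae (L1_form_b0 hx hu hv) (L1_form_b0 hx hu' hv)
  (L1_form_b0 hx (H20_lin oOm k hu hu') hv)).
apply: ae_onS (lin_derivs oOm (k := k) (H20_H2 hu) (H20_H2 hu') (erefl _)) => z _ [_ _ [-> -> ->]].
exact: lin_b02.
Qed.

End forms.

(** * Integral identities on H^2_0 *)

Lemma sign2_eq (R : realType) (X A B : R) : X = (-1) ^+ 2 * A -> X = (-1) ^+ 1 * B -> A = - B.
Proof. by rewrite sqrrN expr1n mul1r expr1 mulN1r => <-. Qed.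

Lemma eqD_opp (R : realType) (x y a b : R) : x = - a -> y = - b -> x + y = - (a + b).
Proof. by move=> -> ->; rewrite opprD. Qed.

(** Pointwise core of [form_b_test]: the right-hand side is minus grad z . grad w for the Jacobian w
    = p_y q_x - p_x q_y, expanded by the product rule with the mixed derivatives identified. *)
Lemma jacobian_identity (R : realType) (zx zy px py pxx pxy pyy qx qy qxx qxy qyy : R) :
  ((qy * pxy - qx * pyy) * zy - (qx * pxy - qy * pxx) * zx) -
  ((py * qxy - px * qyy) * zy - (px * qxy - py * qxx) * zx) =
  -1 * (zx * ((py * qxx + qx * pxy) + -1 * (px * qxy + qy * pxx)) +
     zy * ((py * qxy + qx * pyy) + -1 * (px * qyy + qy * pxy))).
Proof. by ring. Qed.

Lemma le_mul_bound (R : realType) (x y a b K m : R) : 0 <= b -> 0 <= K ->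
  `|x| <= a * b -> `|y| <= a * b -> a <= K -> b <= m -> `|x - y| <= 2 * K * m.
Proof.
move=> b0 K0 hx hy aK bm; have h := normB_le2 hx hy; apply: le_trans h _.
rewrite -mulrA ler_pM2l //; apply: le_trans (ler_wpM2l K0 bm).
exact: ler_wpM2r.
Qed.

Lemma le_mul_boundD (R : realType) (x y a b K m : R) : 0 <= b -> 0 <= K ->
  `|x| <= a * b -> `|y| <= a * b -> a <= K -> b <= m -> `|x + y| <= 2 * K * m.
Proof.
move=> b0 K0 hx hy aK bm; rewrite -[y]opprK.
by apply: (le_mul_bound b0 K0 hx) => //; rewrite normrN.
Qed.

Lemma sub_lin_alg (R : realType) (X Y x x' y y' k : R) :
  X = k * x + x' -> Y = k * y + y' -> X - Y = k * (x - y) + (x' - y').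
Proof. by move=> -> ->; ring. Qed.

Lemma add_lin_alg (R : realType) (X Y x x' y y' k : R) :
  X = k * x + x' -> Y = k * y + y' -> X + Y = k * (x + y) + (x' + y').
Proof. by move=> -> ->; ring. Qed.

Lemma Psi_lin_alg (R : realType) (B B1 B2 C C1 C2 D D1 D2 : R) :
  B = 1 * B1 + B2 -> C = 1 * C1 + C2 -> D = 1 * D1 + D2 ->
  B - (C - D) = 1 * (B1 - (C1 - D1)) + (B2 - (C2 - D2)).
Proof. by move=> -> -> ->; ring. Qed.

(** 108 is three times 36: [form_b] contributes 2 * 2 * 3 * 3 and each [form_b0] contributes 4 * 3 *
    3. *)
Lemma Psi_bound_alg (R : realType) (B C D c a b : R) :
  `|B| <= 2 * (2 * c * (3 * a * (3 * b))) ->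
  `|C| <= 4 * (a * (3 * b * (3 * c))) -> `|D| <= 4 * (b * (3 * a * (3 * c))) ->
  `|B - (C - D)| <= 108 * (c * a * b).
Proof.
move=> hB hC hD.
have -> : 108 * (c * a * b) = 2 * (2 * c * (3 * a * (3 * b))) +
  (4 * (a * (3 * b * (3 * c))) + 4 * (b * (3 * a * (3 * c)))) by ring.
apply: le_trans (ler_normB _ _) _; apply: lerD => //.
by apply: le_trans (ler_normB _ _) _; apply: lerD.
Qed.

Lemma chain_sub_eq (R : realType) (X Y X' Y' U V : R) :
  X = X' -> Y = Y' -> X' = - U -> Y' = - V -> U = V -> X - Y = 0.
Proof. by move=> -> -> -> -> ->; rewrite subrr. Qed.

Lemma sqD_expand (R : realType) (x y : R) : (x + y) ^+ 2 = x ^+ 2 + 2 * (x * y) + y ^+ 2.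
Proof. by ring. Qed.

Lemma semi2_alg (R : realType) (S A B C D E X Y Z : R) :
  S = A + 2 * B + C -> D - B = 0 -> X = Y + C -> Y = A + E -> E = 2 * D ->
  Z = X -> S = Z.
Proof. by move=> -> /eqP; rewrite subr_eq0 => /eqP <- -> -> -> ->. Qed.

Lemma c_alg (R : realType) (Ro A B : R) : A + B = 0 -> B = A -> - Ro^-1 * A = 0.
Proof.
move=> h e; rewrite e in h; have -> : A = 0 by lra.
by rewrite mulr0.
Qed.

Section identities.
Variable R : realType.
Implicit Types (f g h p q u v w : plane R -> R) (k m : R).
Variables (Om : set (plane R)) (oOm : open Om).

Notation L1 := (Lone Om).
Notation L2 := (L2 Om).
Notation I := (integ Om).
Notation test := (test_fun Om).
Notation H20 := (H20 Om).
Notation H2 := (H2 Om).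
Notation n2 := (l2norm Om).
Notation normH2 := (normH2 Om).

Lemma Dx_sub_prod f g f' g' : smooth f -> smooth g -> smooth f' -> smooth g' ->
  Dx (fun z => f z * g z + -1 * (f' z * g' z)) =
  fun z => (f z * Dx g z + g z * Dx f z) + -1 * (f' z * Dx g' z + g' z * Dx f' z).
Proof.
move=> sf sg sf' sg'; have s1 := smoothM sf sg; have s2 := smoothM sf' sg'.
by rewrite (DxD s1 (smoothZ (-1) s2)) (DxZ (-1) s2) (DxM sf sg) (DxM sf' sg').
Qed.

Lemma Dy_sub_prod f g f' g' : smooth f -> smooth g -> smooth f' -> smooth g' ->
  Dy (fun z => f z * g z + -1 * (f' z * g' z)) =
  fun z => (f z * Dy g z + g z * Dy f z) + -1 * (f' z * Dy g' z + g' z * Dy f' z).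
Proof.
move=> sf sg sf' sg'; have s1 := smoothM sf sg; have s2 := smoothM sf' sg'.
by rewrite (DyD s1 (smoothZ (-1) s2)) (DyZ (-1) s2) (DyM sf sg) (DyM sf' sg').
Qed.

Lemma wd_x u w : H2 u -> test w -> I (fun z => u z * Dx w z) = - I (fun z => dx Om u z * w z).
Proof.
move=> hu hw; have := is_wderiv_test (wderivP hu (isT : (1 + 0 <= 2)%N)) hw.
by rewrite !partialE expr1 mulN1r.
Qed.

(** The second weak derivative tested with [w] and the first one tested with [Dx w] involve the same
    integral of u against [Dx (Dx w)]. *)
Lemma wd_xx u w : H2 u -> test w ->
  I (fun z => dxx Om u z * w z) = - I (fun z => dx Om u z * Dx w z).
Proof.
move=> hu hw.
have e1 := is_wderiv_test (wderivP hu (isT : (2 + 0 <= 2)%N)) hw.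
have e2 := is_wderiv_test (wderivP hu (isT : (1 + 0 <= 2)%N)) (test_Dx hw).
rewrite !partialE in e1 e2; exact: (sign2_eq e1 e2).
Qed.

Lemma wd_yy u w : H2 u -> test w ->
  I (fun z => dyy Om u z * w z) = - I (fun z => dy Om u z * Dy w z).
Proof.
move=> hu hw.
have e1 := is_wderiv_test (wderivP hu (isT : (0 + 2 <= 2)%N)) hw.
have e2 := is_wderiv_test (wderivP hu (isT : (0 + 1 <= 2)%N)) (test_Dy hw).
rewrite !partialE in e1 e2; exact: (sign2_eq e1 e2).
Qed.

Lemma wd_xy u w : H2 u -> test w ->
  I (fun z => dxy Om u z * w z) = - I (fun z => dx Om u z * Dy w z).
Proof.
move=> hu hw.
have e1 := is_wderiv_test (wderivP hu (isT : (1 + 1 <= 2)%N)) hw.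
have e2 := is_wderiv_test (wderivP hu (isT : (1 + 0 <= 2)%N)) (test_Dy hw).
rewrite !partialE in e1 e2; exact: (sign2_eq e1 e2).
Qed.

(** For test functions the Jacobian [w] of [p] and [q] is a test function, so the Laplacian of [z0]
    can be integrated by parts against it. Only first derivatives of [z0] survive. *)
Lemma form_b_test z0 p q : H20 z0 -> test p -> test q ->
  form_b Om z0 p q = form_b0 Om q p z0 - form_b0 Om p q z0.
Proof.
move=> hz hp hq; have h2z := H20_H2 hz.
have sp := test_smooth hp; have sq := test_smooth hq.
have [sxp syp] := (smooth_Dx sp, smooth_Dy sp).
have [sxq syq] := (smooth_Dx sq, smooth_Dy sq).
have t1 := test_mul syp (test_Dx hq).
have t2 := test_mul sxp (test_Dy hq).
set w := fun z => Dy p z * Dx q z + -1 * (Dx p z * Dy q z).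
have hw : test w by exact: testD t1 (testZ (-1) t2).
have lw := L2_test oOm hw.
have lwx := L2_test oOm (test_Dx hw); have lwy := L2_test oOm (test_Dy hw).
have wx : Dx w = fun z => (Dy p z * Dx (Dx q) z + Dx q z * Dx (Dy p) z) +
   -1 * (Dx p z * Dx (Dy q) z + Dy q z * Dx (Dx p) z).
  exact: (Dx_sub_prod syp sxq sxp syq).
have wy : Dy w = fun z => (Dy p z * Dy (Dx q) z + Dx q z * Dy (Dy p) z) +
   -1 * (Dx p z * Dy (Dy q) z + Dy q z * Dy (Dx p) z).
  exact: (Dy_sub_prod syp sxq sxp syq).
have dp := test_derivs oOm hp; have dq := test_derivs oOm hq.
have hp20 := test_H20 oOm hp; have hq20 := test_H20 oOm hq.
have llap := L2_lap oOm h2z.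
have e1 : form_b Om z0 p q = I (fun z => lap Om z0 z * w z).
  apply: (integ_ae oOm (L1_form_b oOm hz hp20 hq20) (L2M oOm llap lw)).
  apply: ae_onS2 dp dq => z _ [-> -> _] [-> -> _].
  by rewrite /w mulN1r.
have e2 : I (fun z => lap Om z0 z * w z) =
    I (fun z => dxx Om z0 z * w z) + I (fun z => dyy Om z0 z * w z).
  apply: (etrans _ (integD oOm (L2M oOm (L2_dxx h2z) lw) (L2M oOm (L2_dyy h2z) lw))).
  by apply: integ_eq => z _; rewrite /lap mulrDl.
have e3 := eqD_opp (wd_xx h2z hw) (wd_yy h2z hw).
have i1 := L2M oOm (L2_dx h2z) lwx; have i2 := L2M oOm (L2_dy h2z) lwy.
have e4 := esym (integD oOm i1 i2).
have j1 := L1_form_b0 oOm hq20 hp20 hz; have j2 := L1_form_b0 oOm hp20 hq20 hz.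
have e5 := esym (integB oOm j1 j2).
have e6 := integ_ae oOm (L1B oOm j1 j2) (L1Z oOm (-1) (L1D oOm i1 i2)).
have e7 := integZ oOm (-1) (L1D oOm i1 i2).
apply: (etrans e1); apply: (etrans e2); apply: (etrans e3).
apply: (etrans (congr1 -%R e4)).
apply: esym; apply: (etrans e5); apply: (etrans _ (etrans e7 (mulN1r _))).
apply: e6; apply: ae_onS2 dp dq => z _ [a1 a2 [a3 a4 a5 a6]] [b1 b2 [b3 b4 b5 b6]].
rewrite wx wy -a1 -a2 -a3 -a4 -a5 -a6 -b1 -b2 -b3 -b4 -b5 -b6.
exact: jacobian_identity.
Qed.

(** The defect of the identity, additive and bounded in [u] and in [v], to which [H20_density] is
    applied. *)
Definition Psi z0 u v := form_b Om z0 u v - (form_b0 Om v u z0 - form_b0 Om u v z0).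

Lemma Psi_lin2 z0 u u' v : H20 z0 -> H20 u -> H20 u' -> H20 v ->
  Psi z0 (fun z => 1 * u z + u' z) v = 1 * Psi z0 u v + Psi z0 u' v.
Proof.
move=> hz hu hu' hv.
exact: (Psi_lin_alg (form_b_lin2 oOm 1 hz hu hu' hv) (form_b0_lin2 oOm 1 hv hu hu' hz)
  (form_b0_lin1 oOm 1 hu hu' hv hz)).
Qed.

Lemma Psi_lin3 z0 u v v' : H20 z0 -> H20 u -> H20 v -> H20 v' ->
  Psi z0 u (fun z => 1 * v z + v' z) = 1 * Psi z0 u v + Psi z0 u v'.
Proof.
move=> hz hu hv hv'.
exact: (Psi_lin_alg (form_b_lin3 oOm 1 hz hu hv hv') (form_b0_lin1 oOm 1 hv hv' hu hz)
  (form_b0_lin2 oOm 1 hu hv hv' hz)).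
Qed.

Lemma Psi_bound z0 u v c a b : H20 z0 -> H20 u -> H20 v ->
  0 < c -> 0 < a -> 0 < b -> normH2 z0 <= c -> normH2 u <= a -> normH2 v <= b ->
  `|Psi z0 u v| <= 108 * (c * a * b).
Proof.
move=> hz hu hv c0 a0 b0 hc ha hb.
exact: (Psi_bound_alg (form_b_L1 oOm hz hu hv c0 a0 b0 hc ha hb).2
  (form_b0_L1 oOm hv hu hz b0 a0 c0 hb ha hc).2
  (form_b0_L1 oOm hu hv hz a0 b0 c0 ha hb hc).2).
Qed.

(* The test-function identity extended to [H20] one argument at a time. *)
Lemma form_bE z0 u v : H20 z0 -> H20 u -> H20 v ->
  form_b Om z0 u v = form_b0 Om v u z0 - form_b0 Om u v z0.
Proof.
move=> hz hu hv.
have [c c0 hc] := normH2_bd Om z0.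
suff : Psi z0 u v = 0 by move=> /eqP; rewrite subr_eq0 => /eqP.
have step1 q : test q -> Psi z0 u q = 0.
  move=> hq; have hq20 := test_H20 oOm hq; have [b b0 hb] := normH2_bd Om q.
  apply: (@H20_density _ _ oOm (fun u => Psi z0 u q) (108 * (c * b))) => //.
  - by rewrite !mulr_ge0 ?(ltW c0) ?(ltW b0).
  - by move=> u1 u2 h1 h2; exact: Psi_lin2.
  - move=> u1 m h1 m0 hm; have := Psi_bound hz h1 hq20 c0 m0 b0 hc hm hb.
    by rewrite mulrAC !mulrA.
  - move=> p hp; apply/eqP; rewrite subr_eq0; apply/eqP; exact: form_b_test.
have [a a0 ha] := normH2_bd Om u.
apply: (@H20_density _ _ oOm (fun v => Psi z0 u v) (108 * (c * a))) => //.
- by rewrite !mulr_ge0 ?(ltW c0) ?(ltW a0).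
- by move=> u1 u2 h1 h2; exact: Psi_lin3.
- move=> u1 m h1 m0 hm; have := Psi_bound hz hu h1 c0 a0 m0 hc ha hm.
  by rewrite !mulrA.
Qed.

Lemma lin_prod_ae k f u v w : L2 f -> L2 u -> L2 v -> L2 w ->
  ae_on Om (fun z => w z = k * u z + v z) ->
  I (fun z => f z * w z) = k * I (fun z => f z * u z) + I (fun z => f z * v z).
Proof.
move=> lf lu lv lw h.
apply: (integ_lin_ae oOm (L2M oOm lf lu) (L2M oOm lf lv) (L2M oOm lf lw)).
by apply: ae_onS h => z _ ->; rewrite mulrDr mulrCA.
Qed.

(** For a test function p both integrals reduce to minus the integral of u_x p_xyy, by [wd_xx] and
    [wd_xy]. Only [v] has to be approximated; for [u] its weak derivatives suffice. *)
Lemma dxx_dyy u v : H20 u -> H20 v ->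
  I (fun z => dxx Om u z * dyy Om v z) - I (fun z => dxy Om u z * dxy Om v z) = 0.
Proof.
move=> hu; have h2u := H20_H2 hu; move: v.
have [_ _ _ [b1 b2 b3]] := n2_le_normH2 oOm h2u.
apply: (@H20_density _ _ oOm _ (2 * normH2 u)).
- by rewrite mulr_ge0 // normH2_ge0.
- move=> v v' hv hv'; have [h2 h2'] := (H20_H2 hv, H20_H2 hv').
  have h2w := H2_lin oOm 1 h2 h2'.
  have hl := lin_derivs oOm h2 h2' (erefl (fun z => 1 * v z + v' z)).
  apply: sub_lin_alg.
    apply: (lin_prod_ae (L2_dxx h2u) (L2_dyy h2) (L2_dyy h2') (L2_dyy h2w)).
    by apply: ae_onS hl => z _ [_ _ []].
  apply: (lin_prod_ae (L2_dxy h2u) (L2_dxy h2) (L2_dxy h2') (L2_dxy h2w)).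
  by apply: ae_onS hl => z _ [_ _ []].
- move=> v m hv m0 hm; have h2v := H20_H2 hv.
  have [_ _ _ [c1 c2 c3]] := n2_le_normH2 oOm h2v.
  have k1 := integ_CS oOm (L2_dxx h2u) (L2_dyy h2v).
  have k2 := integ_CS oOm (L2_dxy h2u) (L2_dxy h2v).
  have l1 := le_trans k1 (ler_pM (sqrtr_ge0 _) (sqrtr_ge0 _) b1 c3).
  have l2 := le_trans k2 (ler_pM (sqrtr_ge0 _) (sqrtr_ge0 _) b2 c2).
  exact: (le_mul_bound (normH2_ge0 _ _) (normH2_ge0 _ _) l1 l2 (lexx _) hm).
- move=> p hp; have dp := test_derivs oOm hp; have h2p := test_H2 oOm hp.
  have lxy := L2_test oOm (test_Dx (test_Dy hp)).
  have lyy := L2_test oOm (test_Dy (test_Dy hp)).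
  have e1 : I (fun z => dxx Om u z * dyy Om p z) = I (fun z => dxx Om u z * Dy (Dy p) z).
    apply: (integ_ae oOm (L2M oOm (L2_dxx h2u) (L2_dyy h2p)) (L2M oOm (L2_dxx h2u) lyy)).
    by apply: ae_onS dp => z _ [_ _ [_ _ _ ->]].
  have e2 : I (fun z => dxy Om u z * dxy Om p z) = I (fun z => dxy Om u z * Dx (Dy p) z).
    apply: (integ_ae oOm (L2M oOm (L2_dxy h2u) (L2_dxy h2p)) (L2M oOm (L2_dxy h2u) lxy)).
    by apply: ae_onS dp => z _ [_ _ [_ -> _ _]].
  have e3 := wd_xx h2u (test_Dy (test_Dy hp)).
  have e4 := wd_xy h2u (test_Dx (test_Dy hp)).
  have e5 : I (fun z => dx Om u z * Dx (Dy (Dy p)) z) =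
      I (fun z => dx Om u z * Dy (Dx (Dy p)) z).
    apply: (integ_ae oOm (L2M oOm (L2_dx h2u) (L2_test oOm (test_Dx (test_Dy (test_Dy hp)))))
       (L2M oOm (L2_dx h2u) (L2_test oOm (test_Dy (test_Dx (test_Dy hp)))))).
    have h : ae_on Om (fun z => Dx (Dy (Dy p)) z = Dy (Dx (Dy p)) z) :=
      DxDy_ae oOm (test_Dy hp).
    by apply: ae_onS h => z _ ->.
  exact: (chain_sub_eq e1 e2 e3 e4 e5).
Qed.

(** In the square of the Laplacian the cross term 2 u_xx u_yy integrates to that of 2 u_xy^2, by
    [dxx_dyy] with v = u. *)
Lemma semi2_lap u : H20 u -> semi2 Om u ^+ 2 = I (fun z => lap Om u z ^+ 2).
Proof.
move=> hu; have h2 := H20_H2 hu.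
have e1 := semi2_sq oOm h2.
have e2 : I (fun z => dxx Om u z * dyy Om u z) - I (fun z => dxy Om u z ^+ 2) = 0 :=
  dxx_dyy hu hu.
have i1 := L2sq (L2_dxx h2); have i2 := L2M oOm (L2_dxx h2) (L2_dyy h2).
have i3 := L2sq (L2_dyy h2).
have e3 := integD oOm (L1D oOm i1 (L1Z oOm 2 i2)) i3.
have e4 := integD oOm i1 (L1Z oOm 2 i2).
have e5 := integZ oOm 2 i2.
have e6 : I (fun z => lap Om u z ^+ 2) =
  I (fun z => dxx Om u z ^+ 2 + 2 * (dxx Om u z * dyy Om u z) + dyy Om u z ^+ 2).
  by apply: integ_eq => z _; exact: sqD_expand.
exact (semi2_alg e1 e2 e3 e4 e5 e6).
Qed.

Lemma int_dx_mul u v : H20 u -> H20 v ->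
  I (fun z => dx Om u z * v z) + I (fun z => u z * dx Om v z) = 0.
Proof.
move=> hu; have h2u := H20_H2 hu; move: v.
have [b1 b2 _ _] := n2_le_normH2 oOm h2u.
apply: (@H20_density _ _ oOm _ (2 * normH2 u)).
- by rewrite mulr_ge0 // normH2_ge0.
- move=> v v' hv hv'; have [h2 h2'] := (H20_H2 hv, H20_H2 hv').
  have h2w := H2_lin oOm 1 h2 h2'.
  have hl := lin_derivs oOm h2 h2' (erefl (fun z => 1 * v z + v' z)).
  apply: add_lin_alg.
    apply: (lin_prod_ae (L2_dx h2u) (H2_L2 h2) (H2_L2 h2') (H2_L2 h2w)).
    exact: ae_onT.
  apply: (lin_prod_ae (H2_L2 h2u) (L2_dx h2) (L2_dx h2') (L2_dx h2w)).
  by apply: ae_onS hl => z _ [].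
- move=> v m hv m0 hm; have h2v := H20_H2 hv.
  have [c1 c2 _ _] := n2_le_normH2 oOm h2v.
  have k1 := integ_CS oOm (L2_dx h2u) (H2_L2 h2v).
  have k2 := integ_CS oOm (H2_L2 h2u) (L2_dx h2v).
  have l1 := le_trans k1 (ler_pM (sqrtr_ge0 _) (sqrtr_ge0 _) b2 c1).
  have l2 := le_trans k2 (ler_pM (sqrtr_ge0 _) (sqrtr_ge0 _) b1 c2).
  exact: (le_mul_boundD (normH2_ge0 _ _) (normH2_ge0 _ _) l1 l2 (lexx _) hm).
- move=> p hp; have dp := test_derivs oOm hp; have h2p := test_H2 oOm hp.
  have e1 := wd_x h2u hp.
  have e2 : I (fun z => u z * dx Om p z) = I (fun z => u z * Dx p z).
    apply: (integ_ae oOm (L2M oOm (H2_L2 h2u) (L2_dx h2p))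
      (L2M oOm (H2_L2 h2u) (L2_test oOm (test_Dx hp)))).
    by apply: ae_onS dp => z _ [-> _ _].
  by rewrite e2 e1 subrr.
Qed.

(** By [int_dx_mul] with v = u, the integral of u_x u equals its own opposite. *)
Lemma form_c_diag Ro u : H20 u -> form_c Om Ro u u = 0.
Proof.
move=> hu; have h := int_dx_mul hu hu.
have e : I (fun z => u z * dx Om u z) = I (fun z => dx Om u z * u z).
  by apply: integ_eq => z _; rewrite mulrC.
exact (@c_alg R Ro _ _ h e).
Qed.

End identities.

(** * The energy norm and the error estimate *)

Lemma sq_le_norm (R : realType) (x y : R) : 0 <= y -> x ^+ 2 <= y ^+ 2 -> x <= y.
Proof.
move=> y0 h; apply: le_trans (ler_norm x) _.
by rewrite -(ler_pXn2r (n := 2)) ?nnegrE // real_normK ?num_real.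
Qed.

Lemma triangle_arith (R : realType) (x y z A : R) : 0 <= x -> 0 <= y ->
  `|A| <= y * x -> z ^+ 2 = (-1) ^+ 2 * y ^+ 2 + 2 * -1 * A + x ^+ 2 -> z <= x + y.
Proof.
move=> x0 y0 hA hz; apply: sq_le_norm; first by rewrite addr_ge0.
rewrite hz sqrrN expr1n mul1r.
by move: hA; rewrite ler_norml => /andP[h1 h2]; nra.
Qed.

(** Orthogonal projection in scalars: S = |u|^2, B = |v|^2, A = (v, u). The minimiser t = A / B
    brings t v closest to u, and Cauchy-Schwarz gives |t v| <= |u|. If B = 0 then A = 0, and t = 0
    works. *)
Lemma best_multiple (R : realType) (S A B : R) : 0 <= S -> 0 <= B -> A ^+ 2 <= S * B ->
  exists t, t ^+ 2 * B <= S /\ S - 2 * t * A + t ^+ 2 * B <= S - 2 * A + B.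
Proof.
move=> S0; rewrite le_eqVlt => /predU1P[<-|B0] h.
  exists 0; rewrite !mulr0 mul0r; split => //.
  have : A ^+ 2 <= 0 by move: h; rewrite mulr0.
  rewrite le_eqVlt ltNge sqr_ge0 orbF sqrf_eq0 => /eqP ->; lra.
have bi : B * B^-1 = 1 by rewrite mulfV // gt_eqF.
have bi0 : 0 < B^-1 by rewrite invr_gt0.
exists (A / B); have -> : (A / B) ^+ 2 * B = A ^+ 2 * B^-1.
  by field; rewrite gt_eqF.
split; first by rewrite ler_pdivrMr.
have -> : S - 2 * (A / B) * A + A ^+ 2 * B^-1 = S - A ^+ 2 * B^-1 by ring.
have -> : S - 2 * A + B = S - A ^+ 2 * B^-1 + (A - B) ^+ 2 * B^-1.
  by field; rewrite gt_eqF.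
by rewrite lerDl mulr_ge0 ?sqr_ge0 // ltW.
Qed.

(** One factor [s] is cancelled from the energy identity. The case s = 0 is separate because the
    dual norm controls a quotient by [s]. *)
Lemma apriori_arith (R : realType) (Re Ro s f N : R) : 0 < Re -> 0 < Ro -> 0 <= s ->
  0 <= N -> (s != 0 -> `|f| / s <= N) -> Re^-1 * s ^+ 2 = Ro^-1 * f ->
  s <= Re * Ro^-1 * N.
Proof.
move=> Re0 Ro0 s0 N0 hN h.
case: (eqVneq s 0) => [->|sn0]; first by rewrite !mulr_ge0 ?invr_ge0 // ltW.
have sp : 0 < s by rewrite lt_neqAle eq_sym sn0.
have := hN sn0; rewrite ler_pdivrMr // => hf.
have e : s ^+ 2 = Re * (Ro^-1 * f) by rewrite -h mulrA mulfV ?mul1r // gt_eqF.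
rewrite -(ler_pM2r sp) -expr2 e -!mulrA ler_pM2l // ler_pM2l ?invr_gt0 //.
exact: le_trans (ler_norm f) hf.
Qed.

(* The error equation with [b(psi;lambda,phi) = b(zeta;lambda,phi) + b(psiH;lambda,phi)]:
   only [psi], and not both [psi] and [psiH], multiplies [eta]. *)
Lemma error_equation (R : realType)
  (ap bp cp ah bh ch al ae af bHf bHl cl ce cf be bl bz l : R) :
  ap + bp + cp = l -> ah + bh + ch = l ->
  ap = -1 * -1 * al + ae -> bp = -1 * -1 * bl + be -> cp = -1 * -1 * cl + ce ->
  ah = -1 * -1 * al + af -> bh = -1 * -1 * bHl + bHf -> ch = -1 * -1 * cl + cf ->
  bl = -1 * -1 * bHl + bz -> bHf = 0 -> cf = 0 ->
  af = ae + be + ce + bz.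
Proof. by move=> *; lra. Qed.

(** Multiply the error equation by Re and divide by |phi|_2. The terms a, c and b contribute 1, Re
    Ro^-1 G2 and Re G1 |psi|_2 to the factor of |eta|_2; the two [form_b0] terms contribute 2 Re C L
    |lambda|_2 to that of |zeta|_1. *)
Lemma error_bound (R : realType) (Re Ro G1 G2 C L N sp se sf sl s1 ae be ce z1 z2 : R) :
  0 < Re -> 0 < Ro -> 0 < G1 -> 0 < G2 -> 0 < C -> 0 <= L ->
  0 <= se -> 0 <= sf -> 0 <= sl -> 0 <= s1 -> 0 <= sp ->
  sl <= sp -> sp <= Re * Ro^-1 * N ->
  Re^-1 * sf ^+ 2 = Re^-1 * ae + be + ce + (z1 - z2) ->
  `|ae| <= se * sf -> be <= G1 * sp * se * sf -> ce <= Ro^-1 * G2 * se * sf ->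
  `|z1| <= C * L * sf * s1 * sl -> `|z2| <= C * L * sl * s1 * sf ->
  sf <= (1 + Re * Ro^-1 * G2 + Re ^+ 2 * Ro^-1 * G1 * N) * se +
    2 * Re ^+ 2 * Ro^-1 * C * N * L * s1.
Proof.
move=> Re0 Ro0 G10 G20 C0 L0 se0 sf0 sl0 s10 sp0 hls hsp h hae hbe hce hz1 hz2.
have N0 : 0 <= Re * Ro^-1 * N := le_trans sp0 hsp.
(* [M] bounds |psi|_2, hence also |lambda|_2; it carries the second factor Re of the quadratic
   constants. *)
set M := Re * Ro^-1 * N in hsp N0.
have -> : (1 + Re * Ro^-1 * G2 + Re ^+ 2 * Ro^-1 * G1 * N) * se +
    2 * Re ^+ 2 * Ro^-1 * C * N * L * s1 =
    (1 + Re * Ro^-1 * G2 + Re * (G1 * M)) * se + Re * (2 * (C * L * s1 * M)).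
  by rewrite /M; ring.
clearbody M.
have Ri : 0 < Ro^-1 by rewrite invr_gt0.
have Rr : 0 < Re^-1 by rewrite invr_gt0.
(* Division by [sf] is impossible here, but the right-hand side is nonnegative. *)
case: (eqVneq sf 0) => [->|sfn].
  have p1 : 0 <= Re * Ro^-1 * G2 by rewrite !mulr_ge0 //; exact: ltW.
  have p2 : 0 <= Re * (G1 * M) by rewrite !mulr_ge0 //; exact: ltW.
  have p3 : 0 <= Re * (2 * (C * L * s1 * M)) by rewrite !mulr_ge0 //; exact: ltW.
  by apply: addr_ge0 p3; apply: mulr_ge0 se0; rewrite !addr_ge0.
have sfp : 0 < sf by rewrite lt_neqAle eq_sym sfn.
rewrite -(ler_pM2r sfp).
have h1 : sf * sf = Re * (Re^-1 * sf ^+ 2) by rewrite mulrA mulfV ?mul1r // gt_eqF.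
have b1 : Re * (Re^-1 * ae) <= se * sf.
  rewrite mulrA mulfV ?gt_eqF // mul1r.
  exact: le_trans (ler_norm _) hae.
have b2 : be <= G1 * M * se * sf.
  apply: le_trans hbe _; rewrite -!mulrA ler_pM2l //.
  by apply: ler_wpM2r => //; rewrite mulr_ge0.
have z1b : z1 <= C * L * s1 * M * sf.
  apply: le_trans (ler_norm _) _; apply: le_trans hz1 _.
  have -> : C * L * sf * s1 * sl = C * L * s1 * sl * sf by ring.
  apply: ler_wpM2r => //; apply: ler_wpM2l; first by rewrite !mulr_ge0 //; exact: ltW.
  exact: le_trans hls hsp.
have z2b : - z2 <= C * L * s1 * M * sf.
  apply: le_trans (ler_norm _) _; rewrite normrN; apply: le_trans hz2 _.
  have -> : C * L * sl * s1 * sf = C * L * s1 * sl * sf by ring.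
  apply: ler_wpM2r => //; apply: ler_wpM2l; first by rewrite !mulr_ge0 //; exact: ltW.
  exact: le_trans hls hsp.
have b3 : be + ce + (z1 - z2) <=
    G1 * M * se * sf + Ro^-1 * G2 * se * sf + (C * L * s1 * M * sf + C * L * s1 * M * sf).
  by apply: lerD; [exact: lerD|exact: lerD].
have b4 := ler_wpM2l (ltW Re0) b3.
rewrite h1 h.
have -> : Re * (Re^-1 * ae + be + ce + (z1 - z2)) =
  Re * (Re^-1 * ae) + Re * (be + ce + (z1 - z2)) by ring.
apply: le_trans (lerD b1 b4) _.
by rewrite le_eqVlt; apply/orP; left; apply/eqP; ring.
Qed.

Lemma quad_alg (R : realType) (k W U V Euv Evu Ewu Ewv Euu Evv Euw Evw : R) :
  Ewu = W -> Ewu = k * Euw + Evw -> Euw = k * Euu + Euv -> Evw = k * Evu + Evv ->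
  Euu = U -> Evv = V -> Evu = Euv -> W = k ^+ 2 * U + 2 * k * Euv + V.
Proof. by move=> <- -> -> -> -> -> ->; ring. Qed.

Lemma jacobian_diag (R : realType) (l a b : R) : l * (a * b - b * a) = 0.
Proof. by ring. Qed.

Lemma dx_mul_alg (R : realType) (k b c w : R) : (k * b + c) * w = k * (b * w) + c * w.
Proof. by ring. Qed.

Lemma scale_lin_alg (R : realType) (r k A B C : R) : A = k * B + C ->
  r * A = k * (r * B) + r * C.
Proof. by move=> ->; ring. Qed.

Section energy.
Variable R : realType.
Implicit Types (f g h p q u v w : plane R -> R) (k m : R).
Variables (Om : set (plane R)) (oOm : open Om).

Notation I := (integ Om).
Notation H20 := (H20 Om).
Notation H2 := (H2 Om).
Notation semi2 := (semi2 Om).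

Definition energy u v := I (fun z => lap Om u z * lap Om v z).

Lemma semi2_ge0 u : 0 <= semi2 u. Proof. exact: sqrtr_ge0. Qed.
Lemma semi1_ge0 u : 0 <= semi1 Om u. Proof. exact: sqrtr_ge0. Qed.

Lemma energyC u v : energy u v = energy v u.
Proof. by apply: integ_eq => z _; rewrite mulrC. Qed.

Lemma energy_diag u : H20 u -> energy u u = semi2 u ^+ 2.
Proof. by move=> hu; apply: esym; exact: (semi2_lap oOm hu). Qed.

Lemma energy_lin2 k u v w : H20 u -> H20 v -> H20 w ->
  energy w (fun z => k * u z + v z) = k * energy w u + energy w v.
Proof.
move=> /(@H20_H2 _ _ _) hu /(@H20_H2 _ _ _) hv /(@H20_H2 _ _ _) hw.
apply: (lin_prod_ae oOm (L2_lap oOm hw) (L2_lap oOm hu) (L2_lap oOm hv)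
  (L2_lap oOm (H2_lin oOm k hu hv))).
exact: (lap_lin oOm hu hv (erefl _)).
Qed.

Lemma energy_lin1 k u v w : H20 u -> H20 v -> H20 w ->
  energy (fun z => k * u z + v z) w = k * energy u w + energy v w.
Proof.
by move=> hu hv hw; rewrite !(energyC _ w); exact: energy_lin2.
Qed.

Lemma energy_CS u v : H20 u -> H20 v -> `|energy u v| <= semi2 u * semi2 v.
Proof.
move=> hu hv; have h := integ_CS oOm (L2_lap oOm (H20_H2 hu)) (L2_lap oOm (H20_H2 hv)).
have e (w : plane R -> R) : H20 w -> Num.sqrt (I (fun z => lap Om w z ^+ 2)) = semi2 w.
  move=> hw; rewrite -[RHS](ger0_norm (semi2_ge0 w)) -sqrtr_sqr; congr Num.sqrt.
  exact: esym (semi2_lap oOm hw).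
by rewrite -(e _ hu) -(e _ hv).
Qed.

Lemma semi2_lin k u v : H20 u -> H20 v ->
  semi2 (fun z => k * u z + v z) ^+ 2 =
  k ^+ 2 * semi2 u ^+ 2 + 2 * k * energy u v + semi2 v ^+ 2.
Proof.
move=> hu hv; have hw := H20_lin oOm k hu hv.
have e1 := energy_lin1 k hu hv hw.
have e2 := energy_lin2 k hu hv hu; have e3 := energy_lin2 k hu hv hv.
exact (quad_alg k (energy_diag hw) e1 e2 e3 (energy_diag hu) (energy_diag hv) (energyC v u)).
Qed.

Lemma form_aE Re u v : form_a Om Re u v = Re^-1 * energy u v.
Proof. by []. Qed.

(** The Jacobian of a function with itself vanishes pointwise, so no density argument is
    involved. *)
Lemma form_b_diag z0 u : form_b Om z0 u u = 0.
Proof.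
apply: (etrans _ (integ0 oOm)); apply: integ_eq => z _.
exact: jacobian_diag.
Qed.

Lemma form_c_lin1 Ro k u v w : H20 u -> H20 v -> H20 w ->
  form_c Om Ro (fun z => k * u z + v z) w = k * form_c Om Ro u w + form_c Om Ro v w.
Proof.
move=> hu hv hw; have [h2u h2v] := (H20_H2 hu, H20_H2 hv).
have lw := H2_L2 (H20_H2 hw).
have h2 := H2_lin oOm k h2u h2v.
have e := integ_lin_ae oOm (L2M oOm (L2_dx h2u) lw) (L2M oOm (L2_dx h2v) lw)
  (L2M oOm (L2_dx h2) lw).
have h := lin_derivs oOm h2u h2v (erefl (fun z => k * u z + v z)).
have h' : ae_on Om (fun z => dx Om (fun z0 => k * u z0 + v z0) z * w z =
    k * (dx Om u z * w z) + dx Om v z * w z).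
  by apply: ae_onS h => z _ [-> _ _]; exact: dx_mul_alg.
exact (scale_lin_alg (- Ro^-1) (e k h')).
Qed.

(** Links the two notions of a nonzero function: the supremum in [normHm2] excludes functions that
    vanish almost everywhere, whereas dividing requires a nonzero seminorm. The zero function is a
    weak derivative of such a [u] of every order. *)
Lemma semi2_ae0 u : H20 u -> eq_on Om u (fun=> 0) -> semi2 u = 0.
Proof.
move=> hu u0; have h2 := H20_H2 hu.
have t0 := test0 Om; have l0 := L2_test oOm t0.
have d0 i j : is_wderiv Om i j u (fun=> 0).
  split=> // p hp.
  have e1 : I (fun z => u z * partial i j p z) = 0.
    apply: (etrans _ (integ0 oOm)).
    have lp := L2_test oOm (test_partial i j hp).
    apply: (integ_ae oOm (L2M oOm (H2_L2 h2) lp)).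
      by apply: (L1_ext oOm _ (L2M oOm l0 lp)) => z _; rewrite mul0r.
    by apply: ae_onS (u0 : ae_on Om (fun z => u z = 0)) => z _ ->; rewrite mul0r.
  have e2 : I (fun z => 0 * p z) = 0.
    by apply: (etrans _ (integ0 oOm)); apply: integ_eq => z _; rewrite mul0r.
  by rewrite e1 e2 mulr0.
have lap0 : ae_on Om (fun z => lap Om u z = 0).
  apply: ae_onS2 (wderiv_eq oOm (d0 2 0)) (wderiv_eq oOm (d0 0 2)) => z _ a b.
  by rewrite /lap /dxx /dyy a b addr0.
apply/eqP; rewrite -sqrf_eq0 (semi2_lap oOm hu); apply/eqP.
apply: (etrans _ (integ0 oOm)).
apply: (integ_ae oOm (L2sq (L2_lap oOm h2))).
  by apply: (L1_ext oOm _ (L2sq l0)) => z _; rewrite expr0n.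
by apply: ae_onS lap0 => z _ ->; rewrite expr0n.
Qed.

Lemma normHm2_bound F u : Hm2 Om F -> H20 u ->
  0 <= normHm2 Om F /\ (semi2 u != 0 -> `|F u| / semi2 u <= normHm2 Om F).
Proof.
move=> [_ [M hM]] hu.
rewrite /normHm2; set S := [set _ | _ in _].
have ubS : ubound S `|M|.
  move=> _ [v [hv _] <-].
  (* Where the seminorm vanishes, the quotient is 0 by the convention for inverses. *)
  case: (eqVneq (semi2 v) 0) => [->|sn]; first by rewrite invr0 mulr0.
  have sp : 0 < semi2 v by rewrite lt_neqAle eq_sym sn semi2_ge0.
  rewrite ler_pdivrMr //; apply: le_trans (hM _ hv) _.
  by apply: ler_wpM2r; [exact: ltW|exact: ler_norm].
have inS v : H20 v -> ~ eq_on Om v (fun=> 0) -> `|F v| / semi2 v <= sup S.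
  move=> hv nv; apply: ub_le_sup; first by exists `|M|.
  by exists v.
split; last first.
  move=> sn; apply: inS => // h; move: sn; rewrite semi2_ae0 ?eqxx //.
case: (pselect (exists2 v, H20 v & ~ eq_on Om v (fun=> 0))) => [[v hv nv]|nS].
  by apply: le_trans (inS v hv nv); rewrite divr_ge0 // semi2_ge0.
(* If no function in [H20] is nonzero, the supremum is over the empty set and equals 0 by
   convention. *)
rewrite (_ : S = set0) ?sup0 //; apply/seteqP; split => // x [v [hv nv] _].
by case: nS; exists v.
Qed.

End energy.

(** * Finite element spaces, best approximation and the final estimate *)

Lemma fe_space_lin (R : realType) (Om : set (plane R)) T V k u v :
  fe_space Om T V -> V u -> V v -> V (fun z => k * u z + v z).
Proof.
move=> [_ _ [n [e ->]]] [a _ <-] [b _ <-].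
exists (fun i => k * a i + b i) => //; apply/funext => z.
rewrite mulr_sumr -big_split /=; apply: eq_bigr => i _.
by rewrite mulrDl mulrA.
Qed.

Lemma fe_space_nonempty (R : realType) (Om : set (plane R)) T V :
  fe_space Om T V -> exists u, V u.
Proof. by move=> [_ _ [n [e ->]]]; exists (fun z => \sum_(i < n) 0 * e i z); exists (fun=> 0). Qed.

(** The hypothesis says that (x - r) / c is a lower bound of [S], hence at most its infimum; the
    infimum need not be attained. *)
Lemma inf_bound (R : realType) (S : set R) (x c r : R) : 0 < c -> S !=set0 ->
  (forall y, S y -> x <= c * y + r) -> x <= c * inf S + r.
Proof.
move=> c0 S0 h; rewrite -lerBlDr mulrC -ler_pdivrMr //.
apply: lb_le_inf => // y Sy; rewrite ler_pdivrMr // mulrC lerBlDr.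
exact: h.
Qed.

Lemma add_bounds (R : realType) (x e f a r c : R) : x <= e + f ->
  f <= a * e + r -> c = 1 + a -> x <= c * e + r.
Proof. by move=> h1 h2 ->; lra. Qed.

Lemma le_const (R : realType) (K1 K2 e e0 r : R) : 0 <= K1 -> e <= e0 -> K1 = K2 ->
  K1 * e + r <= K2 * e0 + r.
Proof. by move=> h1 h2 <-; rewrite lerD2r; exact: ler_wpM2l. Qed.

Lemma approximant_alg (R : realType) (t sw sv su suw suv A E Aw : R) :
  sw = (t - 1) ^+ 2 * sv + 2 * (t - 1) * E + sv -> E = sv -> Aw = (t - 1) * A + A ->
  suw = su - 2 * Aw + sw -> suv = su - 2 * A + sv ->
  t ^+ 2 * sv <= su -> su - 2 * t * A + t ^+ 2 * sv <= su - 2 * A + sv ->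
  sw <= su /\ suw <= suv.
Proof.
move=> -> -> -> -> -> h1 h2.
have -> : (t - 1) ^+ 2 * sv + 2 * (t - 1) * sv + sv = t ^+ 2 * sv by ring.
by split => //; apply: le_trans h2; rewrite le_eqVlt; apply/orP; left; apply/eqP; ring.
Qed.

Lemma back_sub (R : realType) (a b : R) : b = -1 * -1 * a + (-1 * a + b).
Proof. by ring. Qed.

Lemma sub_sub_alg (R : realType) (a b c : R) : -1 * a + b - (-1 * a + c) = b - c.
Proof. by ring. Qed.

Lemma quad_sub_alg (R : realType) (W V E U : R) :
  W = (-1) ^+ 2 * V + 2 * -1 * E + U -> W = U - 2 * E + V.
Proof. by move=> ->; ring. Qed.

Section estimate.
Variable R : realType.
Variables (Om : set (plane R)) (oOm : open Om).
Notation H20 := (H20 Om).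
Notation semi2 := (semi2 Om).
Implicit Types (u v w : plane R -> R).

Lemma semi2_sub u v : H20 u -> H20 v ->
  semi2 (u - v) ^+ 2 = semi2 u ^+ 2 - 2 * energy Om v u + semi2 v ^+ 2.
Proof.
move=> hu hv; rewrite sub_linE; have h := semi2_lin oOm (-1) hv hu.
exact: (quad_sub_alg h).
Qed.

Lemma semi2_triangle u v : H20 u -> H20 v -> semi2 (u - v) <= semi2 u + semi2 v.
Proof.
move=> hu hv; rewrite sub_linE.
exact: (triangle_arith (semi2_ge0 _ _) (semi2_ge0 _ _) (energy_CS oOm hv hu)
  (semi2_lin oOm (-1) hv hu)).
Qed.

(* [k + 1] is the coefficient of the projection of [u] on the line of [v]. *)
Lemma bounded_approximant u v : H20 u -> H20 v -> exists k,
  let w := fun z => k * v z + v z in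
  semi2 w <= semi2 u /\ semi2 (u - w) <= semi2 (u - v).
Proof.
move=> hu hv.
have CS : energy Om v u ^+ 2 <= semi2 u ^+ 2 * semi2 v ^+ 2.
  rewrite -exprMn -real_normK ?num_real //.
  rewrite ler_pXn2r ?nnegrE ?mulr_ge0 ?semi2_ge0 // mulrC.
  exact: energy_CS.
have [t [t1 t2]] := best_multiple (sqr_ge0 _) (sqr_ge0 _) CS.
exists (t - 1); cbv zeta.
have hw := H20_lin oOm (t - 1) hv hv.
have e1 := semi2_lin oOm (t - 1) hv hv.
have e2 := energy_lin1 oOm (t - 1) hv hv hu.
have e3 := semi2_sub hu hw; have e4 := semi2_sub hu hv.
have e5 := energy_diag oOm hv.
have [r1 r2] := approximant_alg e1 e5 e2 e3 e4 t1 t2.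
split; apply: sq_le_norm => //; exact: semi2_ge0.
Qed.

End estimate.

Theorem theorem2 (R : realType) (Om : set (plane R))
  (hOm : bounded_sc_domain Om)
  (Re Ro : R) (hRe : 0 < Re) (hRo : 0 < Ro)
  (F : (plane R -> R) -> R) (hF : Hm2 Om F)
  (Gamma1 Gamma2 : R) (hGamma1 : 0 < Gamma1) (hGamma2 : 0 < Gamma2)
  (hb : forall zeta psi chi, H20 Om zeta -> H20 Om psi -> H20 Om chi ->
     form_b Om zeta psi chi
       <= Gamma1 * semi2 Om zeta * semi2 Om psi * semi2 Om chi)
  (hc : forall psi chi, H20 Om psi -> H20 Om chi ->
     form_c Om Ro psi chi <= Ro^-1 * Gamma2 * semi2 Om psi * semi2 Om chi)
  (* coarse mesh and space *)
  (TH : seq (3.-tuple (plane R))) (XH : set (plane R -> R))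
  (hXH : fe_space Om TH XH)
  (* family of fine meshes and spaces; the constants c0 and C are uniform *)
  (I : Type) (Th : I -> seq (3.-tuple (plane R)))
  (Xh : I -> set (plane R -> R))
  (hXh : forall i, fe_space Om (Th i) (Xh i))
  (hmesh : forall i, 0 < mesh_size (Th i) /\ mesh_size (Th i) < mesh_size TH)
  (c0 : R)
  (hinv : forall i phi, Xh i phi ->
     (grad_sup Om phi
       <= (c0 * Num.sqrt `|ln (mesh_size (Th i))| * semi2 Om phi)%:E)%E)
  (C : R) (hC : 0 < C)
  (hb0 : forall i chi psi xi, Xh i chi -> H20 Om psi -> H20 Om xi ->
     `|form_b0 Om psi chi xi|
       <= C * Num.sqrt `|ln (mesh_size (Th i))|
            * semi2 Om psi * semi1 Om xi * semi2 Om chi)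
  (* consequences of the small data condition *)
  (hweak : uniquely_solvable Om Re Ro F (H20 Om))
  (hcoarse : uniquely_solvable Om Re Ro F XH)
  (psi : plane R -> R) (hpsi : nonlinear_sol Om Re Ro F (H20 Om) psi)
  (psiH : plane R -> R) (hpsiH : nonlinear_sol Om Re Ro F XH psiH)
  (i : I) (psih : plane R -> R)
  (hpsih : linear_sol Om Re Ro F psiH (Xh i) psih) :
  let C1 := 2 + Re * Ro^-1 * Gamma2
              + Re ^+ 2 * Ro^-1 * Gamma1 * normHm2 Om F in
  let C2 := 2 * Re ^+ 2 * Ro^-1 * C * normHm2 Om F in
  semi2 Om (psi - psih)
    <= C1 * inf [set semi2 Om (psi - lambda) | lambda in Xh i]
       + C2 * Num.sqrt `|ln (mesh_size (Th i))| * semi1 Om (psi - psiH).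

Proof.
pose C1 := 2 + Re * Ro^-1 * Gamma2 + Re ^+ 2 * Ro^-1 * Gamma1 * normHm2 Om F.
pose C2 := 2 * Re ^+ 2 * Ro^-1 * C * normHm2 Om F.
change (semi2 Om (psi - psih)
  <= C1 * inf [set semi2 Om (psi - lambda) | lambda in Xh i]
     + C2 * Num.sqrt `|ln (mesh_size (Th i))| * semi1 Om (psi - psiH)).
have oOm : open Om by case: hOm.
have [_ subH _] := hXH; have [_ subh _] := hXh i.
have [hp20 wp] := hpsi; have [hH wH] := hpsiH; have [hh wh] := hpsih.
have hH20 := subH _ hH; have hh20 := subh _ hh.
have [N0 hN] := normHm2_bound oOm hF hp20.
(* The weak problem tested with [psi] itself: [form_b] and [form_c] drop out and only the energy
   identity remains. *)
have hap : semi2 Om psi <= Re * Ro^-1 * normHm2 Om F.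
  apply: (apriori_arith hRe hRo (semi2_ge0 Om psi) N0 hN).
  have := wp _ hp20.
  rewrite (form_b_diag oOm) (form_c_diag oOm Ro hp20) !addr0 form_aE.
  by rewrite (energy_diag oOm hp20).
set L := Num.sqrt `|ln (mesh_size (Th i))|.
have L0 : 0 <= L by exact: sqrtr_ge0.
have p2 : 0 <= Re * Ro^-1 * Gamma2 by rewrite !mulr_ge0 ?invr_ge0 //; exact: ltW.
have p3 : 0 <= Re ^+ 2 * Ro^-1 * Gamma1 * normHm2 Om F.
  by rewrite !mulr_ge0 ?invr_ge0 ?sqr_ge0 //; exact: ltW.
have C10 : 0 < C1 by rewrite /C1; lra.
have zeta20 := H20B oOm hp20 hH20.
have key lam0 : Xh i lam0 -> semi2 Om (psi - psih) <=
    C1 * semi2 Om (psi - lam0) + C2 * L * semi1 Om (psi - psiH).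
  move=> hlam0; have hlam020 := subh _ hlam0.
  have [k] := bounded_approximant oOm hp20 hlam020; cbv zeta.
  set lam := fun z => k * lam0 z + lam0 z => -[lam_le eta_le].
  have hlam : Xh i lam by exact: (fe_space_lin k (hXh i) hlam0 hlam0).
  have hl20 := subh _ hlam.
  (* Differences are written in the shape [k * u + v] of the linearity lemmas; undoing them below
     produces the coefficient [-1 * -1]. *)
  pose phi := fun z => -1 * lam z + psih z.
  have hphi : Xh i phi by exact: (fe_space_lin (-1) (hXh i) hlam hh).
  have hphi20 := subh _ hphi.
  pose eta := fun z => -1 * lam z + psi z.
  have heta20 : H20 Om eta by exact: H20_lin.
  pose zeta := fun z => -1 * psiH z + psi z.
  have hzeta20 : H20 Om zeta by exact: H20_lin.
  have psiE : psi = fun z => -1 * -1 * lam z + eta z.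
    by apply/funext => z; exact: back_sub.
  have psihE : psih = fun z => -1 * -1 * lam z + phi z.
    by apply/funext => z; exact: back_sub.
  have psiE' : psi = fun z => -1 * -1 * psiH z + zeta z.
    by apply/funext => z; exact: back_sub.
  (* [phi] lies in [Xh i] and therefore in [H20], so it is admissible in both problems. *)
  have q1 := wp _ hphi20; have q2 := wh _ hphi.
  have a1 : form_a Om Re psi phi = -1 * -1 * form_a Om Re lam phi + form_a Om Re eta phi.
    rewrite {1}psiE !form_aE; apply: scale_lin_alg; exact: energy_lin1.
  have a2 : form_a Om Re psih phi = -1 * -1 * form_a Om Re lam phi + form_a Om Re phi phi.
    rewrite {1}psihE !form_aE; apply: scale_lin_alg; exact: energy_lin1.
  have b1 : form_b Om psi psi phi = -1 * -1 * form_b Om psi lam phi + form_b Om psi eta phi.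
    by rewrite {2}psiE; exact: form_b_lin2.
  have b2 : form_b Om psiH psih phi = -1 * -1 * form_b Om psiH lam phi + form_b Om psiH phi phi.
    by rewrite {1}psihE; exact: form_b_lin2.
  have b3 : form_b Om psi lam phi = -1 * -1 * form_b Om psiH lam phi + form_b Om zeta lam phi.
    by rewrite {1}psiE'; exact: form_b_lin1.
  have c1 : form_c Om Ro psi phi = -1 * -1 * form_c Om Ro lam phi + form_c Om Ro eta phi.
    by rewrite {1}psiE; exact: form_c_lin1.
  have c2 : form_c Om Ro psih phi = -1 * -1 * form_c Om Ro lam phi + form_c Om Ro phi phi.
    by rewrite {1}psihE; exact: form_c_lin1.
  have b4 := form_b_diag oOm psiH phi.
  have c3 := form_c_diag oOm Ro hphi20.
  have E := error_equation q1 q2 a1 b1 c1 a2 b2 c2 b3 b4 c3.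
  have E' : Re^-1 * semi2 Om phi ^+ 2 = Re^-1 * energy Om eta phi +
     form_b Om psi eta phi + form_c Om Ro eta phi +
     (form_b0 Om phi lam zeta - form_b0 Om lam phi zeta).
    by rewrite -(energy_diag oOm hphi20) -(form_bE oOm hzeta20 hl20 hphi20).
  (* In the logarithmic estimate the finite element function is the middle argument of [form_b0]: it
     is [lam] here and [phi] in the next line. *)
  have z1 := hb0 i lam phi zeta hlam hphi20 hzeta20.
  have z2 := hb0 i phi lam zeta hphi hl20 hzeta20.
  have hphi_le := error_bound hRe hRo hGamma1 hGamma2 hC L0 (semi2_ge0 Om eta)
    (semi2_ge0 Om phi) (semi2_ge0 Om lam) (semi1_ge0 Om zeta) (semi2_ge0 Om psi)
    lam_le hap E' (energy_CS oOm heta20 hphi20) (hb _ _ _ hp20 heta20 hphi20)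
    (hc _ _ heta20 hphi20) z1 z2.
  have tri := semi2_triangle oOm heta20 hphi20.
  have etaE : eta = psi - lam by rewrite sub_linE.
  have zetaE : zeta = psi - psiH by rewrite sub_linE.
  have diffE : eta - phi = psi - psih.
    by apply/funext => z; exact: sub_sub_alg.
  rewrite diffE in tri.
  (* Adding |eta|_2 from the triangle inequality raises the leading 1 of [error_bound] to the 2 of
     [C1]. *)
  have step := add_bounds tri hphi_le (erefl _).
  rewrite zetaE in step.
  apply: le_trans step _.
  apply: le_const; [| |].
  - by rewrite !addr_ge0.
  - by rewrite etaE.
  - by rewrite /C1; ring.
apply: inf_bound => //.
  have [u hu] := fe_space_nonempty (hXh i).
  by exists (semi2 Om (psi - u)); exists u.
by move=> _ [lam0 hlam0 <-]; exact: key.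
Qed.
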